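(* The $\mathcal{S}^*_{car}$-radius (the largest $r$ such that $f(rz)/r\in\mathcal{S}^*_{car}$ for every $f$ in the class) for the following subclasses of starlike functions is: (a) for $\mathcal{S}^*(\sqrt{1+cz})$ with $3/4<c\leq 1$: $r_1=\dfrac{3}{4c}$; (b) for $\mathcal{S}^*_L(\alpha)$ with $0\leq \alpha<1/2$: $r_2=\dfrac{3-4\alpha}{4(1-\alpha)^2}$; (c) for $\mathcal{S}^*_e(\alpha)$ with $0\leq \alpha<\dfrac{e-2}{2(e-1)}$: $r_3=\log\left(\dfrac{2(1-\alpha)}{1-2\alpha}\right)$; (d) for $\mathcal{S}^*_{RL}$: $r_4=\dfrac{1}{82}(39+17\sqrt{2})\approx 0.7688$; (e) for $\mathcal{S}^*_C$: $r_5=\dfrac{1}{2}$; (f) for $\mathcal{S}^*_{lim}$: $r_6=\sqrt{2}-1\approx 0.414$; (g) for $\mathcal{S}^*_{\mathrm{crescent}}$: $r_7=\dfrac{3}{4}$; (h) for $\mathcal{S}^*_{sin}$: $r_8=\sin^{-1}(1/2)\approx 0.523598$; (i) for $\mathcal{S}^*_{ne}$: $r_9\approx 0.557875$, where $r_9$ is the smallest positive real root of $2r^3-6r+3=0$ in $(0,1)$. All bounds are sharp.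
   Context: Let $\mathbb{D}$ be the unit disk, $\mathbb{D}_r=\{|z|<r\}$, and $\mathcal{A}$ the class of analytic $f$ on $\mathbb{D}$ with $f(0)=f'(0)-1=0$. For a Ma–Minda function $\varphi$, $\mathcal{S}^*(\varphi)$ denotes the class of $f\in\mathcal{A}$ with $zf'(z)/f(z)\prec\varphi(z)$ in $\mathbb{D}$. Here $\mathcal{S}^*_{car}=\mathcal{S}^*(\phi_{car})$ with $\phi_{car}(z)=1+z+z^2/2$, whose image $\phi_{car}(\mathbb{D})$ is the domain bounded by the cardioid $(4x^2+4y^2-8x-1)^2+4(4x^2+4y^2-12x+1)=0$. The classes are: $\mathcal{S}^*(\sqrt{1+cz})$ ($0<c\leq1$); $\mathcal{S}^*_L(\alpha)=\mathcal{S}^*(\alpha+(1-\alpha)\sqrt{1+z})$; $\mathcal{S}^*_e(\alpha)=\mathcal{S}^*(\alpha+(1-\alpha)e^z)$ ($0\le\alpha<1$); $\mathcal{S}^*_{RL}=\mathcal{S}^*\big(\sqrt{2}-(\sqrt{2}-1)((1-z)/(1+2(\sqrt{2}-1)z))^{1/2}\big)$; $\mathcal{S}^*_C=\mathcal{S}^*(1+4z/3+2z^2/3)$; $\mathcal{S}^*_{lim}=\mathcal{S}^*(1+\sqrt{2}z+z^2/2)$; $\mathcal{S}^*_{\mathrm{crescent}}=\mathcal{S}^*(z+\sqrt{1+z^2})$ (the class of starlike functions associated with a crescent-shaped region); $\mathcal{S}^*_{sin}=\mathcal{S}^*(1+\sin z)$; $\mathcal{S}^*_{ne}=\mathcal{S}^*(1+z-z^3/3)$.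 *)

(* Defs.v *)
From Stdlib Require Import Reals.
From Coquelicot Require Import Coquelicot.
Open Scope R_scope.

(* principal branch of the complex square root (argument in (-pi/2, pi/2]) *)
Definition Csqrt (z : C) : C :=
  (sqrt ((Cmod z + fst z) / 2),
   if Rle_dec 0 (snd z) then sqrt ((Cmod z - fst z) / 2)
   else - sqrt ((Cmod z - fst z) / 2)).

Definition Cexp (z : C) : C := (exp (fst z) * cos (snd z), exp (fst z) * sin (snd z)).

Definition Csin (z : C) : C :=
  Cdiv (Cminus (Cexp (Cmult Ci z)) (Cexp (Copp (Cmult Ci z)))) (Cmult (RtoC 2) Ci).

Definition in_disk (z : C) : Prop := Cmod z < 1.

Definition analytic_on_disk (f : C -> C) : Prop :=
  forall z : C, in_disk z -> ex_derive (K := C_AbsRing) (V := C_NormedModule) f z.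

Definition derivative_on_disk (f f' : C -> C) : Prop :=
  forall z : C, in_disk z -> is_derive (K := C_AbsRing) (V := C_NormedModule) f z (f' z).

Definition classA (f : C -> C) : Prop :=
  analytic_on_disk f /\ f (RtoC 0) = RtoC 0 /\
  is_derive (K := C_AbsRing) (V := C_NormedModule) f (RtoC 0) (RtoC 1).

Definition schwarz (w : C -> C) : Prop :=
  analytic_on_disk w /\ w (RtoC 0) = RtoC 0 /\ (forall z, in_disk z -> in_disk (w z)).

Definition subordinate (g phi : C -> C) : Prop :=
  exists w : C -> C, schwarz w /\ (forall z, in_disk z -> g z = phi (w z)).

(* S*(phi): f in A, f(z) <> 0 on D \ {0}, and z f'(z)/f(z) ≺ phi, where
   z f'/f is taken with its removable singularity at 0 filled by the value 1. *)
Definition zf'_over_f (f f' : C -> C) (z : C) : C :=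
  if Req_dec_T (Cmod z) 0 then RtoC 1 else Cdiv (Cmult z (f' z)) (f z).

Definition Sstar (phi : C -> C) (f : C -> C) : Prop :=
  classA f /\
  (forall z, in_disk z -> z <> RtoC 0 -> f z <> RtoC 0) /\
  exists f' : C -> C, derivative_on_disk f f' /\ subordinate (zf'_over_f f f') phi.

Definition radius_property (K : (C -> C) -> Prop) (phi : C -> C) (r : R) : Prop :=
  forall f, K f -> Sstar phi (fun z => Cdiv (f (Cmult (RtoC r) z)) (RtoC r)).

Definition is_radius (K : (C -> C) -> Prop) (phi : C -> C) (r0 : R) : Prop :=
  0 < r0 <= 1 /\ radius_property K phi r0 /\
  (forall r, 0 < r <= 1 -> radius_property K phi r -> r <= r0).

Definition phi_car (z : C) : C :=
  Cplus (Cplus (RtoC 1) z) (Cdiv (Cmult z z) (RtoC 2)).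

Definition phi_sqrt (c : R) (z : C) : C :=
  Csqrt (Cplus (RtoC 1) (Cmult (RtoC c) z)).

Definition phi_L (a : R) (z : C) : C :=
  Cplus (RtoC a) (Cmult (RtoC (1 - a)) (Csqrt (Cplus (RtoC 1) z))).

Definition phi_e (a : R) (z : C) : C :=
  Cplus (RtoC a) (Cmult (RtoC (1 - a)) (Cexp z)).

Definition phi_RL (z : C) : C :=
  Cminus (RtoC (sqrt 2))
    (Cmult (RtoC (sqrt 2 - 1))
       (Csqrt (Cdiv (Cminus (RtoC 1) z)
                    (Cplus (RtoC 1) (Cmult (RtoC (2 * (sqrt 2 - 1))) z))))).

Definition phi_C (z : C) : C :=
  Cplus (Cplus (RtoC 1) (Cmult (RtoC (4/3)) z)) (Cmult (RtoC (2/3)) (Cmult z z)).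

Definition phi_lim (z : C) : C :=
  Cplus (Cplus (RtoC 1) (Cmult (RtoC (sqrt 2)) z)) (Cdiv (Cmult z z) (RtoC 2)).

Definition phi_crescent (z : C) : C :=
  Cplus z (Csqrt (Cplus (RtoC 1) (Cmult z z))).

Definition phi_sin (z : C) : C := Cplus (RtoC 1) (Csin z).

Definition phi_ne (z : C) : C :=
  Cminus (Cplus (RtoC 1) z) (Cdiv (Cmult z (Cmult z z)) (RtoC 3)).

(* Main.v *)
(* The condition [|sqrt u - 1| < 1] describes the cardioid domain in the coordinate [u = 2 p - 1], since
   [phi_car v = ((1 + v)^2 + 1) / 2]. In all nine cases [phi (- r0) = 1/2 = phi_car (-1)] is the cusp of the
   cardioid: this makes the radius sharp, through the function [f z = z exp (int_0^1 (phi (t z) - 1) / t dt)]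
   with [z f' / f = phi]. Conversely, by the Schwarz lemma it is enough that [phi] maps [|z| < r0] into the
   cardioid domain, and there it lands in the part [Re p > 1/2] of the disk with diameter [[0, 5/2]].
   The Schwarz lemma is obtained for merely complex differentiable functions: Goursat's theorem gives the mean
   value property at 0 and hence [|w'(0)| <= 1], a Moebius change of variables turns this into the Schwarz-Pick
   bound on [w'], and integrating the latter along a radius bounds [w]. *)
Require Import Defs.
From Stdlib Require Import Reals Lra Psatz.
From Coquelicot Require Import Coquelicot.
Open Scope R_scope.

(** * Complex derivatives *)

(** A subordinating function [w] is only known to be complex differentiable at each point of the
    disk: neither a power series nor continuity of its derivative is at hand. This forces the
    bisection proof of Goursat's theorem, with integrals taken as real Riemann integrals of
    components. For sharpness the obstacle is differentiation under the integral sign. It is met by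
    a calculus of functions whose first-order Taylor remainder is bounded by one multiple of the
    squared increment on a whole closed subdisk. This class is stable under sums, products and
    composition, so every [phi] enters it by its formula. In the half-plane Re p > 1/2 the disk |p -
    1|^2 <= 5/4 already lies in the disk with diameter [0, 5/2]: both circles cross the line Re p =
    1/2 at 1/2 + i and 1/2 - i. For eight families this smaller disk suffices by crude modulus
    estimates, and the delicate inequality is Re phi > 1/2, which becomes an equality at - r0. The
    exponential family leaves the smaller disk when [a] is near its upper limit, and there the whole
    larger disk is used. *)

Definition cder (f : C -> C) (z l : C) : Prop :=
  forall eps : R, 0 < eps -> exists d : R, 0 < d /\
  forall z' : C, Cmod (z' - z) < d ->
  Cmod (f z' - f z - (z' - z) * l) <= eps * Cmod (z' - z).

Lemma cder_is_derive (f : C -> C) (z l : C) :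
  cder f z l <-> is_derive (K := C_AbsRing) (V := C_NormedModule) f z l.
Proof.
split.
- intros H; split; [apply is_linear_scal_l|].
  intros x Hx.
  rewrite <- (is_filter_lim_locally_unique (V := AbsRing_NormedModule C_AbsRing) z x Hx).
  intros eps; destruct (H eps (cond_pos eps)) as [d [Hd Hd']].
  exists (mkposreal d Hd); intros y Hy; exact (Hd' y Hy).
- intros [_ H] eps Heps.
  destruct (H z (fun P HP => HP) (mkposreal eps Heps)) as [d Hd].
  exists d; split; [apply cond_pos|]; intros z' Hz'; exact (Hd z' Hz').
Qed.

(** The rules for the identity, products and composition are taken over C as a module over itself.
    The remainder condition is the same for both module structures; only the linearity component is
    proved again. *)
Lemma cder_is_derive_ring (f : C -> C) (z l : C) :
  cder f z l <->
  is_derive (K := C_AbsRing) (V := AbsRing_NormedModule C_AbsRing) f z l.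
Proof.
rewrite cder_is_derive; split; intros [_ K]; (split; [apply is_linear_scal_l|exact K]).
Qed.

(** Both expansions are compared at one small real increment. Uniqueness is what identifies the
    derivative chosen existentially inside [Sstar] with a computed one. *)
Lemma cder_unique (f : C -> C) (z l1 l2 : C) : cder f z l1 -> cder f z l2 -> l1 = l2.
Proof.
intros H1 H2.
destruct (Ceq_dec l1 l2) as [E|E]; [exact E|exfalso].
assert (Hp : 0 < Cmod (l1 - l2)) by (apply Cmod_gt_0; intros H; apply E; replace l1 with (l1 - l2 + l2)%C by ring; rewrite H; ring).
destruct (H1 (Cmod (l1 - l2) / 4)) as [d1 [Hd1 K1]]; [lra|].
destruct (H2 (Cmod (l1 - l2) / 4)) as [d2 [Hd2 K2]]; [lra|].
set (h := Rmin d1 d2 / 2).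
assert (Hh : 0 < h) by (unfold h; apply Rdiv_lt_0_compat; [apply Rmin_pos|]; lra).
assert (Hm := Rmin_l d1 d2); assert (Hm' := Rmin_r d1 d2).
assert (Eh : Cmod (z + RtoC h - z) = h).
{ replace (z + RtoC h - z)%C with (RtoC h) by ring. rewrite Cmod_R; apply Rabs_pos_eq; lra. }
specialize (K1 (z + RtoC h)%C); specialize (K2 (z + RtoC h)%C).
rewrite Eh in K1, K2. specialize (K1 ltac:(unfold h in *; lra)); specialize (K2 ltac:(unfold h in *; lra)).
assert (T := Cmod_triangle (f (z + h)%C - f z - (z + h - z) * l2) (- (f (z + h)%C - f z - (z + h - z) * l1))).
rewrite Cmod_opp in T.
replace (f (z + h)%C - f z - (z + h - z) * l2 + - (f (z + h)%C - f z - (z + h - z) * l1))%C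
  with (RtoC h * (l1 - l2))%C in T by ring.
rewrite Cmod_mult, Cmod_R, Rabs_pos_eq in T by lra. nra.
Qed.

Lemma cder_eq (f : C -> C) (z l l' : C) : cder f z l -> l = l' -> cder f z l'.
Proof. intros H <-; exact H. Qed.

Lemma cder_const (c z : C) : cder (fun _ => c) z 0.
Proof. apply cder_is_derive, @is_derive_const. Qed.

Lemma cder_id (z : C) : cder (fun w => w) z 1.
Proof. apply cder_is_derive_ring, @is_derive_id. Qed.

Lemma cder_minus (f g : C -> C) (z a b : C) :
  cder f z a -> cder g z b -> cder (fun w => f w - g w)%C z (a - b).
Proof.
intros H1 H2; apply cder_is_derive.
exact (is_derive_minus _ _ _ _ _ (proj1 (cder_is_derive _ _ _) H1) (proj1 (cder_is_derive _ _ _) H2)).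
Qed.

Lemma cder_mult (f g : C -> C) (z a b : C) :
  cder f z a -> cder g z b -> cder (fun w => f w * g w)%C z (a * g z + f z * b).
Proof.
intros H1 H2; apply cder_is_derive_ring.
refine (is_derive_mult f g z a b _ _ Cmult_comm); apply cder_is_derive_ring; assumption.
Qed.

Lemma cder_comp (f g : C -> C) (z a b : C) :
  cder f (g z) a -> cder g z b -> cder (fun w => f (g w)) z (a * b).
Proof.
intros H1 H2; apply cder_is_derive_ring; rewrite Cmult_comm.
refine (is_derive_comp (V := AbsRing_NormedModule C_AbsRing) f g z a b _ _); apply cder_is_derive_ring; assumption.
Qed.

Lemma cder_scal (c : C) (f : C -> C) (z a : C) :
  cder f z a -> cder (fun w => c * f w)%C z (c * a).
Proof.
intros H. refine (cder_eq _ _ _ _ (cder_mult _ _ _ _ _ (cder_const c z) H) _). cbv beta; ring.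
Qed.

(** Common route to the derivatives of the inverse, the exponential, the square root and the
    primitive. Dividing by [Rabs M + 1] avoids any assumption on the sign of [M]. *)
Lemma cder_of_quadratic (f : C -> C) (z l : C) (M d : R) : 0 < d ->
  (forall z', Cmod (z' - z) < d -> Cmod (f z' - f z - (z' - z) * l) <= M * Cmod (z' - z) ^ 2) ->
  cder f z l.
Proof.
intros Hd H eps He.
assert (Hp : 0 < eps / (Rabs M + 1)) by (apply Rdiv_lt_0_compat; [|assert (U := Rabs_pos M)]; lra).
exists (Rmin d (eps / (Rabs M + 1))); split; [apply Rmin_pos; lra|].
intros z' Hz'.
assert (Ha := Rlt_le_trans _ _ _ Hz' (Rmin_l _ _)).
assert (Hb := Rlt_le_trans _ _ _ Hz' (Rmin_r _ _)).
apply Rle_trans with (1 := H z' Ha).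
assert (U := Rle_abs M); assert (U' := Rabs_pos M); assert (V := Cmod_ge_0 (z' - z)).
assert (W : (Rabs M + 1) * Cmod (z' - z) < eps).
{ apply (Rmult_lt_compat_l (Rabs M + 1)) in Hb; [|lra].
  replace ((Rabs M + 1) * (eps / (Rabs M + 1))) with eps in Hb by (field; lra). exact Hb. }
nra.
Qed.

Lemma Cmod_tri_sub (a b : C) : Cmod a - Cmod b <= Cmod (a - b).
Proof.
assert (T := Cmod_triangle (a - b) b). replace (a - b + b)%C with a in T by ring. lra.
Qed.

(** The remainder is exactly (z' - z)^2 / (z' z^2), and |z'| >= |z| / 2 near z gives the constant 2
    / |z|^3. *)
Lemma cder_inv (z : C) : z <> 0%C -> cder Cinv z (- / (z * z)).
Proof.
intros Hz. assert (Hp : 0 < Cmod z) by (apply Cmod_gt_0; exact Hz).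
apply cder_of_quadratic with (M := 2 / Cmod z ^ 3) (d := Cmod z / 2); [lra|].
intros z' Hz'.
assert (T := Cmod_tri_sub z (z - z')). replace (z - (z - z'))%C with z' in T by ring.
replace (z - z')%C with (- (z' - z))%C in T by ring. rewrite Cmod_opp in T.
assert (Hz0 : z' <> 0%C) by (apply Cmod_gt_0; lra).
replace (/ z' - / z - (z' - z) * (- / (z * z)))%C with ((z' - z) * (z' - z) / (z' * (z * z)))%C
  by (field; auto).
rewrite Cmod_div, !Cmod_mult by (repeat apply Cmult_neq_0; auto).
set (m := Cmod (z' - z)) in *. assert (Hm : 0 <= m) by apply Cmod_ge_0.
apply Rle_trans with (m * m / (Cmod z / 2 * (Cmod z * Cmod z))).
- apply Rmult_le_compat_l; [nra|]. apply Rinv_le_contravar.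
  + repeat apply Rmult_lt_0_compat; lra.
  + apply Rmult_le_compat_r; nra.
- apply Req_le; field; lra.
Qed.

Lemma cder_div (f g : C -> C) (z a b : C) : g z <> 0%C ->
  cder f z a -> cder g z b -> cder (fun w => f w / g w)%C z ((a * g z - f z * b) / (g z * g z)).
Proof.
intros H0 H1 H2.
refine (cder_eq _ _ _ _ (cder_mult _ _ _ _ _ H1 (cder_comp _ _ _ _ _ (cder_inv _ H0) H2)) _).
cbv beta. field; auto.
Qed.

(** * Goursat's theorem on rectangles *)

Definition rdiff2 (P : R -> R -> R) (x y p1 p2 : R) : Prop :=
  forall eps : R, 0 < eps -> exists d : R, 0 < d /\
  forall x' y' : R, Rabs (x' - x) < d -> Rabs (y' - y) < d ->
  Rabs (P x' y' - P x y - p1 * (x' - x) - p2 * (y' - y)) <= eps * (Rabs (x' - x) + Rabs (y' - y)).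

Lemma continuous_eps (f : R -> R) (x : R) :
  (forall eps, 0 < eps -> exists d, 0 < d /\ forall x', Rabs (x' - x) < d -> Rabs (f x' - f x) < eps) ->
  continuous f x.
Proof.
intros H. apply filterlim_locally. intros eps.
destruct (H eps (cond_pos eps)) as [d [Hd K]].
exists (mkposreal d Hd). intros y Hy. exact (K y Hy).
Qed.

Lemma rdiff2_near (P : R -> R -> R) (x y p1 p2 : R) : rdiff2 P x y p1 p2 ->
  forall eps, 0 < eps -> exists d, 0 < d /\
  forall x' y', Rabs (x' - x) < d -> Rabs (y' - y) < d -> Rabs (P x' y' - P x y) < eps.
Proof.
intros H eps He.
destruct (H 1 Rlt_0_1) as [d [Hd K]].
assert (U1 := Rabs_pos p1); assert (U2 := Rabs_pos p2).
set (k := Rabs p1 + Rabs p2 + 2).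
assert (Hp : 0 < eps / k) by (apply Rdiv_lt_0_compat; unfold k; lra).
exists (Rmin d (eps / k)); split; [apply Rmin_pos; lra|].
intros x' y' Hx Hy.
assert (Hx1 := Rlt_le_trans _ _ _ Hx (Rmin_l _ _)); assert (Hx2 := Rlt_le_trans _ _ _ Hx (Rmin_r _ _)).
assert (Hy1 := Rlt_le_trans _ _ _ Hy (Rmin_l _ _)); assert (Hy2 := Rlt_le_trans _ _ _ Hy (Rmin_r _ _)).
specialize (K x' y' Hx1 Hy1).
assert (T1 := Rabs_triang (P x' y' - P x y - p1 * (x' - x) - p2 * (y' - y)) (p1 * (x' - x) + p2 * (y' - y))).
assert (T2 := Rabs_triang (p1 * (x' - x)) (p2 * (y' - y))). rewrite !Rabs_mult in T2.
replace (P x' y' - P x y - p1 * (x' - x) - p2 * (y' - y) + (p1 * (x' - x) + p2 * (y' - y)))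
  with (P x' y' - P x y) in T1 by ring.
assert (V1 := Rabs_pos (x' - x)); assert (V2 := Rabs_pos (y' - y)).
assert (Ek : eps / k * k = eps) by (field; unfold k; lra).
assert (Rabs p1 * Rabs (x' - x) <= Rabs p1 * (eps / k)) by (apply Rmult_le_compat_l; lra).
assert (Rabs p2 * Rabs (y' - y) <= Rabs p2 * (eps / k)) by (apply Rmult_le_compat_l; lra).
unfold k in *; nra.
Qed.

Lemma rdiff2_cont_l (P : R -> R -> R) (x y p1 p2 : R) :
  rdiff2 P x y p1 p2 -> continuous (fun t => P t y) x.
Proof.
intros H; apply continuous_eps; intros eps He.
destruct (rdiff2_near _ _ _ _ _ H eps He) as [d [Hd K]].
exists d; split; [exact Hd|]. intros x' Hx; apply K; [exact Hx|].
rewrite Rminus_diag, Rabs_R0; exact Hd.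
Qed.

Lemma rdiff2_cont_r (P : R -> R -> R) (x y p1 p2 : R) :
  rdiff2 P x y p1 p2 -> continuous (fun t => P x t) y.
Proof.
intros H; apply continuous_eps; intros eps He.
destruct (rdiff2_near _ _ _ _ _ H eps He) as [d [Hd K]].
exists d; split; [exact Hd|]. intros x' Hx; apply K; [|exact Hx].
rewrite Rminus_diag, Rabs_R0; exact Hd.
Qed.

(* The integral of [P dx + Q dy] along the boundary of [[a,b] x [c,d]], with opposite sides combined. *)
Definition circulation (P Q : R -> R -> R) (a b c d : R) : R :=
  RInt (fun x => P x c - P x d) a b + RInt (fun y => Q b y - Q a y) c d.

(** The shared coefficient [k] is both the y-derivative of [P] and the x-derivative of [Q]: the form
    P dx + Q dy is closed pointwise, and nothing is asked of the partial derivatives as functions of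
    the point. *)
Definition closed_form (P Q : R -> R -> R) (a b c d : R) : Prop :=
  forall x y, a <= x <= b -> c <= y <= d ->
  exists p1 k q2, rdiff2 P x y p1 k /\ rdiff2 Q x y k q2.

Lemma closed_form_sub (P Q : R -> R -> R) (a b c d a' b' c' d' : R) :
  a <= a' -> b' <= b -> c <= c' -> d' <= d ->
  closed_form P Q a b c d -> closed_form P Q a' b' c' d'.
Proof. intros ? ? ? ? H x y Hx Hy; apply H; lra. Qed.

Lemma closed_form_int_P (P Q : R -> R -> R) (a b c d y1 y2 : R) : a <= b -> closed_form P Q a b c d ->
  c <= y1 <= d -> c <= y2 <= d -> ex_RInt (fun x => P x y1 - P x y2) a b.
Proof.
intros Hab H H1 H2. apply (ex_RInt_continuous (V := R_CompleteNormedModule)).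
rewrite Rmin_left, Rmax_right by lra. intros x Hx.
destruct (H x y1 Hx H1) as [? [? [? [K1 _]]]]. destruct (H x y2 Hx H2) as [? [? [? [K2 _]]]].
apply (continuous_minus (fun x => P x y1) (fun x => P x y2)); eapply rdiff2_cont_l; eassumption.
Qed.

Lemma closed_form_int_Q (P Q : R -> R -> R) (a b c d x1 x2 : R) : c <= d -> closed_form P Q a b c d ->
  a <= x1 <= b -> a <= x2 <= b -> ex_RInt (fun y => Q x1 y - Q x2 y) c d.
Proof.
intros Hab H H1 H2. apply (ex_RInt_continuous (V := R_CompleteNormedModule)).
rewrite Rmin_left, Rmax_right by lra. intros y Hy.
destruct (H x1 y H1 Hy) as [? [? [? [_ K1]]]]. destruct (H x2 y H2 Hy) as [? [? [? [_ K2]]]].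
apply (continuous_minus (fun y => Q x1 y) (fun y => Q x2 y)); eapply rdiff2_cont_r; eassumption.
Qed.

Lemma circulation_split_x (P Q : R -> R -> R) (a m b c d : R) : a <= m <= b -> c <= d ->
  closed_form P Q a b c d ->
  circulation P Q a b c d = circulation P Q a m c d + circulation P Q m b c d.
Proof.
intros Hm Hcd H. unfold circulation.
rewrite <- (RInt_Chasles (V := R_CompleteNormedModule) (fun x => P x c - P x d) a m b).
2:{ apply (closed_form_int_P P Q a m c d); try lra.
    apply (closed_form_sub P Q a b c d); lra || assumption. }
2:{ apply (closed_form_int_P P Q m b c d); try lra.
    apply (closed_form_sub P Q a b c d); lra || assumption. }
assert (E : RInt (fun y => Q b y - Q a y) c d
  = RInt (fun y => Q m y - Q a y) c d + RInt (fun y => Q b y - Q m y) c d).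
{ rewrite <- (RInt_plus (V := R_CompleteNormedModule) (fun y => Q m y - Q a y) (fun y => Q b y - Q m y)).
  - apply RInt_ext; intros; unfold plus; simpl; ring.
  - apply (closed_form_int_Q P Q a b c d); lra || assumption.
  - apply (closed_form_int_Q P Q a b c d); lra || assumption. }
rewrite E; unfold plus; simpl; ring.
Qed.

Lemma circulation_split_y (P Q : R -> R -> R) (a b c m d : R) : a <= b -> c <= m <= d ->
  closed_form P Q a b c d ->
  circulation P Q a b c d = circulation P Q a b c m + circulation P Q a b m d.
Proof.
intros Hab Hm H. unfold circulation.
rewrite <- (RInt_Chasles (V := R_CompleteNormedModule) (fun y => Q b y - Q a y) c m d).
2:{ apply (closed_form_int_Q P Q a b c m); try lra.
    apply (closed_form_sub P Q a b c d); lra || assumption. }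
2:{ apply (closed_form_int_Q P Q a b m d); try lra.
    apply (closed_form_sub P Q a b c d); lra || assumption. }
assert (E : RInt (fun x => P x c - P x d) a b
  = RInt (fun x => P x c - P x m) a b + RInt (fun x => P x m - P x d) a b).
{ rewrite <- (RInt_plus (V := R_CompleteNormedModule) (fun x => P x c - P x m) (fun x => P x m - P x d)).
  - apply RInt_ext; intros; unfold plus; simpl; ring.
  - apply (closed_form_int_P P Q a b c d); lra || assumption.
  - apply (closed_form_int_P P Q a b c d); lra || assumption. }
rewrite E; unfold plus; simpl; ring.
Qed.

Lemma RInt_near_const (f : R -> R) (a b k e : R) : a <= b -> ex_RInt f a b ->
  (forall x, a <= x <= b -> Rabs (f x - k) <= e) -> Rabs (RInt f a b - k * (b - a)) <= e * (b - a).
Proof.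
intros Hab Hf H.
assert (L : RInt (fun _ => k - e) a b <= RInt f a b).
{ apply RInt_le; [exact Hab|apply ex_RInt_const|exact Hf|].
  intros x Hx; assert (K := H x ltac:(lra)); apply Rabs_le_between in K; lra. }
assert (U : RInt f a b <= RInt (fun _ => k + e) a b).
{ apply RInt_le; [exact Hab|exact Hf|apply ex_RInt_const|].
  intros x Hx; assert (K := H x ltac:(lra)); apply Rabs_le_between in K; lra. }
rewrite RInt_const in L, U; unfold scal in L, U; simpl in L, U; unfold mult in L, U; simpl in L, U.
apply Rabs_le_between; lra.
Qed.

(** The affine part of the form contributes - k and + k times the area of the rectangle, so only
    remainders survive. Each difference of values on opposite sides costs 2 eps l, with l the
    half-perimeter, and the sides add up to another factor l. *)
Lemma circulation_small (P Q : R -> R -> R) (a b c d x y p1 k q2 eps : R) :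
  a <= x <= b -> c <= y <= d -> closed_form P Q a b c d ->
  (forall x' y', a <= x' <= b -> c <= y' <= d ->
    Rabs (P x' y' - P x y - p1 * (x' - x) - k * (y' - y)) <= eps * ((b - a) + (d - c)) /\
    Rabs (Q x' y' - Q x y - k * (x' - x) - q2 * (y' - y)) <= eps * ((b - a) + (d - c))) ->
  Rabs (circulation P Q a b c d) <= 2 * eps * ((b - a) + (d - c)) ^ 2.
Proof.
intros Hx Hy HF H. unfold circulation.
set (l := (b - a) + (d - c)) in *.
assert (HP : Rabs (RInt (fun x => P x c - P x d) a b - k * (c - d) * (b - a)) <= 2 * eps * l * (b - a)).
{ apply RInt_near_const; [lra|apply (closed_form_int_P P Q a b c d); lra || assumption|].
  intros t Ht.
  destruct (H t c ltac:(lra) ltac:(lra)) as [H1 _]; destruct (H t d ltac:(lra) ltac:(lra)) as [H2 _].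
  apply Rabs_le_between in H1; apply Rabs_le_between in H2; apply Rabs_le_between; lra. }
assert (HQ : Rabs (RInt (fun y => Q b y - Q a y) c d - k * (b - a) * (d - c)) <= 2 * eps * l * (d - c)).
{ apply RInt_near_const; [lra|apply (closed_form_int_Q P Q a b c d); lra || assumption|].
  intros t Ht.
  destruct (H a t ltac:(lra) ltac:(lra)) as [_ H1]; destruct (H b t ltac:(lra) ltac:(lra)) as [_ H2].
  apply Rabs_le_between in H1; apply Rabs_le_between in H2; apply Rabs_le_between; lra. }
apply Rabs_le_between in HP; apply Rabs_le_between in HQ; apply Rabs_le_between.
unfold l in *; nra.
Qed.

(** Every left endpoint lies below every right endpoint, so the supremum of the left endpoints lies
    in all intervals. *)
Lemma nested_intervals_point (u v : nat -> R) :
  (forall n, u n <= u (S n)) -> (forall n, u (S n) + v (S n) <= u n + v n) ->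
  (forall n, 0 < v n) ->
  exists x, forall n, u n <= x <= u n + v n.
Proof.
intros Hu Huv Hv.
assert (D : forall n k, u (n + k)%nat + v (n + k)%nat <= u n + v n).
{ intros n k; induction k as [|k IH]; [rewrite Nat.add_0_r; lra|].
  rewrite Nat.add_succ_r. specialize (Huv (n + k)%nat); lra. }
assert (M : forall n k, u n <= u (n + k)%nat).
{ intros n k; induction k as [|k IH]; [rewrite Nat.add_0_r; lra|].
  rewrite Nat.add_succ_r. specialize (Hu (n + k)%nat); lra. }
assert (A : forall n m, u m <= u n + v n).
{ intros n m. destruct (Nat.le_ge_cases n m) as [L|L].
  - replace m with (n + (m - n))%nat by lia.
    specialize (D n (m - n)%nat); specialize (Hv (n + (m - n))%nat); lra.
  - specialize (M m (n - m)%nat). replace (m + (n - m))%nat with n in M by lia.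
    specialize (Hv n); lra. }
destruct (completeness (fun y => exists n, y = u n)) as [x [Hx1 Hx2]].
- exists (u O + v O); intros y [n ->]; apply A.
- exists (u O), O; reflexivity.
- exists x; intros n; split; [apply Hx1; exists n; reflexivity|].
  apply Hx2; intros y [m ->]; apply A.
Qed.

(** * Bisection of rectangles *)

Section Goursat.

Variables (P Q : R -> R -> R) (a0 b0 c0 d0 e : R).
Hypotheses (Hab : a0 < b0) (Hcd : c0 < d0).
Hypothesis HF : closed_form P Q a0 b0 c0 d0.

Definition goursat_w (n : nat) := (b0 - a0) / 2 ^ n.
Definition goursat_h (n : nat) := (d0 - c0) / 2 ^ n.

(** The invariant of the bisection: quartering divides the allowed circulation by 4. *)
Definition goursat_bad (n : nat) (p : R * R) : Prop :=
  e / 4 ^ n < Rabs (circulation P Q (fst p) (fst p + goursat_w n) (snd p) (snd p + goursat_h n)).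

(** The first three quarters are tested in turn and the upper right one is the default. If the
    current rectangle is bad and the three tests fail, the default is bad too, because the four
    circulations add up to that of the rectangle. *)
Definition goursat_next (n : nat) (p : R * R) : R * R :=
  let (a, c) := p in
  let w := goursat_w (S n) in let h := goursat_h (S n) in
  if Rlt_dec (e / 4 ^ S n) (Rabs (circulation P Q a (a + w) c (c + h))) then (a, c)
  else if Rlt_dec (e / 4 ^ S n) (Rabs (circulation P Q (a + w) (a + w + w) c (c + h))) then (a + w, c)
  else if Rlt_dec (e / 4 ^ S n) (Rabs (circulation P Q a (a + w) (c + h) (c + h + h))) then (a, c + h)
  else (a + w, c + h).

Fixpoint goursat_seq (n : nat) : R * R :=
  match n with O => (a0, c0) | S m => goursat_next m (goursat_seq m) end.

Lemma goursat_w_S n : goursat_w n = goursat_w (S n) + goursat_w (S n).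
Proof. unfold goursat_w; simpl; field; apply pow_nonzero; lra. Qed.
Lemma goursat_h_S n : goursat_h n = goursat_h (S n) + goursat_h (S n).
Proof. unfold goursat_h; simpl; field; apply pow_nonzero; lra. Qed.
Lemma goursat_w_pos n : 0 < goursat_w n.
Proof. unfold goursat_w; apply Rdiv_lt_0_compat; [lra|apply pow_lt; lra]. Qed.
Lemma goursat_h_pos n : 0 < goursat_h n.
Proof. unfold goursat_h; apply Rdiv_lt_0_compat; [lra|apply pow_lt; lra]. Qed.

Lemma goursat_next_bounds n (p : R * R) :
  fst p <= fst (goursat_next n p) /\
  fst (goursat_next n p) + goursat_w (S n) <= fst p + goursat_w n /\
  snd p <= snd (goursat_next n p) /\
  snd (goursat_next n p) + goursat_h (S n) <= snd p + goursat_h n.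
Proof.
destruct p as [a c]; unfold goursat_next.
rewrite (goursat_w_S n), (goursat_h_S n).
assert (W := goursat_w_pos (S n)); assert (H := goursat_h_pos (S n)).
repeat destruct (Rlt_dec _ _); simpl fst; simpl snd; lra.
Qed.

Lemma goursat_seq_bounds n :
  a0 <= fst (goursat_seq n) /\ fst (goursat_seq n) + goursat_w n <= b0 /\
  c0 <= snd (goursat_seq n) /\ snd (goursat_seq n) + goursat_h n <= d0.
Proof.
induction n as [|n IH].
- unfold goursat_w, goursat_h; simpl; lra.
- assert (B := goursat_next_bounds n (goursat_seq n)); simpl goursat_seq; lra.
Qed.

Lemma goursat_seq_bad : e < Rabs (circulation P Q a0 b0 c0 d0) -> forall n, goursat_bad n (goursat_seq n).
Proof.
intros H0 n; induction n as [|n IH].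
- unfold goursat_bad, goursat_w, goursat_h; simpl.
  replace (a0 + (b0 - a0) / 1) with b0 by field. replace (c0 + (d0 - c0) / 1) with d0 by field. lra.
- assert (B := goursat_seq_bounds n).
  simpl goursat_seq. unfold goursat_bad in *. destruct (goursat_seq n) as [a c]. simpl fst in *; simpl snd in *.
  rewrite (goursat_w_S n), (goursat_h_S n) in IH, B.
  assert (W := goursat_w_pos (S n)); assert (H := goursat_h_pos (S n)).
  set (w := goursat_w (S n)) in *; set (h := goursat_h (S n)) in *.
  unfold goursat_next; fold w h.
  destruct (Rlt_dec _ _) as [K1|K1]; simpl fst; simpl snd; [exact K1|].
  destruct (Rlt_dec _ _) as [K2|K2]; simpl fst; simpl snd; [exact K2|].
  destruct (Rlt_dec _ _) as [K3|K3]; simpl fst; simpl snd; [exact K3|].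
  rewrite (circulation_split_x P Q a (a + w)) in IH; try lra.
  2: apply (closed_form_sub P Q a0 b0 c0 d0); lra || assumption.
  rewrite (circulation_split_y P Q a (a + w) c (c + h)) in IH; try lra.
  2: apply (closed_form_sub P Q a0 b0 c0 d0); lra || assumption.
  rewrite (circulation_split_y P Q (a + w) (a + (w + w)) c (c + h)) in IH; try lra.
  2: apply (closed_form_sub P Q a0 b0 c0 d0); lra || assumption.
  replace (a + (w + w)) with (a + w + w) in IH by ring.
  replace (c + (h + h)) with (c + h + h) in IH by ring.
  assert (E : e / 4 ^ n = 4 * (e / 4 ^ S n)) by (simpl; field; apply pow_nonzero; lra).
  rewrite E in IH.
  set (C1 := circulation P Q a (a + w) c (c + h)) in *.
  set (C2 := circulation P Q (a + w) (a + w + w) c (c + h)) in *.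
  set (C3 := circulation P Q a (a + w) (c + h) (c + h + h)) in *.
  set (C4 := circulation P Q (a + w) (a + w + w) (c + h) (c + h + h)) in *.
  assert (T1 := Rabs_triang (C1 + C3) (C2 + C4)).
  assert (T2 := Rabs_triang C1 C3). assert (T3 := Rabs_triang C2 C4). simpl pow in *. lra.
Qed.

Lemma goursat_circulation_le : 0 < e -> Rabs (circulation P Q a0 b0 c0 d0) <= e.
Proof.
intros He. destruct (Rle_or_lt (Rabs (circulation P Q a0 b0 c0 d0)) e) as [L|L]; [exact L|exfalso].
assert (B := goursat_seq_bad L).
assert (N := fun n => goursat_next_bounds n (goursat_seq n)).
assert (S0 := goursat_seq_bounds O).
destruct (nested_intervals_point (fun n => fst (goursat_seq n)) goursat_w) as [x Hx];
  try (intros n; specialize (N n); cbv beta; simpl goursat_seq; lra); try apply goursat_w_pos.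
destruct (nested_intervals_point (fun n => snd (goursat_seq n)) goursat_h) as [y Hy];
  try (intros n; specialize (N n); cbv beta; simpl goursat_seq; lra); try apply goursat_h_pos.
assert (W0 := goursat_w_pos 0); assert (H0 := goursat_h_pos 0).
destruct (HF x y) as [p1 [k [q2 [DP DQ]]]]; [specialize (Hx O); lra|specialize (Hy O); lra|].
set (l := (b0 - a0) + (d0 - c0)).
assert (Hl : 0 < l) by (unfold l; lra).
(* The n-th rectangle has half-perimeter l / 2^n, so with this choice the bound 2 eps (l / 2^n)^2 of
   [circulation_small] is exactly e / 4^n, which contradicts the strict inequality in
   [goursat_bad]. *)
set (eps := e / (2 * l ^ 2)).
assert (Heps : 0 < eps) by (unfold eps; apply Rdiv_lt_0_compat; [lra|nra]).
destruct (DP eps Heps) as [r1 [Hr1 K1]]. destruct (DQ eps Heps) as [r2 [Hr2 K2]].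
destruct (pow_lt_1_zero (1 / 2) ltac:(rewrite Rabs_pos_eq; lra) (Rmin r1 r2 / l)) as [n Hn].
{ apply Rdiv_lt_0_compat; [apply Rmin_pos; lra|exact Hl]. }
specialize (Hn n (le_n n)). rewrite Rabs_pos_eq in Hn by (apply pow_le; lra).
assert (Hsz : goursat_w n + goursat_h n < Rmin r1 r2).
{ unfold goursat_w, goursat_h. apply (Rmult_lt_compat_r l) in Hn; [|exact Hl].
  replace (Rmin r1 r2 / l * l) with (Rmin r1 r2) in Hn by (field; lra).
  replace ((b0 - a0) / 2 ^ n + (d0 - c0) / 2 ^ n) with ((1 / 2) ^ n * l); [exact Hn|].
  unfold Rdiv; rewrite Rpow_mult_distr, pow1, pow_inv; unfold l; field; apply pow_nonzero; lra. }
assert (Wn := goursat_w_pos n); assert (Hhn := goursat_h_pos n).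
assert (M1 := Rmin_l r1 r2); assert (M2 := Rmin_r r1 r2).
specialize (B n); specialize (Hx n); specialize (Hy n); unfold goursat_bad in B.
assert (Sn := goursat_seq_bounds n).
destruct (goursat_seq n) as [a c]; simpl fst in *; simpl snd in *.
assert (C := circulation_small P Q a (a + goursat_w n) c (c + goursat_h n) x y p1 k q2 eps Hx Hy).
replace (a + goursat_w n - a) with (goursat_w n) in C by ring.
replace (c + goursat_h n - c) with (goursat_h n) in C by ring.
assert (C' : Rabs (circulation P Q a (a + goursat_w n) c (c + goursat_h n)) <=
             2 * eps * (goursat_w n + goursat_h n) ^ 2).
{ apply C.
  - apply (closed_form_sub P Q a0 b0 c0 d0); lra || assumption.
  - intros x' y' Hx' Hy'.
    assert (Ax : Rabs (x' - x) <= goursat_w n) by (apply Rabs_le_between; lra).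
    assert (Ay : Rabs (y' - y) <= goursat_h n) by (apply Rabs_le_between; lra).
    split.
    + apply Rle_trans with (1 := K1 x' y' ltac:(lra) ltac:(lra)); apply Rmult_le_compat_l; lra.
    + apply Rle_trans with (1 := K2 x' y' ltac:(lra) ltac:(lra)); apply Rmult_le_compat_l; lra. }
assert (E : 2 * eps * (goursat_w n + goursat_h n) ^ 2 = e / 4 ^ n).
{ replace (4 ^ n) with (2 ^ n * 2 ^ n) by (rewrite <- Rpow_mult_distr; f_equal; lra).
  unfold eps, goursat_w, goursat_h.
  replace ((b0 - a0) / 2 ^ n + (d0 - c0) / 2 ^ n) with (l / 2 ^ n)
    by (unfold l; field; apply pow_nonzero; lra).
  assert (2 ^ n <> 0) by (apply pow_nonzero; lra). field; lra. }
lra.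
Qed.

End Goursat.

Lemma goursat (P Q : R -> R -> R) (a b c d : R) : a < b -> c < d ->
  closed_form P Q a b c d -> circulation P Q a b c d = 0.
Proof.
intros Hab Hcd H.
destruct (Req_dec (circulation P Q a b c d) 0) as [E|E]; [exact E|exfalso].
assert (U := Rabs_pos_lt _ E).
assert (V := goursat_circulation_le P Q a b c d (Rabs (circulation P Q a b c d) / 2) Hab Hcd H ltac:(lra)).
lra.
Qed.

(** * The complex exponential *)

Lemma Cmod_sq (z : C) : Cmod z ^ 2 = fst z ^ 2 + snd z ^ 2.
Proof. exact (Cmod2_alt z). Qed.

Lemma Cmod_lt_of_sq (z : C) (r : R) : 0 <= r -> fst z ^ 2 + snd z ^ 2 < r ^ 2 -> Cmod z < r.
Proof. intros Hr H; rewrite <- Cmod_sq in H. assert (U := Cmod_ge_0 z); nra. Qed.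

Lemma Cmod_le_of_sq (z : C) (r : R) : 0 <= r -> fst z ^ 2 + snd z ^ 2 <= r ^ 2 -> Cmod z <= r.
Proof. intros Hr H; rewrite <- Cmod_sq in H. assert (U := Cmod_ge_0 z); nra. Qed.

Lemma Cmod_fst (z : C) : Rabs (fst z) <= Cmod z.
Proof. exact (re_le_Cmod z). Qed.

Lemma Cmod_snd (z : C) : Rabs (snd z) <= Cmod z.
Proof. apply Rle_trans with (2 := Rmax_Cmod z), Rmax_r. Qed.

Lemma Cmod_le_sum (z : C) : Cmod z <= Rabs (fst z) + Rabs (snd z).
Proof.
assert (U := Rabs_pos (fst z)); assert (V := Rabs_pos (snd z)).
apply Cmod_le_of_sq; [lra|].
rewrite <- (pow2_abs (fst z)), <- (pow2_abs (snd z)); nra.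
Qed.

Lemma Cexp_plus (a b : C) : Cexp (a + b) = (Cexp a * Cexp b)%C.
Proof.
unfold Cexp, Cplus, Cmult; simpl. rewrite exp_plus, cos_plus, sin_plus.
f_equal; ring.
Qed.

Lemma Cexp_0 : Cexp 0 = 1.
Proof. unfold Cexp; simpl. rewrite exp_0, cos_0, sin_0. apply injective_projections; simpl; ring. Qed.

Lemma Cmod_Cexp (z : C) : Cmod (Cexp z) = exp (fst z).
Proof.
assert (E := exp_pos (fst z)). assert (S := sin2_cos2 (snd z)). unfold Rsqr in S.
assert (U := Cmod_ge_0 (Cexp z)). assert (V := Cmod_sq (Cexp z)).
unfold Cexp in V at 2 3; simpl fst in V; simpl snd in V.
assert (W : Cmod (Cexp z) ^ 2 = exp (fst z) ^ 2) by (rewrite V; nra).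
nra.
Qed.

Lemma Cexp_neq_0 (z : C) : Cexp z <> 0%C.
Proof. apply Cmod_gt_0; rewrite Cmod_Cexp; apply exp_pos. Qed.

(** The upper bound comes from exp (- x) >= 1 - x, that is exp x (1 - x) <= 1, together with (1 + x
    + 2 x^2)(1 - x) = 1 + x^2 (1 - 2 x); this explains the constant 2 and the range x <= 1/2. *)
Lemma exp_quadratic (x : R) : Rabs x <= 1 / 2 -> Rabs (exp x - 1 - x) <= 2 * x ^ 2.
Proof.
intros H; apply Rabs_le_between in H.
assert (L := exp_ineq1_le x). assert (U := exp_ineq1_le (- x)).
assert (E : exp x * exp (- x) = 1) by (rewrite <- exp_plus, Rplus_opp_r; apply exp_0).
assert (P := exp_pos x).
assert (exp x <= 1 + x + 2 * x ^ 2).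
{ assert (exp x * (1 - x) <= 1) by nra.
  assert (1 <= (1 + x + 2 * x ^ 2) * (1 - x)) by nra. nra. }
apply Rabs_le_between; nra.
Qed.

Lemma sin_abs_le (x : R) : Rabs (sin x) <= Rabs x.
Proof.
assert (P : forall y, 0 <= y -> Rabs (sin y) <= y).
{ intros y Hy. destruct (Req_dec y 0) as [->|N]; [rewrite sin_0, Rabs_R0; lra|].
  destruct (Rle_or_lt y 1) as [L|L].
  - assert (U := sin_lt_x y ltac:(lra)). assert (V := sin_gt_0 y ltac:(lra)).
    assert (Q := PI2_1). rewrite Rabs_pos_eq; [lra|]. apply Rlt_le, V; lra.
  - assert (B := SIN_bound y). apply Rabs_le_between; lra. }
destruct (Rle_or_lt 0 x) as [L|L].
- rewrite (Rabs_pos_eq x L); apply P, L.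
- rewrite (Rabs_left x L), <- Rabs_Ropp, <- sin_neg; apply P; lra.
Qed.

Lemma cos_quadratic (x : R) : 1 - x ^ 2 / 2 <= cos x.
Proof.
replace x with (2 * (x / 2)) at 2 by field. rewrite cos_2a_sin.
assert (U := sin_abs_le (x / 2)).
assert (V := Rabs_pos (sin (x / 2))).
assert (W : Rabs (sin (x / 2)) ^ 2 <= Rabs (x / 2) ^ 2) by nra.
rewrite !pow2_abs in W. nra.
Qed.

Lemma sin_quadratic (x : R) : Rabs x <= 1 / 2 -> Rabs (sin x - x) <= x ^ 2.
Proof.
intros H. destruct (MVT_gen (fun t => sin t - t) 0 x (fun t => cos t - 1)) as [c [Hc E]].
- intros t _; auto_derive; [trivial|ring].
- intros t _; apply continuity_pt_minus; [apply continuity_sin|apply continuity_pt_id].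
- rewrite sin_0 in E. replace (sin x - x) with ((cos c - 1) * x) by lra.
  rewrite Rabs_mult.
  assert (Q := cos_quadratic c). assert (B := COS_bound c).
  assert (A : Rabs (cos c - 1) <= Rabs x).
  { assert (Hcx : c ^ 2 <= Rabs x ^ 2).
    { rewrite pow2_abs. revert Hc. unfold Rmin, Rmax; destruct (Rle_dec 0 x); nra. }
    assert (U := Rabs_pos x). apply Rabs_le_between; nra. }
  rewrite <- (pow2_abs x). assert (U := Rabs_pos x); nra.
Qed.

Lemma Cexp_quadratic (h : C) : Cmod h <= 1 / 2 -> Cmod (Cexp h - 1 - h) <= 4 * Cmod h ^ 2.
Proof.
intros H.
assert (Hx := Rle_trans _ _ _ (Cmod_fst h) H). assert (Hy := Rle_trans _ _ _ (Cmod_snd h) H).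
rewrite Cmod_sq. destruct h as [x y]; simpl fst in *; simpl snd in *.
assert (E := exp_quadratic x Hx). assert (C := cos_quadratic y).
assert (S := sin_quadratic y Hy). assert (B := COS_bound y). assert (SA := sin_abs_le y).
apply Rabs_le_between in E; apply Rabs_le_between in S; apply Rabs_le_between in Hx.
apply Rle_trans with (1 := Cmod_le_sum _).
unfold Cexp, Cminus, Cplus, Copp; simpl fst; simpl snd.
assert (A1 : Rabs (exp x * cos y + - (1) + - x) <= 2 * x ^ 2 + y ^ 2).
{ replace (exp x * cos y + - (1) + - x) with ((exp x - 1 - x) * cos y + (1 + x) * (cos y - 1)) by ring.
  apply Rle_trans with (1 := Rabs_triang _ _). apply Rplus_le_compat.
  - rewrite Rabs_mult. assert (Rabs (exp x - 1 - x) <= 2 * x ^ 2) by (apply Rabs_le_between; lra).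
    assert (Rabs (cos y) <= 1) by (apply Rabs_le_between; lra).
    assert (U := Rabs_pos (cos y)); assert (V := Rabs_pos (exp x - 1 - x)); nra.
  - apply Rabs_le_between; nra. }
assert (A2 : Rabs (exp x * sin y + - 0 + - y) <= 2 * Rabs x * Rabs y + y ^ 2).
{ replace (exp x * sin y + - 0 + - y) with ((exp x - 1) * sin y + (sin y - y)) by ring.
  apply Rle_trans with (1 := Rabs_triang _ _). apply Rplus_le_compat; [|apply Rabs_le_between; lra].
  rewrite Rabs_mult.
  assert (Rabs (exp x - 1) <= 2 * Rabs x).
  { apply Rabs_le_between; unfold Rabs; destruct (Rcase_abs x); nra. }
  assert (U := Rabs_pos (sin y)); assert (V := Rabs_pos (exp x - 1)); nra. }
assert (2 * Rabs x * Rabs y <= x ^ 2 + y ^ 2).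
{ rewrite <- (pow2_abs x), <- (pow2_abs y). assert (Z := pow2_ge_0 (Rabs x - Rabs y)). lra. }
nra.
Qed.

Lemma cder_Cexp (z : C) : cder Cexp z (Cexp z).
Proof.
apply cder_of_quadratic with (M := 4 * Cmod (Cexp z)) (d := 1 / 2); [lra|].
intros z' Hz'.
replace (Cexp z' - Cexp z - (z' - z) * Cexp z)%C with (Cexp z * (Cexp (z' - z) - 1 - (z' - z)))%C.
- rewrite Cmod_mult. assert (U := Cmod_ge_0 (Cexp z)). assert (V := Cexp_quadratic (z' - z) ltac:(lra)). nra.
- replace (Cexp z') with (Cexp z * Cexp (z' - z))%C; [ring|].
  rewrite <- Cexp_plus; f_equal; ring.
Qed.

(** * Cauchy-Riemann equations and derivatives along rays *)

(** The two components are listed in the order that makes Im G dx + Re G dy, the imaginary part of G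
    dz, a closed form: the common coefficient is the real part of the derivative. *)
Lemma cder_rdiff2 (G : C -> C) (x y : R) (L : C) : cder G (x, y) L ->
  rdiff2 (fun a b => snd (G (a, b))) x y (snd L) (fst L) /\
  rdiff2 (fun a b => fst (G (a, b))) x y (fst L) (- snd L).
Proof.
intros H.
assert (K : forall eps, 0 < eps -> exists d, 0 < d /\ forall x' y',
  Rabs (x' - x) < d -> Rabs (y' - y) < d ->
  Cmod (G (x', y') - G (x, y) - ((x', y') - (x, y)) * L) <= eps * (Rabs (x' - x) + Rabs (y' - y))).
{ intros eps He; destruct (H eps He) as [d [Hd K]].
  exists (d / 2); split; [lra|]. intros x' y' Hx Hy.
  assert (B := Cmod_le_sum ((x', y') - (x, y))). simpl fst in B; simpl snd in B.
  fold (x' - x) in B; fold (y' - y) in B.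
  apply Rle_trans with (1 := K (x', y') ltac:(lra)). apply Rmult_le_compat_l; lra. }
split; intros eps He; destruct (K eps He) as [d [Hd K']]; exists d; (split; [exact Hd|]);
  intros x' y' Hx Hy; refine (Rle_trans _ _ _ _ (K' x' y' Hx Hy)).
- refine (Rle_trans _ _ _ _ (Cmod_snd _)). apply Req_le; f_equal; simpl; ring.
- refine (Rle_trans _ _ _ _ (Cmod_fst _)). apply Req_le; f_equal; simpl; ring.
Qed.

(** Makes the real mean value theorem and the fundamental theorem of calculus available for complex
    functions on segments through 0. *)
Lemma cder_ray (f : C -> C) (e l : C) (t : R) : cder f (RtoC t * e) l ->
  is_derive (fun s : R => fst (f (RtoC s * e)%C)) t (fst (e * l)%C) /\
  is_derive (fun s : R => snd (f (RtoC s * e)%C)) t (snd (e * l)%C).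
Proof.
intros H.
assert (K : forall eps, 0 < eps -> exists d : posreal, forall h, h <> 0 -> Rabs h < d ->
  Cmod (f (RtoC (t + h) * e)%C - f (RtoC t * e)%C - RtoC h * (e * l)) <= eps / 2 * Rabs h).
{ intros eps He. assert (U := Cmod_ge_0 e).
  destruct (H (eps / 2 / (Cmod e + 1))) as [d [Hd K]]; [repeat apply Rdiv_lt_0_compat; lra|].
  assert (Hd' : 0 < d / (Cmod e + 1)) by (apply Rdiv_lt_0_compat; lra).
  exists (mkposreal _ Hd'). intros h _ Hh; simpl in Hh.
  specialize (K (RtoC (t + h) * e)%C).
  replace (RtoC (t + h) * e - RtoC t * e)%C with (RtoC h * e)%C in K by (rewrite RtoC_plus; ring).
  rewrite Cmod_mult, Cmod_R in K.
  apply (Rmult_lt_compat_r (Cmod e + 1)) in Hh; [|lra].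
  replace (d / (Cmod e + 1) * (Cmod e + 1)) with d in Hh by (field; lra).
  assert (V := Rabs_pos h). specialize (K ltac:(nra)).
  rewrite Cmult_assoc. apply Rle_trans with (1 := K).
  assert (W : 0 < / (Cmod e + 1)) by (apply Rinv_0_lt_compat; lra).
  apply Rle_trans with (eps / 2 / (Cmod e + 1) * (Rabs h * (Cmod e + 1))).
  - apply Rmult_le_compat_l; [unfold Rdiv; nra|nra].
  - apply Req_le; field; lra. }
split; apply is_derive_Reals; intros eps He; destruct (K eps He) as [d Hd]; exists d; intros h Hh Hhd;
  specialize (Hd h Hh Hhd); assert (U := Rabs_pos_lt h Hh);
  apply Rmult_lt_reg_r with (1 := U); rewrite <- Rabs_mult.
- apply Rle_lt_trans with (eps / 2 * Rabs h); [|nra].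
  refine (Rle_trans _ _ _ _ Hd). refine (Rle_trans _ _ _ _ (Cmod_fst _)).
  apply Req_le; f_equal. simpl. field; exact Hh.
- apply Rle_lt_trans with (eps / 2 * Rabs h); [|nra].
  refine (Rle_trans _ _ _ _ Hd). refine (Rle_trans _ _ _ _ (Cmod_snd _)).
  apply Req_le; f_equal. simpl. field; exact Hh.
Qed.

(** * The Schwarz lemma *)

(* In the variable [zeta = log z] the function [w z / z] becomes [2 i PI]-periodic, so Goursat's theorem on
   [[s,t] x [0,2 PI]] equates its means over the circles of radii [exp s] and [exp t]; the former tends to [l]
   as [s -> -oo], and the latter has real part at most [exp (-t)]. *)
Lemma schwarz_re_derivative_at_0 (w : C -> C) (l : C) :
  (forall z, Cmod z < 1 -> exists d, cder w z d) -> (forall z, Cmod z < 1 -> Cmod (w z) < 1) ->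
  w 0 = 0 -> cder w 0 l -> fst l <= 1.
Proof.
intros Hw Hb H0 Hl.
destruct (Rle_or_lt (fst l) 1) as [L|L]; [exact L|exfalso].
(* Then Re l - eps = 1 + 3 eps bounds the real part of G from below on the inner circle, while the
   outer circle of radius 1 / (1 + eps) gives at most 1 + eps. The integrand below is thus at most -
   2 eps, although its integral vanishes. *)
set (eps := (fst l - 1) / 4). assert (He : 0 < eps) by (unfold eps; lra).
destruct (Hl eps He) as [d [Hd K]].
set (t := - ln (1 + eps)).
assert (Ht : t < 0).
{ unfold t. assert (U := ln_increasing 1 (1 + eps) ltac:(lra) ltac:(lra)). rewrite ln_1 in U; lra. }
assert (Het : exp (- t) = 1 + eps) by (unfold t; rewrite Ropp_involutive; apply exp_ln; lra).
(* The minimum ensures both s < t and exp s < d, so that the expansion of [w] at 0 applies on the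
   inner circle. *)
set (s := Rmin (t - 1) (ln d - 1)).
assert (Hs1 := Rmin_l (t - 1) (ln d - 1)). assert (Hs2 := Rmin_r (t - 1) (ln d - 1)). fold s in Hs1, Hs2.
assert (Hes : exp s < d).
{ rewrite <- (exp_ln d Hd). apply exp_increasing; lra. }
set (G := fun z => (w (Cexp z) / Cexp z)%C).
assert (HF : closed_form (fun x y => snd (G (x, y))) (fun x y => fst (G (x, y))) s t 0 (2 * PI)).
{ intros x y Hx _.
  assert (Hlt : Cmod (Cexp (x, y)) < 1).
  { rewrite Cmod_Cexp; simpl. rewrite <- exp_0. apply exp_increasing; lra. }
  destruct (Hw _ Hlt) as [p Hp].
  assert (HG := cder_div _ _ _ _ _ (Cexp_neq_0 (x, y)) (cder_comp _ _ _ _ _ Hp (cder_Cexp (x, y))) (cder_Cexp (x, y))).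
  destruct (cder_rdiff2 _ _ _ _ HG) as [R1 R2].
  eexists _, _, _; split; [exact R1|exact R2]. }
assert (PI0 := PI_RGT_0).
assert (HG := goursat _ _ s t 0 (2 * PI) ltac:(lra) ltac:(lra) HF).
unfold circulation in HG.
(* The horizontal sides cancel because [Cexp] takes the same values at heights 0 and 2 PI. *)
rewrite (RInt_ext _ (fun _ => 0)) in HG.
2:{ intros x _. unfold G, Cexp; simpl fst; simpl snd. rewrite cos_0, sin_0, cos_2PI, sin_2PI. apply Rminus_diag_eq; reflexivity. }
rewrite RInt_const in HG.
assert (HI : RInt (fun y => fst (G (t, y)) - fst (G (s, y))) 0 (2 * PI) <= RInt (fun _ => - 2 * eps) 0 (2 * PI)).
{ apply RInt_le; [lra| |apply ex_RInt_const|].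
  - apply (closed_form_int_Q _ (fun x y => fst (G (x, y))) s t 0 (2 * PI) t s ltac:(lra) HF); lra.
  - intros y _.
    assert (Mt := Cmod_Cexp (t, y)); assert (Ms := Cmod_Cexp (s, y)); simpl fst in Mt, Ms.
    assert (Et := exp_pos t). assert (Es := exp_pos s).
    assert (A1 : fst (G (t, y)) <= 1 + eps).
    { apply Rle_trans with (1 := Rle_abs _), Rle_trans with (1 := Cmod_fst _).
      unfold G; rewrite Cmod_div by apply Cexp_neq_0.
      rewrite Mt, <- Het, exp_Ropp. rewrite <- (Rmult_1_l (/ exp t)). unfold Rdiv.
      apply Rmult_le_compat_r; [apply Rlt_le, Rinv_0_lt_compat, Et|].
      apply Rlt_le, Hb. rewrite Mt, <- exp_0; apply exp_increasing, Ht. }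
    assert (A2 : fst l - eps <= fst (G (s, y))).
    { assert (B : Cmod (G (s, y) - l) <= eps).
      { specialize (K (Cexp (s, y))). rewrite H0 in K.
        replace (Cexp (s, y) - 0)%C with (Cexp (s, y)) in K by ring. rewrite Ms in K. specialize (K Hes).
        replace (w (Cexp (s, y)) - 0 - Cexp (s, y) * l)%C with (Cexp (s, y) * (G (s, y) - l))%C in K
          by (unfold G; field; apply Cexp_neq_0).
        rewrite Cmod_mult, Ms in K. nra. }
      assert (B' := Rle_trans _ _ _ (Cmod_fst _) B). apply Rabs_le_between in B'. change (fst (G (s, y) - l)%C) with (fst (G (s, y)) - fst l) in B'. lra. }
    unfold eps in *; lra. }
rewrite RInt_const in HI. unfold scal in HG, HI; simpl in HG, HI; unfold mult in HG, HI; simpl in HG, HI.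
nra.
Qed.

(** Multiplying [w] by the unimodular constant conj l / |l| makes the derivative at 0 equal to the
    real number |l|, to which the bound on the real part applies. *)
Lemma schwarz_derivative_at_0 (w : C -> C) (l : C) :
  (forall z, Cmod z < 1 -> exists d, cder w z d) -> (forall z, Cmod z < 1 -> Cmod (w z) < 1) ->
  w 0 = 0 -> cder w 0 l -> Cmod l <= 1.
Proof.
intros Hw Hb H0 Hl.
destruct (Ceq_dec l 0) as [->|N]; [rewrite Cmod_0; lra|].
assert (P : 0 < Cmod l) by (apply Cmod_gt_0; exact N).
assert (NR : RtoC (Cmod l) <> 0%C) by (intros E; apply RtoC_inj in E; lra).
set (c := (Cconj l / Cmod l)%C).
assert (Hc : Cmod c = 1).
{ unfold c; rewrite Cmod_div, Cmod_conj, Cmod_R, Rabs_pos_eq by (lra || exact NR). field; lra. }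
assert (E : (c * l)%C = Cmod l).
{ unfold c. replace (Cconj l / Cmod l * l)%C with (l * Cconj l / Cmod l)%C by (field; exact NR).
  rewrite <- Cmod2_conj. unfold pow. rewrite Rmult_1_r, RtoC_mult. field; exact NR. }
replace (Cmod l) with (fst (c * l)%C) by (rewrite E; reflexivity).
apply (schwarz_re_derivative_at_0 (fun z => c * w z)%C).
- intros z Hz; destruct (Hw z Hz) as [d Hd]; exists (c * d)%C; apply cder_scal, Hd.
- intros z Hz; rewrite Cmod_mult, Hc, Rmult_1_l; apply Hb, Hz.
- rewrite H0; ring.
- apply cder_scal, Hl.
Qed.

Definition mobius (a z : C) : C := ((z - a) / (1 - Cconj a * z))%C.

Lemma mobius_den (a z : C) : Cmod a < 1 -> Cmod z < 1 -> (1 - Cconj a * z)%C <> 0%C.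
Proof.
intros Ha Hz. apply Cmod_gt_0.
assert (T := Cmod_tri_sub 1 (Cconj a * z)). rewrite Cmod_1, Cmod_mult, Cmod_conj in T.
assert (U := Cmod_ge_0 a); assert (V := Cmod_ge_0 z); nra.
Qed.

Lemma mobius_disk (a z : C) : Cmod a < 1 -> Cmod z < 1 -> Cmod (mobius a z) < 1.
Proof.
intros Ha Hz. assert (N := mobius_den a z Ha Hz). unfold mobius. rewrite Cmod_div by exact N.
apply Cmod_gt_0 in N. apply Rmult_lt_reg_r with (1 := N). unfold Rdiv.
rewrite Rmult_assoc, Rinv_l, Rmult_1_r, Rmult_1_l by lra.
apply Cmod_lt_of_sq; [lra|]. rewrite Cmod_sq.
assert (A := Cmod_sq a). assert (Z := Cmod_sq z).
assert (U := Cmod_ge_0 a); assert (V := Cmod_ge_0 z).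
(* This product equals |1 - conj a z|^2 - |z - a|^2. *)
assert (D : 0 < (1 - Cmod a ^ 2) * (1 - Cmod z ^ 2)) by (apply Rmult_lt_0_compat; nra).
rewrite A, Z in D. destruct a as [a1 a2], z as [z1 z2]. simpl in *. nra.
Qed.

Lemma cder_mobius (a z : C) : Cmod a < 1 -> Cmod z < 1 ->
  cder (mobius a) z ((1 - a * Cconj a) / ((1 - Cconj a * z) * (1 - Cconj a * z))).
Proof.
intros Ha Hz. assert (N := mobius_den a z Ha Hz).
refine (cder_eq _ _ _ _ (cder_div (fun w => w - a)%C (fun w => 1 - Cconj a * w)%C _ _ _ N
  (cder_minus _ _ _ _ _ (cder_id z) (cder_const a z))
  (cder_minus _ _ _ _ _ (cder_const 1 z) (cder_scal (Cconj a) _ _ _ (cder_id z)))) _).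
cbv beta; field; exact N.
Qed.

(** With b = w a, the composite of [mobius (- a)], [w] and [mobius b] fixes 0 and maps the disk to
    itself; its derivative there is l (1 - |a|^2) / (1 - |b|^2). *)
Lemma schwarz_pick_derivative (w : C -> C) (a l : C) :
  (forall z, Cmod z < 1 -> exists d, cder w z d) -> (forall z, Cmod z < 1 -> Cmod (w z) < 1) ->
  Cmod a < 1 -> cder w a l -> Cmod l * (1 - Cmod a ^ 2) <= 1 - Cmod (w a) ^ 2.
Proof.
intros Hw Hb Ha Hl.
set (b := w a). assert (Hb' : Cmod b < 1) by apply (Hb a Ha).
assert (Hma : Cmod (- a) < 1) by (rewrite Cmod_opp; exact Ha).
assert (M0 : mobius (- a) 0 = a).
{ unfold mobius. field. }
assert (H0 : Cmod 0 < 1) by (rewrite Cmod_0; lra).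
assert (D0 := cder_mobius (- a) 0 Hma H0).
assert (D1 : cder w (mobius (- a) 0) l) by (rewrite M0; exact Hl).
assert (D2 := cder_comp w (mobius (- a)) 0 _ _ D1 D0).
assert (D3 : cder (mobius b) (w (mobius (- a) 0)) ((1 - b * Cconj b) / ((1 - Cconj b * b) * (1 - Cconj b * b)))).
{ rewrite M0. apply cder_mobius; exact Hb'. }
assert (D4 := cder_comp (mobius b) (fun z => w (mobius (- a) z)) 0 _ _ D3 D2).
assert (S : Cmod ((1 - b * Cconj b) / ((1 - Cconj b * b) * (1 - Cconj b * b)) *
  (l * ((1 - - a * Cconj (- a)) / ((1 - Cconj (- a) * 0) * (1 - Cconj (- a) * 0))))) <= 1).
{ apply (schwarz_derivative_at_0 (fun z => mobius b (w (mobius (- a) z)))).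
  - intros z Hz. assert (Hz' := mobius_disk (- a) z Hma Hz). destruct (Hw _ Hz') as [d Hd].
    eexists. apply (cder_comp (mobius b) (fun z => w (mobius (- a) z))).
    + apply cder_mobius; [exact Hb'|apply Hb, Hz'].
    + apply (cder_comp w (mobius (- a))); [exact Hd|apply cder_mobius; assumption].
  - intros z Hz. apply mobius_disk; [exact Hb'|]. apply Hb, mobius_disk; assumption.
  - rewrite M0. fold b. unfold mobius, Cdiv. replace (b - b)%C with (RtoC 0) by ring. ring.
  - exact D4. }
assert (Nb := mobius_den b b Hb' Hb').
replace ((1 - b * Cconj b) / ((1 - Cconj b * b) * (1 - Cconj b * b)) *
  (l * ((1 - - a * Cconj (- a)) / ((1 - Cconj (- a) * 0) * (1 - Cconj (- a) * 0)))))%C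
  with (l * RtoC (1 - Cmod a ^ 2) / RtoC (1 - Cmod b ^ 2))%C in S.
2:{ rewrite !RtoC_minus, !Cmod2_conj.
    replace (Cconj (- a)) with (- Cconj a)%C by (apply injective_projections; simpl; ring).
    rewrite (Cmult_comm b). field; exact Nb. }
assert (Ua := Cmod_ge_0 a); assert (Ub := Cmod_ge_0 b).
assert (Pa : 0 < 1 - Cmod a ^ 2) by nra. assert (Pb : 0 < 1 - Cmod b ^ 2) by nra.
rewrite Cmod_div, Cmod_mult, !Cmod_R, !Rabs_pos_eq in S by (lra || (intros E; apply RtoC_inj in E; lra)).
apply (Rmult_le_compat_r (1 - Cmod b ^ 2)) in S; [|lra].
replace (Cmod l * (1 - Cmod a ^ 2) / (1 - Cmod b ^ 2) * (1 - Cmod b ^ 2)) with (Cmod l * (1 - Cmod a ^ 2)) in S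
  by (field; lra).
lra.
Qed.

Lemma schwarz_lemma (w : C -> C) (z : C) : schwarz w -> in_disk z -> Cmod (w z) <= Cmod z.
Proof.
intros [Han [H0 Hb]] Hz. unfold in_disk in *.
assert (Hd : forall u, Cmod u < 1 -> cder w u (C_derive w u)).
{ intros u Hu. apply cder_is_derive, C_derive_correct; [exact u|apply Han, Hu]. }
assert (Hw : forall u, Cmod u < 1 -> exists d, cder w u d) by (intros u Hu; eexists; apply Hd, Hu).
destruct (Rle_or_lt (Cmod (w z)) (Cmod z)) as [L|L]; [exact L|exfalso].
assert (Uz := Cmod_ge_0 z).
assert (Nz : z <> 0%C) by (intros ->; rewrite H0 in L; lra).
assert (Pz : 0 < Cmod z) by (apply Cmod_gt_0; exact Nz).
assert (NRz : RtoC (Cmod z) <> 0%C) by (intros E; apply RtoC_inj in E; lra).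
assert (NRw : RtoC (Cmod (w z)) <> 0%C) by (intros E; apply RtoC_inj in E; lra).
set (r := Cmod z) in *. set (e := (z / r)%C). set (c := (Cconj (w z) / Cmod (w z))%C).
assert (Me : Cmod e = 1).
{ unfold e; rewrite Cmod_div, Cmod_R, Rabs_pos_eq by (lra || exact NRz). fold r. field; lra. }
assert (Mc : Cmod c = 1).
{ unfold c; rewrite Cmod_div, Cmod_conj, Cmod_R, Rabs_pos_eq by (lra || exact NRw). field; lra. }
(* The real part of [w] along the ray through z, rotated so that q r = |w z|. Being real-valued, it
   can be treated by the mean value theorem. *)
set (q := fun t : R => fst (c * w (RtoC t * e))%C).
assert (Mt : forall t, 0 <= t -> Cmod (RtoC t * e) = t).
{ intros t Ht; rewrite Cmod_mult, Cmod_R, Me, Rabs_pos_eq; lra. }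
assert (Q0 : q 0 = 0) by (unfold q; rewrite Cmult_0_l, H0; simpl; ring).
assert (Qr : q r = Cmod (w z)).
{ unfold q. replace (RtoC r * e)%C with z by (unfold e; field; exact NRz).
  unfold c. replace (Cconj (w z) / Cmod (w z) * w z)%C with (w z * Cconj (w z) / Cmod (w z))%C by (field; exact NRw).
  rewrite <- Cmod2_conj. unfold pow. rewrite Rmult_1_r, RtoC_mult.
  replace (RtoC (Cmod (w z)) * RtoC (Cmod (w z)) / RtoC (Cmod (w z)))%C with (RtoC (Cmod (w z))) by (field; exact NRw).
  reflexivity. }
assert (Qb : forall t, 0 <= t < 1 -> Rabs (q t) <= Cmod (w (RtoC t * e)%C) /\ Cmod (w (RtoC t * e)%C) < 1).
{ intros t Ht; split.
  - unfold q. apply Rle_trans with (1 := Cmod_fst _). rewrite Cmod_mult, Mc; lra.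
  - apply Hb; rewrite Mt; lra. }
set (dq := fun t : R => fst (e * (c * C_derive w (RtoC t * e)))%C).
assert (Dq : forall t, 0 <= t < 1 -> is_derive q t (dq t)).
{ intros t Ht. apply (cder_ray (fun u => c * w u)%C). apply cder_scal, Hd. rewrite Mt; lra. }
assert (Dqb : forall t, 0 <= t < 1 -> dq t * (1 - t ^ 2) <= 1 - q t ^ 2).
{ intros t Ht. destruct (Qb t Ht) as [B1 B2].
  assert (Mlt : Cmod (RtoC t * e) < 1) by (rewrite Mt; lra).
  assert (SP := schwarz_pick_derivative w (RtoC t * e) _ Hw Hb Mlt (Hd _ Mlt)).
  rewrite (Mt t) in SP by lra.
  assert (B3 : dq t <= Cmod (C_derive w (RtoC t * e)%C)).
  { apply Rle_trans with (1 := Rle_abs _), Rle_trans with (1 := Cmod_fst _). rewrite !Cmod_mult, Me, Mc; lra. }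
  assert (B4 : q t ^ 2 <= Cmod (w (RtoC t * e)%C) ^ 2).
  { rewrite <- (pow2_abs (q t)). assert (V := Rabs_pos (q t)); nra. }
  assert (0 < 1 - t ^ 2) by nra. nra. }
assert (Hq1 : forall t, 0 <= t < 1 -> -1 < q t < 1).
{ intros t Ht; destruct (Qb t Ht) as [B1 B2]. assert (B := Rle_lt_trans _ _ _ B1 B2).
  apply Rabs_lt_between in B; lra. }
(* This is 2 artanh (q t) - 2 artanh t, a difference of hyperbolic distances from 0. The
   Schwarz-Pick bound makes it nonincreasing from the value 0, whereas |w z| > |z| would make it
   positive at r. *)
set (g := fun t => ln (1 + q t) - ln (1 - q t) - ln (1 + t) + ln (1 - t)).
set (dg := fun t => dq t / (1 + q t) + dq t / (1 - q t) - / (1 + t) - / (1 - t)).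
assert (Dg : forall t, 0 <= t <= r -> is_derive g t (dg t)).
{ intros t Ht. assert (B := Hq1 t ltac:(lra)). assert (D := Dq t ltac:(lra)).
  unfold g, dg. auto_derive.
  - repeat split; try lra; exists (dq t); exact D.
  - change (fun x : R => q x) with q. rewrite (is_derive_unique _ _ _ D). field; lra. }
destruct (MVT_gen g 0 r dg) as [x [Hx E]].
- rewrite Rmin_left, Rmax_right by lra. intros x Hx; apply Dg; lra.
- rewrite Rmin_left, Rmax_right by lra. intros x Hx.
  apply derivable_continuous_pt. exists (dg x). apply is_derive_Reals, Dg, Hx.
- rewrite Rmin_left, Rmax_right in Hx by lra.
  assert (G0 : g 0 = 0) by (unfold g; rewrite Q0, Rplus_0_r, Rminus_0_r, ln_1; lra).
  assert (Dneg : dg x <= 0).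
  { assert (B := Hq1 x ltac:(lra)). assert (D := Dqb x ltac:(lra)).
    replace (dg x) with (- (2 * ((1 - q x ^ 2) - dq x * (1 - x ^ 2)) * / ((1 - q x ^ 2) * (1 - x ^ 2)))).
    - assert (0 < / ((1 - q x ^ 2) * (1 - x ^ 2))) by (apply Rinv_0_lt_compat, Rmult_lt_0_compat; nra). nra.
    - unfold dg. field. repeat split; nra. }
  assert (Gr : 0 < g r).
  { unfold g. rewrite Qr. assert (B := Hb z Hz).
    assert (A1 := ln_increasing (1 + r) (1 + Cmod (w z)) ltac:(lra) ltac:(lra)).
    assert (A2 := ln_increasing (1 - Cmod (w z)) (1 - r) ltac:(lra) ltac:(lra)). lra. }
  nra.
Qed.

(** * Functions with quadratically small Taylor remainder *)

(** A single constant controls values, derivative, increments and Taylor remainder for all pairs of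
    points of [D]. The bounds besides the remainder are what products and compositions consume. *)
Definition C11_bound (D : C -> Prop) (f f' : C -> C) (M : R) : Prop :=
  (forall z, D z -> Cmod (f z) <= M /\ Cmod (f' z) <= M) /\
  (forall z z', D z -> D z' -> Cmod (f z' - f z) <= M * Cmod (z' - z) /\
     Cmod (f z' - f z - (z' - z) * f' z) <= M * Cmod (z' - z) ^ 2).

Definition C11_on (D : C -> Prop) (f f' : C -> C) : Prop := exists M : R, 0 <= M /\ C11_bound D f f' M.

Lemma C11_bound_le (D : C -> Prop) (f f' : C -> C) (M N : R) :
  M <= N -> C11_bound D f f' M -> C11_bound D f f' N.
Proof.
intros L [H1 H2]; split.
- intros z Hz; destruct (H1 z Hz); lra.
- intros z z' Hz Hz'; destruct (H2 z z' Hz Hz'). assert (U := Cmod_ge_0 (z' - z)). split; nra.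
Qed.

Lemma C11_const (D : C -> Prop) (c : C) : C11_on D (fun _ => c) (fun _ => 0%C).
Proof.
exists (Cmod c); assert (U := Cmod_ge_0 c). split; [exact U|split].
- intros z _; rewrite Cmod_0; lra.
- intros z z' _ _. assert (V := Cmod_ge_0 (z' - z)).
  replace (c - c)%C with (RtoC 0) by ring. replace (0 - (z' - z) * 0)%C with (RtoC 0) by ring.
  rewrite Cmod_0; split; nra.
Qed.

Lemma C11_id (D : C -> Prop) (B : R) : (forall z, D z -> Cmod z <= B) -> C11_on D (fun z => z) (fun _ => 1%C).
Proof.
intros H. assert (U := Rabs_pos B); assert (V := Rle_abs B).
exists (Rabs B + 1); split; [lra|split].
- intros z Hz; rewrite Cmod_1; specialize (H z Hz); lra.
- intros z z' _ _. replace (z' - z - (z' - z) * 1)%C with (RtoC 0) by ring. rewrite Cmod_0.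
  assert (W := Cmod_ge_0 (z' - z)). split; nra.
Qed.

Lemma C11_plus (D : C -> Prop) (f g f' g' : C -> C) : C11_on D f f' -> C11_on D g g' ->
  C11_on D (fun z => f z + g z)%C (fun z => f' z + g' z)%C.
Proof.
intros [M [HM [F1 F2]]] [N [HN [G1 G2]]]; exists (M + N); split; [lra|split].
- intros z Hz; destruct (F1 z Hz), (G1 z Hz).
  assert (T1 := Cmod_triangle (f z) (g z)); assert (T2 := Cmod_triangle (f' z) (g' z)); lra.
- intros z z' Hz Hz'; destruct (F2 z z' Hz Hz'), (G2 z z' Hz Hz').
  assert (T1 := Cmod_triangle (f z' - f z) (g z' - g z)).
  assert (T2 := Cmod_triangle (f z' - f z - (z' - z) * f' z) (g z' - g z - (z' - z) * g' z)).
  replace (f z' + g z' - (f z + g z))%C with (f z' - f z + (g z' - g z))%C by ring.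
  replace (f z' - f z + (g z' - g z) - (z' - z) * (f' z + g' z))%C
    with (f z' - f z - (z' - z) * f' z + (g z' - g z - (z' - z) * g' z))%C by ring.
  split; lra.
Qed.

Lemma C11_opp (D : C -> Prop) (f f' : C -> C) : C11_on D f f' ->
  C11_on D (fun z => - f z)%C (fun z => - f' z)%C.
Proof.
intros [M [HM [F1 F2]]]; exists M; split; [exact HM|split].
- intros z Hz; rewrite !Cmod_opp; apply F1, Hz.
- intros z z' Hz Hz'.
  replace (- f z' - - f z)%C with (- (f z' - f z))%C by ring.
  replace (- (f z' - f z) - (z' - z) * - f' z)%C with (- (f z' - f z - (z' - z) * f' z))%C by ring.
  rewrite !Cmod_opp; apply F2; assumption.
Qed.

(** The Taylor remainder of a product is R_f g + f R_g plus the product of the two increments, each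
    of second order. *)
Lemma C11_mult (D : C -> Prop) (f g f' g' : C -> C) : C11_on D f f' -> C11_on D g g' ->
  C11_on D (fun z => f z * g z)%C (fun z => f' z * g z + f z * g' z)%C.
Proof.
intros [M [HM HF]] [N [HN HG]].
set (K := M + N). assert (HK : 0 <= K) by (unfold K; lra).
apply (C11_bound_le _ _ _ _ K) in HF; [|unfold K; lra].
apply (C11_bound_le _ _ _ _ K) in HG; [|unfold K; lra].
destruct HF as [F1 F2]; destruct HG as [G1 G2].
exists (3 * K * K); split; [nra|split].
- intros z Hz; destruct (F1 z Hz) as [A1 A2], (G1 z Hz) as [B1 B2].
  assert (T := Cmod_triangle (f' z * g z) (f z * g' z)). rewrite !Cmod_mult in *.
  assert (U1 := Cmod_ge_0 (f z)); assert (U2 := Cmod_ge_0 (g z)).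
  assert (U3 := Cmod_ge_0 (f' z)); assert (U4 := Cmod_ge_0 (g' z)).
  assert (Cmod (f z) * Cmod (g z) <= K * K) by (apply Rmult_le_compat; lra).
  assert (Cmod (f' z) * Cmod (g z) <= K * K) by (apply Rmult_le_compat; lra).
  assert (Cmod (f z) * Cmod (g' z) <= K * K) by (apply Rmult_le_compat; lra).
  split; nra.
- intros z z' Hz Hz'; destruct (F1 z Hz) as [A1 A2], (G1 z Hz) as [B1 B2], (G1 z' Hz') as [B3 B4].
  destruct (F2 z z' Hz Hz') as [A5 A6], (G2 z z' Hz Hz') as [B5 B6].
  set (m := Cmod (z' - z)) in *. assert (Hm : 0 <= m) by apply Cmod_ge_0.
  assert (U1 := Cmod_ge_0 (f z)); assert (U2 := Cmod_ge_0 (g z)); assert (U3 := Cmod_ge_0 (g z')).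
  assert (V1 := Cmod_ge_0 (f z' - f z)); assert (V2 := Cmod_ge_0 (g z' - g z)).
  assert (V3 := Cmod_ge_0 (f z' - f z - (z' - z) * f' z)); assert (V4 := Cmod_ge_0 (g z' - g z - (z' - z) * g' z)).
  split.
  + assert (T := Cmod_triangle ((f z' - f z) * g z') (f z * (g z' - g z))). rewrite !Cmod_mult in T.
    replace (f z' * g z' - f z * g z)%C with ((f z' - f z) * g z' + f z * (g z' - g z))%C by ring.
    assert (Cmod (f z' - f z) * Cmod (g z') <= K * m * K) by (apply Rmult_le_compat; lra).
    assert (Cmod (f z) * Cmod (g z' - g z) <= K * (K * m)) by (apply Rmult_le_compat; lra).
    assert (0 <= K * K * m) by (repeat apply Rmult_le_pos; lra). lra.
  + assert (T1 := Cmod_triangle ((f z' - f z - (z' - z) * f' z) * g z + f z * (g z' - g z - (z' - z) * g' z))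
      ((f z' - f z) * (g z' - g z))).
    assert (T2 := Cmod_triangle ((f z' - f z - (z' - z) * f' z) * g z) (f z * (g z' - g z - (z' - z) * g' z))).
    rewrite !Cmod_mult in *.
    replace (f z' * g z' - f z * g z - (z' - z) * (f' z * g z + f z * g' z))%C
      with ((f z' - f z - (z' - z) * f' z) * g z + f z * (g z' - g z - (z' - z) * g' z) +
        (f z' - f z) * (g z' - g z))%C by ring.
    assert (Cmod (f z' - f z - (z' - z) * f' z) * Cmod (g z) <= K * m ^ 2 * K) by (apply Rmult_le_compat; lra).
    assert (Cmod (f z) * Cmod (g z' - g z - (z' - z) * g' z) <= K * (K * m ^ 2)) by (apply Rmult_le_compat; lra).
    assert (Cmod (f z' - f z) * Cmod (g z' - g z) <= K * m * (K * m)) by (apply Rmult_le_compat; lra).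
    lra.
Qed.

(** The Taylor remainder of the composite is that of [g] for the increment f z' - f z, plus the
    remainder of [f] multiplied by g' (f z). *)
Lemma C11_comp (D E : C -> Prop) (f g f' g' : C -> C) : (forall z, D z -> E (f z)) ->
  C11_on E g g' -> C11_on D f f' -> C11_on D (fun z => g (f z)) (fun z => g' (f z) * f' z)%C.
Proof.
intros HDE [N [HN HG]] [M [HM HF]].
set (K := M + N). assert (HK : 0 <= K) by (unfold K; lra).
apply (C11_bound_le _ _ _ _ K) in HF; [|unfold K; lra].
apply (C11_bound_le _ _ _ _ K) in HG; [|unfold K; lra].
destruct HF as [F1 F2]; destruct HG as [G1 G2].
assert (KK : 0 <= K * K) by nra. assert (KKK : 0 <= K * (K * K)) by nra.
exists (K + K * K + K * (K * K)); split; [lra|split].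
- intros z Hz; destruct (F1 z Hz) as [A1 A2], (G1 _ (HDE z Hz)) as [B1 B2]. rewrite Cmod_mult.
  assert (U1 := Cmod_ge_0 (g' (f z))); assert (U2 := Cmod_ge_0 (f' z)).
  assert (Cmod (g' (f z)) * Cmod (f' z) <= K * K) by (apply Rmult_le_compat; lra). lra.
- intros z z' Hz Hz'. destruct (G1 _ (HDE z Hz)) as [B1 B2].
  destruct (F2 z z' Hz Hz') as [A5 A6], (G2 _ _ (HDE z Hz) (HDE z' Hz')) as [B5 B6].
  set (m := Cmod (z' - z)) in *. assert (Hm : 0 <= m) by apply Cmod_ge_0.
  assert (V1 := Cmod_ge_0 (f z' - f z)). assert (U1 := Cmod_ge_0 (g' (f z))).
  assert (V3 := Cmod_ge_0 (f z' - f z - (z' - z) * f' z)).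
  split.
  + assert (K * Cmod (f z' - f z) <= K * (K * m)) by (apply Rmult_le_compat_l; lra).
    assert (0 <= K * m) by nra. assert (0 <= K * (K * K) * m) by nra. lra.
  + assert (T := Cmod_triangle (g (f z') - g (f z) - (f z' - f z) * g' (f z))
                  ((f z' - f z - (z' - z) * f' z) * g' (f z))).
    rewrite Cmod_mult in T.
    replace (g (f z') - g (f z) - (z' - z) * (g' (f z) * f' z))%C with
      (g (f z') - g (f z) - (f z' - f z) * g' (f z) + (f z' - f z - (z' - z) * f' z) * g' (f z))%C by ring.
    assert (K * Cmod (f z' - f z) ^ 2 <= K * (K * m) ^ 2).
    { apply Rmult_le_compat_l; [lra|]. apply pow_incr; lra. }
    assert (Cmod (f z' - f z - (z' - z) * f' z) * Cmod (g' (f z)) <= K * m ^ 2 * K)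
      by (apply Rmult_le_compat; lra).
    assert (0 <= K * m ^ 2) by nra. nra.
Qed.

Lemma C11_cder (D : C -> Prop) (f f' : C -> C) (z : C) (d : R) : C11_on D f f' -> 0 < d ->
  (forall z', Cmod (z' - z) < d -> D z') -> cder f z (f' z).
Proof.
intros [M [HM [_ H]]] Hd HD. apply (cder_of_quadratic _ _ _ M d Hd).
intros z' Hz'. apply H; [|apply HD, Hz']. apply HD.
replace (z - z)%C with (RtoC 0) by ring. rewrite Cmod_0; exact Hd.
Qed.

(** Adding the expansions from z to z' and from z' to z cancels the values and leaves (z' - z)(f' z'
    - f' z), which is bounded by 2 M |z' - z|^2. This gives the continuity of the integrand dphi (t
    z). *)
Lemma C11_derivative_lipschitz (D : C -> Prop) (f f' : C -> C) : C11_on D f f' ->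
  exists M, 0 <= M /\ forall z z', D z -> D z' -> Cmod (f' z' - f' z) <= M * Cmod (z' - z).
Proof.
intros [M [HM [_ H]]]. exists (2 * M); split; [lra|]. intros z z' Hz Hz'.
destruct (Ceq_dec z' z) as [->|N].
{ replace (f' z - f' z)%C with (RtoC 0) by ring. rewrite Cmod_0. assert (U := Cmod_ge_0 (z - z)); nra. }
destruct (H z z' Hz Hz') as [_ A]. destruct (H z' z Hz' Hz) as [_ B].
assert (T := Cmod_triangle (f z' - f z - (z' - z) * f' z) (f z - f z' - (z - z') * f' z')).
replace (f z' - f z - (z' - z) * f' z + (f z - f z' - (z - z') * f' z'))%C
  with ((z' - z) * (f' z' - f' z))%C in T by ring.
rewrite Cmod_mult in T.
replace (Cmod (z - z')) with (Cmod (z' - z)) in B by (rewrite <- Cmod_opp; f_equal; ring).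
assert (P : 0 < Cmod (z' - z)).
{ apply Cmod_gt_0; intros E; apply N. replace z' with (z' - z + z)%C by ring. rewrite E; ring. }
apply Rmult_le_reg_l with (1 := P). lra.
Qed.

Lemma C11_inv (m : R) : 0 < m -> C11_on (fun z => m <= Cmod z) Cinv (fun z => - / (z * z))%C.
Proof.
intros Hm.
assert (Hi : 0 < / m) by (apply Rinv_0_lt_compat; exact Hm).
set (i := / m) in *.
assert (Ii : forall z, m <= Cmod z -> z <> 0%C /\ Cmod (/ z) <= i).
{ intros z Hz. assert (N : z <> 0%C) by (apply Cmod_gt_0; lra). split; [exact N|].
  rewrite Cmod_inv by exact N. apply Rinv_le_contravar; assumption. }
assert (0 < i * i) by nra. assert (0 < i * (i * i)) by nra.
exists (i + i * i + i * (i * i)); split; [lra|split].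
- intros z Hz; destruct (Ii z Hz) as [N B]. assert (U := Cmod_ge_0 (/ z)).
  rewrite Cmod_opp. replace (/ (z * z))%C with (/ z * / z)%C by (field; exact N). rewrite Cmod_mult.
  assert (Cmod (/ z) * Cmod (/ z) <= i * i) by (apply Rmult_le_compat; lra). split; lra.
- intros z z' Hz Hz'. destruct (Ii z Hz) as [N B], (Ii z' Hz') as [N' B'].
  assert (U := Cmod_ge_0 (/ z)); assert (U' := Cmod_ge_0 (/ z')); assert (V := Cmod_ge_0 (z' - z)).
  set (d := Cmod (z' - z)) in *.
  assert (K1 : Cmod (/ z) * Cmod (/ z') <= i * i) by (apply Rmult_le_compat; lra).
  assert (U2 : 0 <= Cmod (/ z) * Cmod (/ z')) by (apply Rmult_le_pos; lra).
  assert (K2 : Cmod (/ z) * (Cmod (/ z) * Cmod (/ z')) <= i * (i * i)) by (apply Rmult_le_compat; lra).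
  split.
  + replace (/ z' - / z)%C with (- ((z' - z) * (/ z * / z')))%C by (field; auto).
    rewrite Cmod_opp, !Cmod_mult. fold d. nra.
  + replace (/ z' - / z - (z' - z) * (- / (z * z)))%C
      with ((z' - z) * (z' - z) * (/ z * (/ z * / z')))%C by (field; auto).
    rewrite !Cmod_mult. fold d. assert (0 <= d * d) by nra. nra.
Qed.

Lemma C11_Cexp (B : R) : C11_on (fun z => Cmod z <= B) Cexp Cexp.
Proof.
set (E := exp B). assert (HE := exp_pos B). fold E in HE.
assert (HB : forall z, Cmod z <= B -> Cmod (Cexp z) <= E).
{ intros z Hz. rewrite Cmod_Cexp.
  assert (U := Rle_trans _ _ _ (Rle_abs _) (Cmod_fst z)).
  destruct (Rle_lt_or_eq_dec (fst z) B ltac:(lra)) as [L|L]; [|rewrite L; unfold E; lra].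
  apply Rlt_le, exp_increasing, L. }
exists (12 * E); split; [lra|split].
- intros z Hz; specialize (HB z Hz); lra.
- intros z z' Hz Hz'. assert (A := HB z Hz). assert (A' := HB z' Hz').
  assert (Eq : Cexp z' = (Cexp z * Cexp (z' - z))%C) by (rewrite <- Cexp_plus; f_equal; ring).
  assert (U := Cmod_ge_0 (z' - z)). assert (V := Cmod_ge_0 (Cexp z)).
  (* Nearby points use the local quadratic estimate; for distant ones |z' - z| > 1/2 lets the crude
     bounds on the separate terms be absorbed into |z' - z| and |z' - z|^2. *)
  destruct (Rle_or_lt (Cmod (z' - z)) (1 / 2)) as [L|L].
  + assert (Q := Cexp_quadratic _ L). assert (Q0 := Cmod_ge_0 (Cexp (z' - z) - 1 - (z' - z))).
    split.
    * rewrite Eq. replace (Cexp z * Cexp (z' - z) - Cexp z)%C with (Cexp z * (Cexp (z' - z) - 1))%C by ring.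
      rewrite Cmod_mult. assert (T := Cmod_triangle (Cexp (z' - z) - 1 - (z' - z)) (z' - z)).
      replace (Cexp (z' - z) - 1 - (z' - z) + (z' - z))%C with (Cexp (z' - z) - 1)%C in T by ring.
      assert (W := Cmod_ge_0 (Cexp (z' - z) - 1)).
      apply Rle_trans with (E * (3 * Cmod (z' - z))); [|nra]. apply Rmult_le_compat; nra.
    * rewrite Eq. replace (Cexp z * Cexp (z' - z) - Cexp z - (z' - z) * Cexp z)%C
        with (Cexp z * (Cexp (z' - z) - 1 - (z' - z)))%C by ring.
      rewrite Cmod_mult. apply Rle_trans with (E * (4 * Cmod (z' - z) ^ 2)); [|nra]. apply Rmult_le_compat; nra.
  + assert (T := Cmod_triangle (Cexp z') (- Cexp z)). rewrite Cmod_opp in T.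
    fold (Cexp z' - Cexp z)%C in T.
    assert (T2 := Cmod_triangle (Cexp z' - Cexp z) (- ((z' - z) * Cexp z))). rewrite Cmod_opp, Cmod_mult in T2.
    fold (Cexp z' - Cexp z - (z' - z) * Cexp z)%C in T2.
    assert (Cmod (z' - z) * Cmod (Cexp z) <= Cmod (z' - z) * E) by (apply Rmult_le_compat_l; lra).
    assert (E <= 2 * Cmod (z' - z) * E) by nra.
    assert (Cmod (z' - z) * E <= 2 * Cmod (z' - z) ^ 2 * E) by nra.
    split; nra.
Qed.

(** * The principal square root *)

Lemma Csqrt_re_sq (z : C) : fst (Csqrt z) ^ 2 = (Cmod z + fst z) / 2.
Proof.
assert (H := Cmod_fst z). apply Rabs_le_between in H.
unfold Csqrt; simpl fst. rewrite pow2_sqrt; lra.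
Qed.

Lemma Csqrt_re_ge_0 (z : C) : 0 <= fst (Csqrt z).
Proof. apply sqrt_pos. Qed.

Lemma Csqrt_sqr (z : C) : (Csqrt z * Csqrt z)%C = z.
Proof.
assert (H := Cmod_fst z). apply Rabs_le_between in H.
assert (S := Cmod_sq z). assert (U := Cmod_ge_0 z).
set (p := sqrt ((Cmod z + fst z) / 2)). set (q := sqrt ((Cmod z - fst z) / 2)).
assert (Hp : p * p = (Cmod z + fst z) / 2) by (apply sqrt_sqrt; lra).
assert (Hq : q * q = (Cmod z - fst z) / 2) by (apply sqrt_sqrt; lra).
assert (Pp : 0 <= p) by apply sqrt_pos. assert (Pq : 0 <= q) by apply sqrt_pos.
assert (Hpq : (2 * (p * q)) ^ 2 = snd z ^ 2) by nra.
assert (Ppq : 0 <= p * q) by nra.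
unfold Csqrt; fold p q.
destruct (Rle_dec 0 (snd z)) as [L|L]; apply injective_projections; simpl; nra.
Qed.

(** Two square roots of z agree up to sign, and the sign is settled because [Csqrt z] has
    nonnegative and [s] positive real part. *)
Lemma Csqrt_unique (z s : C) : (s * s)%C = z -> 0 < fst s -> Csqrt z = s.
Proof.
intros E Hs. assert (Q := Csqrt_sqr z). assert (P := Csqrt_re_ge_0 z).
assert (F : ((Csqrt z - s) * (Csqrt z + s))%C = 0%C).
{ replace ((Csqrt z - s) * (Csqrt z + s))%C with (Csqrt z * Csqrt z - s * s)%C by ring. rewrite Q, E; ring. }
destruct (Ceq_dec (Csqrt z - s) 0) as [N|N].
- replace (Csqrt z) with (Csqrt z - s + s)%C by ring. rewrite N; ring.
- exfalso. destruct (Ceq_dec (Csqrt z + s) 0) as [N'|N'].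
  + apply (f_equal fst) in N'. simpl in N'. unfold Csqrt in P; simpl in P. lra.
  + exact (Cmult_neq_0 _ _ N N' F).
Qed.

Lemma Csqrt_re_ge (z : C) (m : R) : 0 <= m -> m ^ 2 <= fst z -> m <= fst (Csqrt z).
Proof.
intros Hm H. assert (A := Csqrt_re_sq z). assert (B := Csqrt_re_ge_0 z).
assert (U := Rle_trans _ _ _ (Rle_abs _) (Cmod_fst z)). nra.
Qed.

Lemma Cmod_Csqrt_sq (z : C) : Cmod (Csqrt z) ^ 2 = Cmod z.
Proof. rewrite <- (Csqrt_sqr z) at 2. rewrite Cmod_mult; ring. Qed.

(* Both estimates come from [sqrt z' - sqrt z = (z' - z) / (sqrt z + sqrt z')]. *)
Lemma Csqrt_estimates (z z' : C) : 0 < fst (Csqrt z) ->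
  Cmod (Csqrt z' - Csqrt z) <= / fst (Csqrt z) * Cmod (z' - z) /\
  Cmod (Csqrt z' - Csqrt z - (z' - z) * / (2 * Csqrt z)) <= / fst (Csqrt z) ^ 3 * Cmod (z' - z) ^ 2.
Proof.
intros H. assert (H' := Csqrt_re_ge_0 z').
set (s := Csqrt z) in *. set (s' := Csqrt z') in *. set (m := fst s) in *.
assert (Ez : z = (s * s)%C) by (symmetry; apply Csqrt_sqr).
assert (Ez' : z' = (s' * s')%C) by (symmetry; apply Csqrt_sqr).
assert (Ms : m <= Cmod s) by (apply Rle_trans with (2 := Cmod_fst s), Rle_abs).
assert (Mss : m <= Cmod (s + s')).
{ apply Rle_trans with (2 := Cmod_fst _). apply Rle_trans with (2 := Rle_abs _). change (fst (s + s')%C) with (m + fst s'); lra. }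
assert (Ns : s <> 0%C) by (apply Cmod_gt_0; lra).
assert (Nss : (s + s')%C <> 0%C) by (apply Cmod_gt_0; lra).
assert (Hi : 0 < / m) by (apply Rinv_0_lt_compat; exact H).
assert (I1 : Cmod (/ s) <= / m) by (rewrite Cmod_inv by exact Ns; apply Rinv_le_contravar; lra).
assert (I2 : Cmod (/ (s + s')) <= / m) by (rewrite Cmod_inv by exact Nss; apply Rinv_le_contravar; lra).
assert (U1 := Cmod_ge_0 (/ s)); assert (U2 := Cmod_ge_0 (/ (s + s'))); assert (U := Cmod_ge_0 (z' - z)).
split.
- replace (s' - s)%C with (/ (s + s') * (z' - z))%C by (rewrite Ez, Ez'; field; exact Nss).
  rewrite Cmod_mult. apply Rmult_le_compat_r; assumption.
- replace (s' - s - (z' - z) * / (2 * s))%C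
    with (- (RtoC (1 / 2) * / s * / (s + s') * / (s + s') * ((z' - z) * (z' - z))))%C.
  2:{ rewrite Ez, Ez', RtoC_div by lra. field; split; assumption. }
  rewrite Cmod_opp, !Cmod_mult, Cmod_R, Rabs_pos_eq by lra.
  replace (Cmod (z' - z) * Cmod (z' - z)) with (Cmod (z' - z) ^ 2) by ring.
  apply Rmult_le_compat_r; [apply pow2_ge_0|].
  rewrite <- pow_inv. set (i := / m) in *.
  apply Rle_trans with (1 * i * i * i); [|apply Req_le; ring].
  repeat apply Rmult_le_compat; try lra; repeat apply Rmult_le_pos; lra.
Qed.

Lemma cder_Csqrt (z : C) : 0 < fst (Csqrt z) -> cder Csqrt z (/ (2 * Csqrt z)).
Proof.
intros H. apply (cder_of_quadratic _ _ _ (/ fst (Csqrt z) ^ 3) 1 Rlt_0_1).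
intros z' _. apply Csqrt_estimates, H.
Qed.

Lemma C11_Csqrt (m B : R) : 0 < m ->
  C11_on (fun z => m <= fst z /\ Cmod z <= B) Csqrt (fun z => / (2 * Csqrt z))%C.
Proof.
intros Hm. set (k := Rmin m 1). assert (Hk : 0 < k) by (apply Rmin_pos; lra).
assert (K1 := Rmin_l m 1); assert (K2 := Rmin_r m 1); fold k in K1, K2.
assert (Hre : forall z, m <= fst z -> k <= fst (Csqrt z)).
{ intros z Hz. apply Csqrt_re_ge; nra. }
assert (Hi : 0 < / k) by (apply Rinv_0_lt_compat; exact Hk).
assert (Hi3 : 0 < / k ^ 3) by (apply Rinv_0_lt_compat, pow_lt, Hk).
assert (UB := Rabs_pos B); assert (UB' := Rle_abs B).
exists (Rabs B + 1 + / k + / k ^ 3); split; [lra|split].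
- intros z [Hz HB]. specialize (Hre z Hz). assert (A := Cmod_Csqrt_sq z). assert (P := Cmod_ge_0 (Csqrt z)).
  split; [nra|].
  assert (L : k <= Cmod (Csqrt z)).
  { apply Rle_trans with (2 := Cmod_fst _), Rle_trans with (2 := Rle_abs _), Hre. }
  assert (N : (2 * Csqrt z)%C <> 0%C).
  { apply Cmod_gt_0; rewrite Cmod_mult, Cmod_R, Rabs_pos_eq; lra. }
  rewrite Cmod_inv, Cmod_mult, Cmod_R, Rabs_pos_eq by (lra || exact N).
  assert (/ (2 * Cmod (Csqrt z)) <= / k) by (apply Rinv_le_contravar; lra). lra.
- intros z z' [Hz _] _. specialize (Hre z Hz).
  destruct (Csqrt_estimates z z') as [E1 E2]; [lra|].
  assert (U := Cmod_ge_0 (z' - z)). assert (U2 := pow2_ge_0 (Cmod (z' - z))).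
  assert (J1 : / fst (Csqrt z) <= / k) by (apply Rinv_le_contravar; lra).
  assert (J3 : / fst (Csqrt z) ^ 3 <= / k ^ 3).
  { apply Rinv_le_contravar; [apply pow_lt, Hk|apply pow_incr; lra]. }
  split; nra.
Qed.

(** * Extremal functions *)

Definition CInt (g : R -> C) : C := (RInt (fun t => fst (g t)) 0 1, RInt (fun t => snd (g t)) 0 1).

Definition Cpath (g : R -> C) : Prop := forall t, 0 <= t <= 1 ->
  continuous (fun s => fst (g s)) t /\ continuous (fun s => snd (g s)) t.

Lemma Cpath_int (g : R -> C) : Cpath g ->
  ex_RInt (fun s => fst (g s)) 0 1 /\ ex_RInt (fun s => snd (g s)) 0 1.
Proof.
intros H; split; apply (ex_RInt_continuous (V := R_CompleteNormedModule));
  rewrite Rmin_left, Rmax_right by lra; intros t Ht; apply H, Ht.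
Qed.

Lemma Cpath_minus (g h : R -> C) : Cpath g -> Cpath h -> Cpath (fun t => g t - h t)%C.
Proof.
intros G H t Ht; destruct (G t Ht), (H t Ht); split; simpl.
- apply (continuous_minus (fun s => fst (g s)) (fun s => fst (h s))); assumption.
- apply (continuous_minus (fun s => snd (g s)) (fun s => snd (h s))); assumption.
Qed.

Lemma Cpath_scal (c : C) (g : R -> C) : Cpath g -> Cpath (fun t => c * g t)%C.
Proof.
intros G t Ht; destruct (G t Ht) as [G1 G2]; split; simpl.
- apply (continuous_minus (fun s => fst c * fst (g s)) (fun s => snd c * snd (g s)));
    apply (continuous_scal_r (V := R_NormedModule)); assumption.
- apply (continuous_plus (fun s => fst c * snd (g s)) (fun s => snd c * fst (g s)));
    apply (continuous_scal_r (V := R_NormedModule)); assumption.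
Qed.

Lemma continuous_fst_snd (g : R -> C) (t : R) :
  (forall eps, 0 < eps -> exists d, 0 < d /\ forall s, Rabs (s - t) < d -> Cmod (g s - g t) < eps) ->
  continuous (fun s => fst (g s)) t /\ continuous (fun s => snd (g s)) t.
Proof.
intros H; split; apply continuous_eps; intros eps He; destruct (H eps He) as [d [Hd K]];
  exists d; (split; [exact Hd|]); intros s Hs.
- exact (Rle_lt_trans _ _ _ (Cmod_fst (g s - g t)) (K s Hs)).
- exact (Rle_lt_trans _ _ _ (Cmod_snd (g s - g t)) (K s Hs)).
Qed.

Lemma CInt_minus (g h : R -> C) : Cpath g -> Cpath h ->
  CInt (fun t => g t - h t)%C = (CInt g - CInt h)%C.
Proof.
intros G H; destruct (Cpath_int g G), (Cpath_int h H).
apply injective_projections; simpl.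
- exact (RInt_minus (V := R_CompleteNormedModule) (fun s => fst (g s)) (fun s => fst (h s)) 0 1 ltac:(assumption) ltac:(assumption)).
- exact (RInt_minus (V := R_CompleteNormedModule) (fun s => snd (g s)) (fun s => snd (h s)) 0 1 ltac:(assumption) ltac:(assumption)).
Qed.

Lemma CInt_scal (c : C) (g : R -> C) : Cpath g -> CInt (fun t => c * g t)%C = (c * CInt g)%C.
Proof.
intros G; destruct (Cpath_int g G) as [G1 G2].
assert (S : forall (k : R) (f : R -> R), ex_RInt f 0 1 ->
  ex_RInt (fun s => k * f s) 0 1 /\ RInt (fun s => k * f s) 0 1 = k * RInt f 0 1).
{ intros k f Hf; split; [apply (ex_RInt_scal (V := R_NormedModule)), Hf|].
  exact (RInt_scal (V := R_CompleteNormedModule) f 0 1 k Hf). }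
destruct (S (fst c) _ G1) as [A1 B1], (S (snd c) _ G1) as [A2 B2].
destruct (S (fst c) _ G2) as [A3 B3], (S (snd c) _ G2) as [A4 B4].
apply injective_projections; simpl.
- rewrite <- B1, <- B4. exact (RInt_minus (V := R_CompleteNormedModule) _ _ 0 1 A1 A4).
- rewrite <- B3, <- B2. exact (RInt_plus (V := R_CompleteNormedModule) _ _ 0 1 A3 A2).
Qed.

(** The factor 2 comes from bounding the two components separately; in the application only the
    order in |z' - z| matters. *)
Lemma CInt_bound (g : R -> C) (M : R) : Cpath g -> (forall t, 0 <= t <= 1 -> Cmod (g t) <= M) ->
  Cmod (CInt g) <= 2 * M.
Proof.
intros G H; destruct (Cpath_int g G) as [G1 G2].
assert (A := RInt_near_const _ 0 1 0 M Rle_0_1 G1). assert (B := RInt_near_const _ 0 1 0 M Rle_0_1 G2).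
rewrite Rmult_0_l, !Rminus_0_r, Rmult_1_r in A, B.
apply Rle_trans with (1 := Cmod_le_sum _); simpl.
apply Rle_trans with (M + M); [|lra].
apply Rplus_le_compat.
- apply A; intros t Ht. rewrite Rminus_0_r. apply Rle_trans with (1 := Cmod_fst _), H, Ht.
- apply B; intros t Ht. rewrite Rminus_0_r. apply Rle_trans with (1 := Cmod_snd _), H, Ht.
Qed.

Lemma CInt_0 : CInt (fun _ => 0%C) = 0%C.
Proof.
unfold CInt; simpl. rewrite RInt_const. unfold scal; simpl; unfold mult; simpl. rewrite Rmult_0_r. reflexivity.
Qed.

Lemma Cdiv_RtoC (c : C) (s : R) : s <> 0 -> (c / RtoC s)%C = (fst c * / s, snd c * / s).
Proof. intros H. apply injective_projections; simpl; field; exact H. Qed.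

Definition closed_disk (r : R) (z : C) : Prop := Cmod z <= r.

(* [(phi (t z) - 1) / t], continuously extended to [t = 0] when [phi 0 = 1]. *)
Definition quotient_path (phi dphi : C -> C) (z : C) (t : R) : C :=
  if Req_dec_T t 0 then (z * dphi 0)%C else ((phi (RtoC t * z) - 1) / RtoC t)%C.

(** With zeta = t z this is the integral of (phi zeta - 1) / zeta along the segment from 0 to z. *)
Definition primitive (phi dphi : C -> C) (z : C) : C := CInt (quotient_path phi dphi z).

Section Extremal.

Variables phi dphi : C -> C.
Hypothesis phi0 : phi 0 = 1.
Hypothesis Hphi : forall r, r < 1 -> C11_on (closed_disk r) phi dphi.

(** Continuity is two-sided even at the endpoints of [0, 1], so parameters s slightly outside that
    interval must still give points of a disk of radius less than 1. *)
Lemma ray_closed_disk (z : C) (s t : R) : Cmod z < 1 -> 0 <= t <= 1 ->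
  Rabs (s - t) < (1 - Cmod z) / 2 -> closed_disk ((1 + Cmod z) / 2) (RtoC s * z).
Proof.
intros Hz Ht Hs. unfold closed_disk. rewrite Cmod_mult, Cmod_R.
assert (U := Cmod_ge_0 z). apply Rabs_lt_between in Hs.
assert (A : Rabs s <= 1 + (1 - Cmod z) / 2) by (apply Rabs_le_between; lra).
assert (P := Rabs_pos s). nra.
Qed.

Lemma cder_phi (z : C) : Cmod z < 1 -> cder phi z (dphi z).
Proof.
intros Hz. apply (C11_cder (closed_disk ((1 + Cmod z) / 2)) _ _ _ ((1 - Cmod z) / 2)); [apply Hphi; lra|lra|].
intros z' Hz'. unfold closed_disk. assert (T := Cmod_triangle (z' - z) z).
replace (z' - z + z)%C with z' in T by ring. lra.
Qed.

Lemma Cpath_dphi (z : C) : Cmod z < 1 -> Cpath (fun t => dphi (RtoC t * z)).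
Proof.
intros Hz t Ht. apply (continuous_fst_snd (fun s => dphi (RtoC s * z)%C)). intros eps He.
destruct (C11_derivative_lipschitz _ _ _ (Hphi ((1 + Cmod z) / 2) ltac:(lra))) as [M [HM L]].
assert (Hp : 0 < eps / (M + 1)) by (apply Rdiv_lt_0_compat; lra).
exists (Rmin ((1 - Cmod z) / 2) (eps / (M + 1))); split; [apply Rmin_pos; lra|].
intros s Hs. assert (A := Rlt_le_trans _ _ _ Hs (Rmin_l _ _)). assert (B := Rlt_le_trans _ _ _ Hs (Rmin_r _ _)).
specialize (L (RtoC t * z)%C (RtoC s * z)%C).
apply Rle_lt_trans with (M * Cmod (RtoC s * z - RtoC t * z)).
- apply L; apply (ray_closed_disk z _ t); try assumption. rewrite Rminus_diag, Rabs_R0; lra.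
- replace (RtoC s * z - RtoC t * z)%C with (RtoC (s - t) * z)%C by (rewrite RtoC_minus; ring).
  rewrite Cmod_mult, Cmod_R. assert (U := Cmod_ge_0 z). assert (V := Rabs_pos (s - t)).
  apply (Rmult_lt_compat_r (M + 1)) in B; [|lra].
  replace (eps / (M + 1) * (M + 1)) with eps in B by (field; lra).
  assert (Rabs (s - t) * Cmod z <= Rabs (s - t)) by nra. nra.
Qed.

(** At t = 0 the quadratic remainder of [phi] at 0 bounds the deviation from z dphi 0 by M |s|
    |z|^2. Elsewhere the path agrees near t with a quotient of continuous functions. *)
Lemma Cpath_quotient (z : C) : Cmod z < 1 -> Cpath (quotient_path phi dphi z).
Proof.
intros Hz t Ht. destruct (Req_dec t 0) as [->|N].
- apply continuous_fst_snd. intros eps He.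
  destruct (Hphi ((1 + Cmod z) / 2) ltac:(lra)) as [M [HM [_ H]]].
  assert (Hp : 0 < eps / (M + 1)) by (apply Rdiv_lt_0_compat; lra).
  exists (Rmin ((1 - Cmod z) / 2) (eps / (M + 1))); split; [apply Rmin_pos; lra|].
  intros s Hs. assert (A := Rlt_le_trans _ _ _ Hs (Rmin_l _ _)). assert (B := Rlt_le_trans _ _ _ Hs (Rmin_r _ _)).
  unfold quotient_path. destruct (Req_dec_T 0 0) as [_|F]; [|contradiction F; reflexivity].
  destruct (Req_dec_T s 0) as [E|Ns].
  { replace (z * dphi 0 - z * dphi 0)%C with (RtoC 0) by ring. rewrite Cmod_0; exact He. }
  assert (NR : RtoC s <> 0%C) by (intros E; apply RtoC_inj in E; contradiction).
  destruct (H 0%C (RtoC s * z)%C) as [_ Q].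
  { unfold closed_disk; rewrite Cmod_0; assert (U := Cmod_ge_0 z); lra. }
  { apply (ray_closed_disk z s 0); lra || assumption. }
  rewrite phi0 in Q. replace (RtoC s * z - 0)%C with (RtoC s * z)%C in Q by ring.
  replace (phi (RtoC s * z) - 1 - RtoC s * z * dphi 0)%C
    with (RtoC s * ((phi (RtoC s * z) - 1) / RtoC s - z * dphi 0))%C in Q by (field; exact NR).
  rewrite !Cmod_mult, Cmod_R in Q. rewrite Rminus_0_r in *.
  assert (P := Rabs_pos_lt _ Ns). assert (U := Cmod_ge_0 z).
  apply (Rmult_lt_compat_r (M + 1)) in B; [|lra].
  replace (eps / (M + 1) * (M + 1)) with eps in B by (field; lra).
  apply Rmult_lt_reg_l with (1 := P).
  apply Rle_lt_trans with (1 := Q).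
  assert (Rabs s * Cmod z <= Rabs s) by nra. assert (0 <= Rabs s * Cmod z) by nra.
  assert ((Rabs s * Cmod z) ^ 2 <= Rabs s ^ 2) by (apply pow_incr; lra). nra.
- assert (D := cder_phi (RtoC t * z)).
  assert (Hlt : Cmod (RtoC t * z) < 1).
  { rewrite Cmod_mult, Cmod_R, Rabs_pos_eq by lra. assert (U := Cmod_ge_0 z); nra. }
  destruct (cder_ray _ _ _ _ (D Hlt)) as [D1 D2].
  assert (Near : forall g h : R -> R, (forall s, s <> 0 -> g s = h s) -> continuous g t -> continuous h t).
  { intros g h E C. apply continuous_ext_loc with (2 := C).
    assert (P := Rabs_pos_lt _ N). exists (mkposreal _ P). intros y Hy. apply E. intros ->.
    revert Hy. unfold ball; simpl; unfold AbsRing_ball, abs, minus, plus, opp; simpl.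
    rewrite Rplus_0_l, Rabs_Ropp. lra. }
  split.
  + apply Near with (fun s => (fst (phi (RtoC s * z)%C) - 1) * / s).
    * intros s Hs. unfold quotient_path. destruct (Req_dec_T s 0) as [E|_]; [contradiction|].
      rewrite Cdiv_RtoC by exact Hs. simpl; unfold Rminus; rewrite ?Ropp_0, ?Rplus_0_r; reflexivity.
    * apply (continuous_mult (K := R_AbsRing) (fun s => fst (phi (RtoC s * z)%C) - 1) Rinv);
        [|apply continuous_Rinv, N].
      apply (continuous_minus (V := R_NormedModule) (fun s => fst (phi (RtoC s * z)%C)) (fun _ => 1));
        [|apply continuous_const].
      apply (ex_derive_continuous (V := R_NormedModule)). eexists; exact D1.
  + apply Near with (fun s => snd (phi (RtoC s * z)%C) * / s).
    * intros s Hs. unfold quotient_path. destruct (Req_dec_T s 0) as [E|_]; [contradiction|].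
      rewrite Cdiv_RtoC by exact Hs. simpl; unfold Rminus; rewrite ?Ropp_0, ?Rplus_0_r; reflexivity.
    * apply (continuous_mult (K := R_AbsRing) (fun s => snd (phi (RtoC s * z)%C)) Rinv);
        [|apply continuous_Rinv, N].
      apply (ex_derive_continuous (V := R_NormedModule)). eexists; exact D2.
Qed.

(** Differentiation under the integral: the remainder of (phi (t z) - 1) / t is 1 / t times that of
    [phi] at t z for the increment t (z' - z), hence at most M t |z' - z|^2, uniformly in t. The
    singular factor 1 / t also disappears from the derivative dphi (t z). *)
Lemma cder_primitive (z : C) : Cmod z < 1 ->
  cder (primitive phi dphi) z (CInt (fun t => dphi (RtoC t * z))).
Proof.
intros Hz. destruct (Hphi ((1 + Cmod z) / 2) ltac:(lra)) as [M [HM [_ H]]].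
apply (cder_of_quadratic _ _ _ (2 * M) ((1 - Cmod z) / 2)); [lra|].
intros z' Hz'.
assert (T := Cmod_triangle (z' - z) z). replace (z' - z + z)%C with z' in T by ring.
assert (Hz1 : Cmod z' < 1) by lra.
unfold primitive.
rewrite <- CInt_minus by (apply Cpath_quotient; assumption).
rewrite <- CInt_scal by (apply Cpath_dphi; assumption).
rewrite <- CInt_minus; [|apply Cpath_minus; apply Cpath_quotient; assumption|apply Cpath_scal, Cpath_dphi; assumption].
rewrite Rmult_assoc. apply CInt_bound.
{ apply Cpath_minus; [apply Cpath_minus; apply Cpath_quotient; assumption|apply Cpath_scal, Cpath_dphi; assumption]. }
intros t Ht. assert (U := Cmod_ge_0 (z' - z)). unfold quotient_path. destruct (Req_dec_T t 0) as [->|N].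
- rewrite Cmult_0_l. replace (z' * dphi 0 - z * dphi 0 - (z' - z) * dphi 0)%C with (RtoC 0) by ring.
  rewrite Cmod_0. nra.
- assert (NR : RtoC t <> 0%C) by (intros E; apply RtoC_inj in E; contradiction).
  destruct (H (RtoC t * z)%C (RtoC t * z')%C) as [_ Q].
  1, 2: unfold closed_disk; rewrite Cmod_mult, Cmod_R, Rabs_pos_eq by lra;
    assert (U1 := Cmod_ge_0 z); assert (U2 := Cmod_ge_0 z'); nra.
  replace (phi (RtoC t * z') - phi (RtoC t * z) - (RtoC t * z' - RtoC t * z) * dphi (RtoC t * z))%C
    with (RtoC t * ((phi (RtoC t * z') - 1) / t - (phi (RtoC t * z) - 1) / t - (z' - z) * dphi (RtoC t * z)))%C
    in Q by (field; exact NR).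
  replace (RtoC t * z' - RtoC t * z)%C with (RtoC t * (z' - z))%C in Q by ring.
  rewrite !Cmod_mult, Cmod_R, Rabs_pos_eq in Q by lra.
  apply Rmult_le_reg_l with t; [lra|]. apply Rle_trans with (1 := Q).
  assert (P : 0 <= M * Cmod (z' - z) ^ 2) by (apply Rmult_le_pos; [lra|apply pow2_ge_0]).
  replace (M * (t * Cmod (z' - z)) ^ 2) with (t * (t * (M * Cmod (z' - z) ^ 2))) by ring.
  apply Rmult_le_compat_l; [lra|]. rewrite <- (Rmult_1_l (M * Cmod (z' - z) ^ 2)) at 2.
  apply Rmult_le_compat_r; lra.
Qed.

(** z dphi (t z) is the derivative of phi (t z) in t, so the fundamental theorem of calculus
    applies. In terms of the primitive F this is z F' = phi - 1, the logarithmic derivative needed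
    for z exp F. *)
Lemma primitive_equation (z : C) : Cmod z < 1 ->
  (z * CInt (fun t => dphi (RtoC t * z)))%C = (phi z - 1)%C.
Proof.
intros Hz. assert (CP := Cpath_dphi z Hz).
rewrite <- CInt_scal by exact CP. assert (CS := Cpath_scal z _ CP).
assert (D : forall t, 0 <= t <= 1 -> cder phi (RtoC t * z) (dphi (RtoC t * z))).
{ intros t Ht. apply cder_phi. rewrite Cmod_mult, Cmod_R, Rabs_pos_eq by lra.
  assert (U := Cmod_ge_0 z); nra. }
unfold CInt. apply injective_projections; simpl fst; simpl snd.
- rewrite (is_RInt_unique _ 0 1 (minus (fst (phi (RtoC 1 * z)%C)) (fst (phi (RtoC 0 * z)%C)))).
  + rewrite Cmult_1_l, Cmult_0_l, phi0. reflexivity.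
  + apply (is_RInt_derive (V := R_CompleteNormedModule) (fun t => fst (phi (RtoC t * z)%C)));
      rewrite Rmin_left, Rmax_right by lra; intros t Ht.
    * apply cder_ray, D, Ht.
    * apply CS, Ht.
- rewrite (is_RInt_unique _ 0 1 (minus (snd (phi (RtoC 1 * z)%C)) (snd (phi (RtoC 0 * z)%C)))).
  + rewrite Cmult_1_l, Cmult_0_l, phi0. reflexivity.
  + apply (is_RInt_derive (V := R_CompleteNormedModule) (fun t => snd (phi (RtoC t * z)%C)));
      rewrite Rmin_left, Rmax_right by lra; intros t Ht.
    * apply cder_ray, D, Ht.
    * apply CS, Ht.
Qed.

Lemma primitive_0 : primitive phi dphi 0 = 0%C.
Proof.
assert (Q : forall t, quotient_path phi dphi 0 t = 0%C).
{ intros t; unfold quotient_path; destruct (Req_dec_T t 0) as [E|N]; [ring|].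
  rewrite Cmult_0_r, phi0. field. intros E; apply RtoC_inj in E; contradiction. }
transitivity (CInt (fun _ => 0%C)); [|apply CInt_0].
unfold primitive, CInt. f_equal; apply RInt_ext; intros t _; rewrite Q; reflexivity.
Qed.

Lemma extremal_function : exists f f' : C -> C, classA f /\
  (forall z, in_disk z -> z <> RtoC 0 -> f z <> RtoC 0) /\ derivative_on_disk f f' /\
  (forall z, in_disk z -> zf'_over_f f f' z = phi z).
Proof.
set (F := primitive phi dphi). set (dF := fun z => CInt (fun t => dphi (RtoC t * z))).
assert (D : forall z, in_disk z -> cder (fun z => z * Cexp (F z))%C z (Cexp (F z) + z * (Cexp (F z) * dF z))).
{ intros z Hz. refine (cder_eq _ _ _ _ (cder_mult (fun z => z) _ _ _ _ (cder_id z)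
    (cder_comp Cexp F _ _ _ (cder_Cexp (F z)) (cder_primitive z Hz))) _). unfold dF. ring. }
assert (H0 : in_disk 0) by (unfold in_disk; rewrite Cmod_0; lra).
exists (fun z => z * Cexp (F z))%C, (fun z => Cexp (F z) + z * (Cexp (F z) * dF z))%C.
split; [split; [|split]|split; [|split]].
- intros z Hz; eexists; apply cder_is_derive, D, Hz.
- apply Cmult_0_l.
- apply cder_is_derive. refine (cder_eq _ _ _ _ (D _ H0) _). unfold F; rewrite primitive_0, Cexp_0. ring.
- intros z _ Hz; apply Cmult_neq_0; [exact Hz|apply Cexp_neq_0].
- intros z Hz; apply cder_is_derive, D, Hz.
- intros z Hz. unfold zf'_over_f. destruct (Req_dec_T (Cmod z) 0) as [E|N].
  + apply Cmod_eq_0 in E; rewrite E; symmetry; exact phi0.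
  + assert (Nz : z <> 0%C) by (intros E; apply N; rewrite E; apply Cmod_0).
    assert (NE := Cexp_neq_0 (F z)).
    assert (P := primitive_equation z Hz). fold (dF z) in P.
    replace (phi z) with (1 + z * dF z)%C by (rewrite P; ring). field. split; assumption.
Qed.

End Extremal.

(** * The radius criterion *)

(* In the half-plane [Re p > 1/2], the disk with diameter [[0, 5/2]] lies in the cardioid domain and touches
   its boundary at 5/2. *)
Definition in_cardioid_disk (p : C) : Prop :=
  1 / 2 < fst p /\ 2 * (fst p ^ 2 + snd p ^ 2) < 5 * fst p.

Lemma in_cardioid_disk_near_1 (p : C) :
  1 / 2 < fst p -> Cmod (p - 1) ^ 2 <= 5 / 4 -> in_cardioid_disk p.
Proof.
intros H1 H2. rewrite Cmod_sq in H2. simpl fst in H2; simpl snd in H2. split; [exact H1|].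
destruct p as [x y]; simpl fst in *; simpl snd in *. nra.
Qed.

Definition car_inv (p : C) : C := (Csqrt (2 * p - 1) - 1)%C.

Lemma phi_car_car_inv (p : C) : phi_car (car_inv p) = p.
Proof.
unfold phi_car, car_inv. set (s := Csqrt (2 * p - 1)).
assert (E : (s * s)%C = (2 * p - 1)%C) by apply Csqrt_sqr.
replace (1 + (s - 1) + (s - 1) * (s - 1) / 2)%C with ((s * s + 1) / 2)%C by field.
rewrite E; field.
Qed.

(** Expanding |sqrt u - 1|^2 < 1 gives |u| < 2 Re sqrt u, that is |u|^2 < 2 (|u| + Re u). The disk
    becomes |u|^2 < 3 Re u + 4, whence |u| < 4. For |u| <= 2 the claim follows from Re u > 0; for 2
    < |u| < 4 it reduces to (|u| - 2)(|u| - 4) < 0. *)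
Lemma car_inv_disk (p : C) : in_cardioid_disk p -> in_disk (car_inv p).
Proof.
intros [H1 H2]. unfold in_disk, car_inv. set (u := (2 * p - 1)%C).
assert (Ru : fst u = 2 * fst p - 1) by (unfold u; simpl; ring).
assert (Iu : snd u = 2 * snd p) by (unfold u; simpl; ring).
assert (A := Csqrt_re_sq u). assert (B := Csqrt_re_ge_0 u). assert (S := Cmod_Csqrt_sq u). assert (M := Cmod_sq u).
rewrite Cmod_sq in S. assert (U := Cmod_ge_0 u).
assert (V := Rle_trans _ _ _ (Rle_abs _) (Cmod_fst u)).
assert (M4 : Cmod u ^ 2 < 3 * fst u + 4) by (rewrite M, Ru, Iu; nra).
assert (Hm : Cmod u < 4) by nra.
assert (K : Cmod u ^ 2 < 2 * (Cmod u + fst u)).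
{ destruct (Rle_or_lt (Cmod u) 2) as [L|L]; nra. }
assert (K' : Cmod u < 2 * fst (Csqrt u)) by nra.
apply Cmod_lt_of_sq; [lra|]. simpl fst; simpl snd. unfold Csqrt in S, K'; simpl in S, K'. nra.
Qed.

Lemma cder_car_inv (p : C) : in_cardioid_disk p -> exists l, cder car_inv p l.
Proof.
intros [H1 H2]. eexists. unfold car_inv.
apply (cder_minus (fun p => Csqrt (2 * p - 1)) (fun _ => 1%C)); [|apply cder_const].
apply (cder_comp Csqrt (fun p => 2 * p - 1)%C).
- apply cder_Csqrt.
  assert (A := Csqrt_re_sq (2 * p - 1)). assert (B := Csqrt_re_ge_0 (2 * p - 1)).
  assert (V := Rle_trans _ _ _ (Rle_abs _) (Cmod_fst (2 * p - 1))).
  assert (Ru : fst (2 * p - 1)%C = 2 * fst p - 1) by (simpl; ring). nra.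
- apply (cder_minus (fun p => 2 * p)%C (fun _ => 1%C)); [apply cder_scal, cder_id|apply cder_const].
Qed.

Definition dilation (f : C -> C) (r : R) (z : C) : C := Cdiv (f (Cmult (RtoC r) z)) (RtoC r).

Lemma RtoC_neq_0 (r : R) : r <> 0 -> RtoC r <> 0%C.
Proof. intros H E; apply RtoC_inj in E; contradiction. Qed.

Lemma dilation_in_disk (r : R) (z : C) : 0 < r <= 1 -> in_disk z -> in_disk (RtoC r * z).
Proof.
intros Hr Hz. unfold in_disk in *. rewrite Cmod_mult, Cmod_R, Rabs_pos_eq by lra.
assert (U := Cmod_ge_0 z); nra.
Qed.

Lemma cder_dilation (f : C -> C) (r : R) (z l : C) : r <> 0 ->
  cder f (RtoC r * z) l -> cder (dilation f r) z l.
Proof.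
intros Hr H. apply RtoC_neq_0 in Hr. unfold dilation.
refine (cder_eq _ _ _ _ (cder_mult (fun z => f (RtoC r * z)%C) (fun _ => / RtoC r)%C _ _ _
  (cder_comp f (fun z => RtoC r * z)%C _ _ _ H (cder_scal _ _ _ _ (cder_id z))) (cder_const _ _)) _).
field; exact Hr.
Qed.

Lemma zf'_over_f_dilation (f f' : C -> C) (r : R) (z : C) : 0 < r ->
  (z <> 0%C -> f (RtoC r * z)%C <> 0%C) ->
  zf'_over_f (dilation f r) (fun z => f' (RtoC r * z)%C) z = zf'_over_f f f' (RtoC r * z).
Proof.
intros Hr Hf. assert (NR := RtoC_neq_0 r ltac:(lra)). unfold zf'_over_f.
rewrite Cmod_mult, Cmod_R, Rabs_pos_eq by lra.
destruct (Req_dec_T (Cmod z) 0) as [E|N]; destruct (Req_dec_T (r * Cmod z) 0) as [E'|N'].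
- reflexivity.
- exfalso; apply N'; rewrite E; ring.
- exfalso; nra.
- assert (Nf : f (RtoC r * z)%C <> 0%C) by (apply Hf; intros E; apply N; rewrite E; apply Cmod_0).
  unfold dilation. field. split; assumption.
Qed.

Lemma schwarz_id : schwarz (fun z => z).
Proof.
split; [|split].
- intros z _; eexists; apply cder_is_derive, cder_id.
- reflexivity.
- intros z Hz; exact Hz.
Qed.

Section Radius.

Variables (phi dphi : C -> C) (r0 : R).
Hypothesis Hr0 : 0 < r0 < 1.
Hypothesis phi0 : phi 0 = 1.
Hypothesis Hphi : forall r, r < 1 -> C11_on (closed_disk r) phi dphi.

Lemma cardioid_radius_property :
  (forall z, Cmod z < r0 -> in_cardioid_disk (phi z)) -> radius_property (Sstar phi) phi_car r0.
Proof.
intros Hincl f [[Han [Hf0 Hf1]] [Hnz [f' [Hf' [w [Hw Hsub]]]]]].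
assert (NR := RtoC_neq_0 r0 ltac:(lra)).
assert (Hdisk : forall z, in_disk z -> in_disk (RtoC r0 * z)) by (intros z Hz; apply dilation_in_disk; [lra|exact Hz]).
assert (D : forall z, in_disk z -> cder (dilation f r0) z (f' (RtoC r0 * z)%C)).
{ intros z Hz. apply cder_dilation; [lra|]. apply cder_is_derive, Hf', Hdisk, Hz. }
assert (Hnz' : forall z, in_disk z -> z <> 0%C -> f (RtoC r0 * z)%C <> 0%C).
{ intros z Hz Nz; apply Hnz; [apply Hdisk, Hz|apply Cmult_neq_0; assumption]. }
assert (Hcar : forall z, in_disk z -> in_cardioid_disk (phi (w (RtoC r0 * z)%C))).
{ intros z Hz. apply Hincl. assert (S := schwarz_lemma w _ Hw (Hdisk z Hz)).
  rewrite Cmod_mult, Cmod_R, Rabs_pos_eq in S by lra. unfold in_disk in Hz.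
  assert (U := Cmod_ge_0 z). nra. }
split; [split; [|split]|split].
- intros z Hz; eexists; apply cder_is_derive, D, Hz.
- rewrite Cmult_0_r, Hf0. field; exact NR.
- apply cder_is_derive, (cder_dilation f); [lra|]. apply cder_is_derive. rewrite Cmult_0_r. exact Hf1.
- intros z Hz Nz E. apply (Hnz' z Hz Nz).
  replace (f (RtoC r0 * z)%C) with (f (RtoC r0 * z)%C / RtoC r0 * RtoC r0)%C by (field; exact NR).
  rewrite E; ring.
- exists (fun z => f' (RtoC r0 * z)%C); split; [intros z Hz; apply cder_is_derive, D, Hz|].
  destruct Hw as [Hwan [Hw0 Hwd]].
  (* The Schwarz function for [phi_car] is explicit: the inverse branch applied to phi (w (r0 z)).
     It vanishes at 0 because phi 0 = 1 and the principal root of 1 is 1. *)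
  exists (fun z => car_inv (phi (w (RtoC r0 * z)%C))); split; [split; [|split]|].
  + intros z Hz. destruct (cder_car_inv _ (Hcar z Hz)) as [l Hl].
    destruct (Hwan _ (Hdisk z Hz)) as [lw Hlw]. apply cder_is_derive in Hlw.
    eexists; apply cder_is_derive.
    apply (cder_comp car_inv (fun z => phi (w (RtoC r0 * z)%C))); [exact Hl|].
    apply (cder_comp phi (fun z => w (RtoC r0 * z)%C)).
    * apply (cder_phi phi dphi Hphi), Hwd, Hdisk, Hz.
    * apply (cder_comp w (fun z => RtoC r0 * z)%C); [exact Hlw|apply cder_scal, cder_id].
  + rewrite Cmult_0_r, Hw0, phi0. unfold car_inv.
    rewrite (Csqrt_unique _ 1); [ring|ring|simpl; lra].
  + intros z Hz; apply car_inv_disk, Hcar, Hz.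
  + intros z Hz. rewrite phi_car_car_inv, <- Hsub by (apply Hdisk, Hz).
    apply (zf'_over_f_dilation f f'); [lra|]. apply Hnz', Hz.
Qed.

(* At the cusp [1/2 = phi_car (-1)] the only preimage under [phi_car] lies on the unit circle. *)
Lemma cardioid_radius_upper (r : R) : phi (RtoC (- r0)) = RtoC (1 / 2) ->
  0 < r <= 1 -> radius_property (Sstar phi) phi_car r -> r <= r0.
Proof.
intros Hcusp Hr Hrad. destruct (Rle_or_lt r r0) as [L|L]; [exact L|exfalso].
destruct (extremal_function phi dphi phi0 Hphi) as [f [f' [HA [Hnz [Hf' Heq]]]]].
assert (HS : Sstar phi f).
{ split; [exact HA|split; [exact Hnz|]]. exists f'; split; [exact Hf'|].
  exists (fun z => z); split; [exact schwarz_id|exact Heq]. }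
destruct (Hrad f HS) as [_ [_ [g' [Hg' [v [[_ [_ Hv]] Hsub]]]]]].
assert (NR := RtoC_neq_0 r ltac:(lra)).
(* As r > r0, this point lies in the disk, and dilation by r sends it to - r0, where the extremal
   function attains the cusp value. *)
set (z := RtoC (- r0 / r)).
assert (Erz : (RtoC r * z)%C = RtoC (- r0)) by (unfold z; rewrite <- RtoC_mult; f_equal; field; lra).
assert (Hz : in_disk z).
{ unfold in_disk, z. rewrite Cmod_R. unfold Rdiv. rewrite Rabs_mult, Rabs_Ropp, Rabs_inv, !Rabs_pos_eq by lra.
  apply Rmult_lt_reg_r with r; [lra|]. rewrite Rmult_assoc, Rinv_l; lra. }
assert (Hrz : in_disk (RtoC r * z)) by (apply dilation_in_disk; assumption).
assert (Eg : g' z = f' (RtoC r * z)%C).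
{ apply (cder_unique (dilation f r) z).
  - apply cder_is_derive, Hg', Hz.
  - apply cder_dilation; [lra|]. apply cder_is_derive, Hf', Hrz. }
assert (Ez : zf'_over_f (dilation f r) g' z = RtoC (1 / 2)).
{ rewrite <- Hcusp, <- Erz, <- Heq by exact Hrz.
  rewrite <- (zf'_over_f_dilation f f' r z).
  - unfold zf'_over_f. rewrite Eg. reflexivity.
  - lra.
  - intros Nz; apply Hnz; [exact Hrz|apply Cmult_neq_0; assumption]. }
unfold dilation in Ez. rewrite (Hsub z Hz) in Ez. specialize (Hv z Hz).
set (u := v z) in *. unfold phi_car in Ez.
assert (E2 : ((1 + u) * (1 + u))%C = 0%C).
{ replace ((1 + u) * (1 + u))%C with (2 * (1 + u + u * u / 2) - 1)%C by field.
  rewrite Ez, RtoC_div by lra. field. }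
destruct (Ceq_dec (1 + u) 0) as [E1|N1]; [|exact (Cmult_neq_0 _ _ N1 N1 E2)].
unfold in_disk in Hv. replace u with (1 + u - 1)%C in Hv by ring. rewrite E1 in Hv.
replace (0 - 1)%C with (- (1))%C in Hv by ring. rewrite Cmod_m1 in Hv. lra.
Qed.

Lemma cardioid_radius : phi (RtoC (- r0)) = RtoC (1 / 2) ->
  (forall z, Cmod z < r0 -> in_cardioid_disk (phi z)) -> is_radius (Sstar phi) phi_car r0.
Proof.
intros Hcusp Hincl. split; [lra|split].
- apply cardioid_radius_property, Hincl.
- intros r; apply cardioid_radius_upper, Hcusp.
Qed.

End Radius.

(** * The nine families *)

Lemma C11_id_disk (r : R) : C11_on (closed_disk r) (fun z => z) (fun _ => 1%C).
Proof. apply (C11_id _ r); intros z Hz; exact Hz. Qed.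

(** The bound k < 1 keeps 1 + h in the half-plane Re >= 1 - k, away from the branch cut. *)
Lemma C11_Csqrt_1_plus (D : C -> Prop) (h h' : C -> C) (k : R) : k < 1 ->
  C11_on D h h' -> (forall z, D z -> Cmod (h z) <= k) ->
  C11_on D (fun z => Csqrt (1 + h z)) (fun z => / (2 * Csqrt (1 + h z)) * (0 + h' z))%C.
Proof.
intros Hk Hh Hb.
apply (C11_comp D (fun z => 1 - k <= fst z /\ Cmod z <= 1 + k) (fun z => 1 + h z)%C Csqrt
  (fun z => 0 + h' z)%C (fun z => / (2 * Csqrt z))%C).
- intros z Hz; specialize (Hb z Hz). split.
  + assert (A := Rle_trans _ _ _ (Cmod_fst (h z)) Hb). apply Rabs_le_between in A. simpl. lra.
  + assert (T := Cmod_triangle 1 (h z)). rewrite Cmod_1 in T. lra.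
- apply C11_Csqrt; lra.
- apply (C11_plus D (fun _ => 1%C) h (fun _ => 0%C) h'); [apply C11_const|exact Hh].
Qed.

Lemma Csqrt_re_gt (z : C) (m : R) : 0 <= m -> m ^ 2 < fst z -> m < fst (Csqrt z).
Proof.
intros Hm H. assert (A := Csqrt_re_sq z). assert (B := Csqrt_re_ge_0 z).
assert (U := Rle_trans _ _ _ (Rle_abs _) (Cmod_fst z)). nra.
Qed.

(** With s the root, h = (s - 1)(s + 1), and Re s >= 0 makes the second factor at least 1 in
    modulus. *)
Lemma Csqrt_1_plus_near_1 (h : C) : Cmod (Csqrt (1 + h) - 1) <= Cmod h.
Proof.
set (s := Csqrt (1 + h)). assert (P : 0 <= fst s) by apply Csqrt_re_ge_0.
assert (E : (s * s)%C = (1 + h)%C) by apply Csqrt_sqr.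
replace h with ((s - 1) * (s + 1))%C.
2:{ replace ((s - 1) * (s + 1))%C with (s * s - 1)%C by ring. rewrite E; ring. }
rewrite Cmod_mult. assert (U := Cmod_ge_0 (s - 1)).
assert (V : 1 <= Cmod (s + 1)).
{ apply Rle_trans with (2 := Cmod_fst _), Rle_trans with (2 := Rle_abs _).
  change (fst (s + 1)%C) with (fst s + 1). lra. }
nra.
Qed.

Lemma Cmod_lt_coords (z : C) (r : R) : Cmod z < r -> fst z ^ 2 + snd z ^ 2 < r ^ 2.
Proof. intros H; rewrite <- Cmod_sq. assert (U := Cmod_ge_0 z). nra. Qed.

Lemma Csqrt_0_1 : Csqrt 1 = 1.
Proof. apply Csqrt_unique; [ring|simpl; lra]. Qed.

Lemma Csqrt_RtoC_sq (q : R) : 0 < q -> Csqrt (RtoC (q * q)) = RtoC q.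
Proof. intros H; apply Csqrt_unique; [symmetry; apply RtoC_mult|exact H]. Qed.

(** * Families defined by a square root of a linear function *)

Lemma C11_phi_L (a r : R) : r < 1 -> C11_on (closed_disk r) (phi_L a)
  (fun z => 0 + (0 * Csqrt (1 + z) + RtoC (1 - a) * (/ (2 * Csqrt (1 + z)) * (0 + 1))))%C.
Proof.
intros Hr. apply (C11_plus _ (fun _ => RtoC a) (fun z => RtoC (1 - a) * Csqrt (1 + z))%C (fun _ => 0%C));
  [apply C11_const|].
apply (C11_mult _ (fun _ => RtoC (1 - a)) (fun z => Csqrt (1 + z)) (fun _ => 0%C)); [apply C11_const|].
apply (C11_Csqrt_1_plus _ (fun z => z) (fun _ => 1%C) r Hr); [apply C11_id_disk|intros z Hz; exact Hz].
Qed.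

Lemma radius_L (a : R) : 0 <= a < 1 / 2 ->
  is_radius (Sstar (phi_L a)) phi_car ((3 - 4 * a) / (4 * (1 - a) ^ 2)).
Proof.
(* q is the value that the root must take at - r0 to produce the cusp, a + (1 - a) q = 1/2; the
   radius is then 1 - q^2. *)
intros Ha. set (q := (1 - 2 * a) / (2 * (1 - a))).
assert (Hq : 0 < q <= 1).
{ unfold q; split; [apply Rdiv_lt_0_compat; lra|].
  apply Rmult_le_reg_r with (2 * (1 - a)); [lra|]. unfold Rdiv; rewrite Rmult_assoc, Rinv_l; lra. }
assert (Eq : a + (1 - a) * q = 1 / 2) by (unfold q; field; lra).
replace ((3 - 4 * a) / (4 * (1 - a) ^ 2)) with (1 - q * q) by (unfold q; field; lra).
assert (Hr : 0 < 1 - q * q < 1).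
{ split; [|nra]. assert (q < 1) by nra. nra. }
eapply (cardioid_radius (phi_L a) _ (1 - q * q) Hr).
- unfold phi_L. rewrite Cplus_0_r, Csqrt_0_1, RtoC_minus. ring.
- intros r; apply C11_phi_L.
- unfold phi_L. rewrite <- RtoC_plus. replace (1 + - (1 - q * q)) with (q * q) by ring.
  rewrite Csqrt_RtoC_sq by lra. rewrite <- RtoC_mult, <- RtoC_plus, Eq. reflexivity.
- intros z Hz. assert (Z := Cmod_fst z). apply Rabs_le_between in Z.
  assert (S := Csqrt_re_gt (1 + z) q ltac:(lra) ltac:(simpl; lra)).
  assert (N := Csqrt_1_plus_near_1 z). apply in_cardioid_disk_near_1.
  + unfold phi_L. replace (fst (RtoC a + RtoC (1 - a) * Csqrt (1 + z))%C) with (a + (1 - a) * fst (Csqrt (1 + z)%C)).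
    * nra.
    * unfold RtoC. set (s := Csqrt _). simpl. ring.
  + unfold phi_L. replace (RtoC a + RtoC (1 - a) * Csqrt (1 + z) - 1)%C
      with (RtoC (1 - a) * (Csqrt (1 + z) - 1))%C by (rewrite RtoC_minus; ring).
    rewrite Cmod_mult, Cmod_R, Rabs_pos_eq by lra. assert (U := Cmod_ge_0 (Csqrt (1 + z) - 1)).
    assert ((1 - a) * Cmod (Csqrt (1 + z) - 1) <= 1) by nra. nra.
Qed.

Lemma radius_sqrt (c : R) : 3 / 4 < c <= 1 -> is_radius (Sstar (phi_sqrt c)) phi_car (3 / (4 * c)).
Proof.
intros Hc.
assert (Hr : 0 < 3 / (4 * c) < 1).
{ split; [apply Rdiv_lt_0_compat; lra|]. apply Rmult_lt_reg_r with (4 * c); [lra|].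
  unfold Rdiv; rewrite Rmult_assoc, Rinv_l; lra. }
assert (Hrc : c * (3 / (4 * c)) = 3 / 4) by (field; lra).
apply (cardioid_radius (phi_sqrt c) (fun z => / (2 * Csqrt (1 + RtoC c * z)) * (0 + (0 * z + RtoC c * 1)))%C _ Hr).
- unfold phi_sqrt. rewrite Cmult_0_r, Cplus_0_r. apply Csqrt_0_1.
- intros r Hr1. apply (C11_Csqrt_1_plus _ (fun z => RtoC c * z)%C (fun z => 0 * z + RtoC c * 1)%C r Hr1).
  + apply (C11_mult _ (fun _ => RtoC c) (fun z => z) (fun _ => 0%C) (fun _ => 1%C)); [apply C11_const|apply C11_id_disk].
  + intros z Hz. unfold closed_disk in Hz. rewrite Cmod_mult, Cmod_R, Rabs_pos_eq by lra.
    assert (U := Cmod_ge_0 z); nra.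
- unfold phi_sqrt. rewrite <- RtoC_mult, <- RtoC_plus.
  replace (1 + c * - (3 / (4 * c))) with (1 / 2 * (1 / 2)) by (field; lra). apply Csqrt_RtoC_sq; lra.
- intros z Hz. assert (U := Cmod_ge_0 z).
  assert (Hcz : Cmod (RtoC c * z) < 3 / 4) by (rewrite Cmod_mult, Cmod_R, Rabs_pos_eq by lra; nra).
  assert (Z := Cmod_fst (RtoC c * z)). apply Rabs_le_between in Z.
  apply in_cardioid_disk_near_1.
  + apply Csqrt_re_gt; [lra|]. change (fst (1 + RtoC c * z)%C) with (1 + fst (RtoC c * z)%C). lra.
  + assert (N := Csqrt_1_plus_near_1 (RtoC c * z)). fold (phi_sqrt c z) in N.
    assert (V := Cmod_ge_0 (phi_sqrt c z - 1)). nra.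
Qed.

(** * Polynomial families *)

Lemma radius_C : is_radius (Sstar phi_C) phi_car (1 / 2).
Proof.
apply (cardioid_radius phi_C (fun z => 0 + (0 * z + RtoC (4 / 3) * 1) + (0 * (z * z) + RtoC (2 / 3) * (1 * z + z * 1)))%C).
- lra.
- unfold phi_C; ring.
- intros r _. apply (C11_plus _ (fun z => 1 + RtoC (4 / 3) * z)%C (fun z => RtoC (2 / 3) * (z * z))%C
    (fun z => 0 + (0 * z + RtoC (4 / 3) * 1))%C).
  + apply (C11_plus _ (fun _ => 1%C) (fun z => RtoC (4 / 3) * z)%C (fun _ => 0%C)); [apply C11_const|].
    apply (C11_mult _ (fun _ => RtoC (4 / 3)) (fun z => z) (fun _ => 0%C) (fun _ => 1%C)); [apply C11_const|apply C11_id_disk].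
  + apply (C11_mult _ (fun _ => RtoC (2 / 3)) (fun z => z * z)%C (fun _ => 0%C)); [apply C11_const|].
    apply (C11_mult _ (fun z => z) (fun z => z) (fun _ => 1%C) (fun _ => 1%C)); apply C11_id_disk.
- unfold phi_C. rewrite <- !RtoC_mult, <- !RtoC_plus. f_equal; field.
- intros z Hz. assert (Z := Cmod_lt_coords z _ Hz). apply in_cardioid_disk_near_1.
  (* Inserting y^2 < 1/4 - x^2 gives Re phi > 1/2 + 4/3 (x + 1/2)^2. *)
  + unfold phi_C; destruct z as [x y]; simpl in *. nra.
  + replace (phi_C z - 1)%C with (z * (RtoC (4 / 3) + RtoC (2 / 3) * z))%C by (unfold phi_C; ring).
    assert (T := Cmod_triangle (RtoC (4 / 3)) (RtoC (2 / 3) * z)).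
    rewrite Cmod_mult, !Cmod_R, !Rabs_pos_eq in T by lra. rewrite Cmod_mult.
    assert (U := Cmod_ge_0 z). assert (V := Cmod_ge_0 (RtoC (4 / 3) + RtoC (2 / 3) * z)).
    assert (W : Cmod z * Cmod (RtoC (4 / 3) + RtoC (2 / 3) * z) <= 1 / 2 * (5 / 3)) by (apply Rmult_le_compat; lra).
    assert (0 <= Cmod z * Cmod (RtoC (4 / 3) + RtoC (2 / 3) * z)) by (apply Rmult_le_pos; lra). nra.
Qed.

Lemma sqrt2_facts : sqrt 2 * sqrt 2 = 2 /\ 1.414 < sqrt 2 < 1.415.
Proof.
assert (E : sqrt 2 * sqrt 2 = 2) by (apply sqrt_sqrt; lra). assert (P := sqrt_pos 2). split; [exact E|nra].
Qed.

Lemma radius_lim : is_radius (Sstar phi_lim) phi_car (sqrt 2 - 1).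
Proof.
destruct sqrt2_facts as [E B].
apply (cardioid_radius phi_lim (fun z => 0 + (0 * z + RtoC (sqrt 2) * 1) + ((1 * z + z * 1) * / 2 + (z * z) * 0))%C).
- lra.
- unfold phi_lim; field.
- intros r _. apply (C11_plus _ (fun z => 1 + RtoC (sqrt 2) * z)%C (fun z => z * z / 2)%C
    (fun z => 0 + (0 * z + RtoC (sqrt 2) * 1))%C).
  + apply (C11_plus _ (fun _ => 1%C) (fun z => RtoC (sqrt 2) * z)%C (fun _ => 0%C)); [apply C11_const|].
    apply (C11_mult _ (fun _ => RtoC (sqrt 2)) (fun z => z) (fun _ => 0%C) (fun _ => 1%C)); [apply C11_const|apply C11_id_disk].
  + apply (C11_mult _ (fun z => z * z)%C (fun _ => / 2)%C (fun z => 1 * z + z * 1)%C (fun _ => 0%C)); [|apply C11_const].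
    apply (C11_mult _ (fun z => z) (fun z => z) (fun _ => 1%C) (fun _ => 1%C)); apply C11_id_disk.
- unfold phi_lim. rewrite <- !RtoC_mult, <- RtoC_div by lra. rewrite <- !RtoC_plus. f_equal. nra.
- intros z Hz. assert (Z := Cmod_lt_coords z _ Hz). apply in_cardioid_disk_near_1.
  + unfold phi_lim. assert (X := Rle_lt_trans _ _ _ (Cmod_fst z) Hz). apply Rabs_lt_between in X.
    destruct z as [x y]; simpl in *.
    (* After inserting y^2 < (sqrt 2 - 1)^2 - x^2, this product is the lower bound for Re phi -
       1/2. *)
    assert (0 < (x + (sqrt 2 - 1)) * (x + 1)) by (apply Rmult_lt_0_compat; lra). nra.
  + replace (phi_lim z - 1)%C with (z * (RtoC (sqrt 2) + RtoC (1 / 2) * z))%C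
      by (unfold phi_lim; rewrite RtoC_div by lra; field).
    assert (T := Cmod_triangle (RtoC (sqrt 2)) (RtoC (1 / 2) * z)).
    rewrite Cmod_mult, !Cmod_R, !Rabs_pos_eq in T by lra. rewrite Cmod_mult.
    assert (U := Cmod_ge_0 z). assert (V := Cmod_ge_0 (RtoC (sqrt 2) + RtoC (1 / 2) * z)).
    assert (W : Cmod z * Cmod (RtoC (sqrt 2) + RtoC (1 / 2) * z) <= 1 / 2 * 2) by (apply Rmult_le_compat; lra).
    assert (0 <= Cmod z * Cmod (RtoC (sqrt 2) + RtoC (1 / 2) * z)) by (apply Rmult_le_pos; lra). nra.
Qed.

Lemma radius_ne (r9 : R) : 0 < r9 < 1 -> 2 * r9 ^ 3 - 6 * r9 + 3 = 0 -> is_radius (Sstar phi_ne) phi_car r9.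
Proof.
intros Hr E.
(* The cubic decreases on (0, 1) and is negative at 0.577. This number lies just below 1 / sqrt 3,
   so that 1 - 3 r9^2 > 0, as the estimate of the real part requires. *)
assert (Hr' : r9 < 0.577).
{ destruct (Rlt_or_le r9 0.577) as [L|L]; [exact L|exfalso].
  assert (0 <= (r9 - 0.577) * (6 - 2 * (r9 ^ 2 + 0.577 * r9 + 0.577 ^ 2))) by (apply Rmult_le_pos; nra). nra. }
apply (cardioid_radius phi_ne (fun z => 0 + 1 + - ((1 * (z * z) + z * (1 * z + z * 1)) * / 3 + (z * (z * z)) * 0))%C _ Hr).
- unfold phi_ne; field.
- intros r _. apply (C11_plus _ (fun z => 1 + z)%C (fun z => - (z * (z * z) / 3))%C (fun z => 0 + 1)%C).
  + apply (C11_plus _ (fun _ => 1%C) (fun z => z) (fun _ => 0%C) (fun _ => 1%C)); [apply C11_const|apply C11_id_disk].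
  + apply (C11_opp _ (fun z => z * (z * z) / 3)%C).
    apply (C11_mult _ (fun z => z * (z * z))%C (fun _ => / 3)%C (fun z => 1 * (z * z) + z * (1 * z + z * 1))%C (fun _ => 0%C));
      [|apply C11_const].
    apply (C11_mult _ (fun z => z) (fun z => z * z)%C (fun _ => 1%C) (fun z => 1 * z + z * 1)%C); [apply C11_id_disk|].
    apply (C11_mult _ (fun z => z) (fun z => z) (fun _ => 1%C) (fun _ => 1%C)); apply C11_id_disk.
- unfold phi_ne. rewrite <- !RtoC_mult, <- RtoC_div by lra. rewrite <- !RtoC_plus, <- RtoC_minus. f_equal. nra.
- intros z Hz. assert (Z := Cmod_lt_coords z _ Hz). assert (U := Cmod_ge_0 z). apply in_cardioid_disk_near_1.
  + assert (X := Rle_lt_trans _ _ _ (Cmod_fst z) Hz). apply Rabs_lt_between in X.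
    destruct z as [x y]; simpl fst in *; simpl snd in *.
    replace (fst (phi_ne (x, y))) with (1 + x - (x ^ 3 - 3 * x * y ^ 2) / 3) by (unfold phi_ne; simpl; field).
    destruct (Rle_or_lt 0 x) as [L|L].
    * assert (x ^ 3 <= x) by nra. nra.
    (* For x < 0 the worst case is y^2 = r9^2 - x^2. The resulting cubic in x has the value 1/2 at x
       = - r9, so r9 + x splits off; the cofactor exceeds 1 - 3 r9^2. *)
    * assert (A : (- x) * y ^ 2 <= (- x) * (r9 ^ 2 - x ^ 2)) by (apply Rmult_le_compat_l; nra).
      assert (B : - x * (1 + r9 ^ 2) + 4 / 3 * x ^ 3 < r9 - r9 ^ 3 / 3).
      { assert (0 < (r9 + x) * (1 + r9 ^ 2 - 4 / 3 * (r9 ^ 2 - r9 * x + x ^ 2))); [|nra].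
        apply Rmult_lt_0_compat; nra. }
      nra.
  + replace (phi_ne z - 1)%C with (z * (1 - RtoC (1 / 3) * (z * z)))%C
      by (unfold phi_ne; rewrite RtoC_div by lra; field).
    assert (T := Cmod_triangle 1 (- (RtoC (1 / 3) * (z * z)))).
    rewrite Cmod_opp, !Cmod_mult, !Cmod_R, !Rabs_pos_eq in T by lra. rewrite Cmod_mult.
    fold (1 - RtoC (1 / 3) * (z * z))%C in T.
    assert (V := Cmod_ge_0 (1 - RtoC (1 / 3) * (z * z))).
    assert (W : Cmod z * Cmod (1 - RtoC (1 / 3) * (z * z)) <= 0.577 * (4 / 3)) by (apply Rmult_le_compat; nra).
    assert (0 <= Cmod z * Cmod (1 - RtoC (1 / 3) * (z * z))) by (apply Rmult_le_pos; lra). nra.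
Qed.

(** * The crescent-shaped region *)

Lemma radius_crescent : is_radius (Sstar phi_crescent) phi_car (3 / 4).
Proof.
apply (cardioid_radius phi_crescent (fun z => 1 + / (2 * Csqrt (1 + z * z)) * (0 + (1 * z + z * 1)))%C); [lra| | | |].
- unfold phi_crescent. rewrite Cmult_0_l, Cplus_0_r, Csqrt_0_1. ring.
- intros r Hr. apply (C11_plus _ (fun z => z) (fun z => Csqrt (1 + z * z)) (fun _ => 1%C)); [apply C11_id_disk|].
  apply (C11_Csqrt_1_plus _ (fun z => z * z)%C (fun z => 1 * z + z * 1)%C r Hr).
  + apply (C11_mult _ (fun z => z) (fun z => z) (fun _ => 1%C) (fun _ => 1%C)); apply C11_id_disk.
  + intros z Hz. unfold closed_disk in Hz. rewrite Cmod_mult. assert (U := Cmod_ge_0 z); nra.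
- unfold phi_crescent. rewrite <- RtoC_mult, <- RtoC_plus.
  replace (1 + - (3 / 4) * - (3 / 4)) with (5 / 4 * (5 / 4)) by field.
  rewrite Csqrt_RtoC_sq, <- RtoC_plus by lra. f_equal; field.
- intros z Hz. unfold phi_crescent. set (s := Csqrt (1 + z * z)).
  assert (Hs : 0 <= fst s) by apply Csqrt_re_ge_0.
  assert (Es : (s * s)%C = (1 + z * z)%C) by apply Csqrt_sqr.
  (* With [q = z + s] one has [1 / q = s - z], so that [q - 1/q = 2 z] and [q + 1/q = 2 s]. *)
  set (q := (z + s)%C).
  assert (Eq : (q * (s - z))%C = 1%C).
  { unfold q. replace ((z + s) * (s - z))%C with (s * s - z * z)%C by ring. rewrite Es; ring. }
  assert (Eq2 : (q * q - 1)%C = (RtoC 2 * z * q)%C) by (rewrite <- Eq; unfold q; ring).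
  assert (M : Cmod (q * q - 1) ^ 2 = 4 * Cmod z ^ 2 * Cmod q ^ 2).
  { rewrite Eq2, !Cmod_mult, Cmod_R, Rabs_pos_eq by lra. ring. }
  assert (Nq : 0 < Cmod q).
  { apply Cmod_gt_0. intros E. rewrite E, Cmult_0_l in Eq. apply RtoC_inj in Eq. lra. }
  assert (U := Cmod_ge_0 z).
  assert (M' : Cmod (q * q - 1) ^ 2 < 9 / 4 * Cmod q ^ 2).
  { rewrite M. apply Rmult_lt_compat_r; [apply pow_lt, Nq|nra]. }
  assert (K0 : 0 < Cmod q ^ 2) by (apply pow_lt, Nq).
  rewrite !Cmod_sq in M'. rewrite Cmod_sq in K0.
  assert (Hc : fst s = fst q + fst (s - z)%C - fst s) by (unfold q; simpl; ring).
  apply in_cardioid_disk_near_1; [|rewrite Cmod_sq].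
  all: clearbody q; clear M Eq2 Es; set (n := (s - z)%C) in *; clearbody n s.
  all: assert (E1 := f_equal fst Eq); assert (E2 := f_equal snd Eq).
  all: destruct q as [t b], n as [c d]; simpl in M', K0, Hc, E1, E2 |- *.
  all: assert (Kc : (t ^ 2 + b ^ 2) * c = t)
    by (replace ((t ^ 2 + b ^ 2) * c) with (t * (t * c - b * d) + b * (t * d + b * c)) by ring; rewrite E1, E2; ring).
  all: set (K := t ^ 2 + b ^ 2) in *.
  all: assert (Kt : t ^ 2 <= K) by (unfold K; nra).
  (* With K = |q|^2 and t = Re q, |q^2 - 1|^2 = (K + 1)^2 - 4 t^2, and the bound 9/4 K comes from
     |z| < 3/4. Together with t^2 <= K this yields (K - 4)(K - 1/4) < 0. *)
  all: assert (MK : K ^ 2 - K / 4 + 1 < 4 * t ^ 2) by (unfold K; nra).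
  all: assert (K1 : 1 / 4 < K < 4) by (assert ((K - 4) * (K - 1 / 4) < 0) by lra; split; nra).
  (* 2 Re s = Re q + Re (1/q) = t (1 + 1/K), so Re s >= 0 fixes the sign of t. *)
  all: assert (tpos : 0 <= t) 
    by (assert (Ec : c = 2 * fst s - t) by lra; rewrite Ec in Kc; assert (0 <= fst s * K) by nra; nra).
  (* K > 1/4 makes K^2 - K/4 + 1 greater than 1, hence 4 t^2 > 1. *)
  all: assert (t1 : 1 / 2 < t) by nra.
  + exact t1.
  + assert (D : 0 < 2 * t - K).
    (* 4 t^2 - K^2 > 1 - K/4, which is positive because K < 4. The claim |q - 1|^2 = K - 2 t + 1 <=
       5/4 then follows. *)
    { assert (0 < (2 * t - K) * (2 * t + K)) by nra. nra. }
    unfold K in D. nra.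
Qed.

(** * The family with a square root of a Moebius map *)

Lemma radius_RL : is_radius (Sstar phi_RL) phi_car ((39 + 17 * sqrt 2) / 82).
Proof.
destruct sqrt2_facts as [E B]. set (T := sqrt 2) in *.
set (k := 2 * (T - 1)). assert (Hk : 0.82 < k < 0.84) by (unfold k; lra).
set (r0 := (39 + 17 * T) / 82).
assert (Hr : 0.768 < r0 < 0.77) by (unfold r0; lra).
(* sg solves T - (T - 1) sg = 1/2, so it is the value of the root at the cusp, and r0 is determined
   by (1 + r0) / (1 - k r0) = sg^2. *)
set (sg := 3 / 2 + T / 2).
assert (Hsg : 1 + r0 = sg * sg * (1 - k * r0)).
{ unfold r0, sg, k.
  assert (T3 : T * T * T = 2 * T) by (rewrite E; ring).
  assert (T4 : T * T * T * T = 4) by (rewrite T3; lra). nra. }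
assert (Den : forall z, Cmod z < 1 -> 1 - k * Cmod z <= Cmod (1 + RtoC k * z) /\ Cmod (1 + RtoC k * z) <= 2).
{ intros z Hz. assert (U := Cmod_ge_0 z). assert (T1 := Cmod_tri_sub 1 (- (RtoC k * z))).
  assert (T2 := Cmod_triangle 1 (RtoC k * z)).
  replace (1 - - (RtoC k * z))%C with (1 + RtoC k * z)%C in T1 by ring.
  rewrite Cmod_opp, Cmod_mult, Cmod_1, Cmod_R, Rabs_pos_eq in T1 by lra.
  rewrite Cmod_mult, Cmod_1, Cmod_R, Rabs_pos_eq in T2 by lra. split; nra. }
assert (Num : forall z, Cmod (1 - z) <= 1 + Cmod z).
{ intros z. assert (T1 := Cmod_triangle 1 (- z)). rewrite Cmod_opp, Cmod_1 in T1. exact T1. }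
set (h := fun z : C => ((1 - z) / (1 + RtoC k * z))%C).
assert (Hden0 : forall z, Cmod z < 1 -> 0 < Cmod (1 + RtoC k * z)).
{ intros z Hz. destruct (Den z Hz). assert (U := Cmod_ge_0 z). nra. }
assert (Hmod : forall z, Cmod z < 1 -> Cmod (h z) * (1 - k * Cmod z) <= 1 + Cmod z).
{ intros z Hz. assert (P := Hden0 z Hz). destruct (Den z Hz) as [D1 _]. unfold h.
  rewrite Cmod_div by (apply Cmod_gt_0; exact P).
  apply Rle_trans with (Cmod (1 - z) / Cmod (1 + RtoC k * z) * Cmod (1 + RtoC k * z)).
  - apply Rmult_le_compat_l; [|exact D1].
    apply Rmult_le_pos; [apply Cmod_ge_0|apply Rlt_le, Rinv_0_lt_compat, P].
  - unfold Rdiv; rewrite Rmult_assoc, Rinv_l, Rmult_1_r by lra. apply Num. }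
assert (Hre : forall z, Cmod z < 1 -> (1 - Cmod z) / 4 <= fst (h z)).
{ intros z Hz. assert (P := Hden0 z Hz). destruct (Den z Hz) as [_ D2].
  assert (Pz := Rle_trans _ _ _ (Rle_abs _) (Cmod_fst z)). assert (U := Cmod_ge_0 z).
  assert (Z2 := Cmod_sq z).
  set (N := Cmod (1 + RtoC k * z) ^ 2).
  assert (HN : 0 < N <= 4) by (unfold N; split; nra).
  assert (Eh : fst (h z) * N = 1 - k * Cmod z ^ 2 - (1 - k) * fst z).
  { unfold N, h in *. rewrite !Cmod_sq in *. destruct z as [x y].
    assert (P2 : 0 < Cmod (1 + RtoC k * (x, y)) ^ 2) by (apply pow_lt, P).
    rewrite Cmod_sq in P2. simpl in *. field. nra. }
  assert (L : 1 - Cmod z <= fst (h z) * N).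
  { rewrite Eh. assert ((1 - k) * fst z <= (1 - k) * Cmod z) by (apply Rmult_le_compat_l; lra).
    assert (0 <= k * (Cmod z * (1 - Cmod z))) by (repeat apply Rmult_le_pos; lra). lra. }
  assert (0 <= fst (h z)) by nra. nra. }
assert (Hphi : phi_RL = fun z => (RtoC T - RtoC (T - 1) * Csqrt (h z))%C) by reflexivity.
rewrite Hphi; clear Hphi.
eapply (cardioid_radius (fun z => RtoC T - RtoC (T - 1) * Csqrt (h z))%C _ r0); [lra| | | |].
- unfold h. replace ((1 - 0) / (1 + RtoC k * 0))%C with (RtoC 1) by field.
  rewrite Csqrt_0_1, RtoC_minus. ring.
- intros r Hr1.
  eapply (C11_plus _ (fun _ => RtoC T) (fun z => - (RtoC (T - 1) * Csqrt (h z)))%C (fun _ => 0%C)); [apply C11_const|].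
  eapply (C11_opp _ (fun z => RtoC (T - 1) * Csqrt (h z))%C).
  eapply (C11_mult _ (fun _ => RtoC (T - 1)) (fun z => Csqrt (h z)) (fun _ => 0%C)); [apply C11_const|].
  (* The argument of the root stays in Re >= (1 - r) / 4 by [Hre], and since k < 0.84 its modulus is
     at most 2 / 0.16 < 20. *)
  eapply (C11_comp _ (fun z => (1 - r) / 4 <= fst z /\ Cmod z <= 20) h Csqrt _ (fun z => / (2 * Csqrt z))%C).
  + intros z Hz. unfold closed_disk in Hz. split.
    * apply Rle_trans with (2 := Hre z ltac:(lra)). lra.
    * assert (A := Hmod z ltac:(lra)). assert (U := Cmod_ge_0 z). assert (V := Cmod_ge_0 (h z)).
      assert (0.16 <= 1 - k * Cmod z) by nra. nra.
  + apply C11_Csqrt; lra.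
  + eapply (C11_mult _ (fun z => 1 - z)%C (fun z => / (1 + RtoC k * z))%C (fun _ => 0 + - (1))%C).
    * eapply (C11_plus _ (fun _ => 1%C) (fun z => - z)%C (fun _ => 0%C) (fun _ => - (1))%C); [apply C11_const|].
      eapply (C11_opp _ (fun z => z) (fun _ => 1%C)), C11_id_disk.
    * eapply (C11_comp _ (fun z => 0.16 <= Cmod z) (fun z => 1 + RtoC k * z)%C Cinv _ (fun z => - / (z * z))%C).
      -- intros z Hz. unfold closed_disk in Hz. destruct (Den z) as [D1 _]; [lra|].
         assert (U := Cmod_ge_0 z). nra.
      -- apply C11_inv; lra.
      -- eapply (C11_plus _ (fun _ => 1%C) (fun z => RtoC k * z)%C (fun _ => 0%C)); [apply C11_const|].
         eapply (C11_mult _ (fun _ => RtoC k) (fun z => z) (fun _ => 0%C) (fun _ => 1%C)); [apply C11_const|apply C11_id_disk].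
- unfold h. rewrite <- RtoC_mult, <- RtoC_minus, <- RtoC_plus.
  assert (0 < 1 - k * r0) by nra.
  rewrite <- RtoC_div by lra.
  replace ((1 - - r0) / (1 + k * - r0)) with (sg * sg).
  + rewrite Csqrt_RtoC_sq by (unfold sg; lra). rewrite <- RtoC_mult, <- RtoC_minus. f_equal. unfold sg. nra.
  + replace (1 - - r0) with (1 + r0) by ring. rewrite Hsg. field. lra.
- intros z Hz. assert (U := Cmod_ge_0 z). assert (V := Cmod_ge_0 (h z)).
  assert (A := Hmod z ltac:(lra)).
  (* The bound (1 + |z|) / (1 - k |z|) for |h z| increases with |z| and equals sg^2 at |z| = r0.
     Hence Re sqrt (h z) < sg, which is Re phi > 1/2. *)
  assert (Hh : Cmod (h z) < sg * sg).
  { apply Rmult_lt_reg_r with (1 - k * Cmod z); [nra|]. apply Rle_lt_trans with (1 := A).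
    assert (sg * sg * (1 - k * r0) <= sg * sg * (1 - k * Cmod z)) by (apply Rmult_le_compat_l; nra). lra. }
  assert (Sq := Cmod_Csqrt_sq (h z)). assert (S0 := Csqrt_re_ge_0 (h z)).
  assert (S1 := Rle_trans _ _ _ (Rle_abs _) (Cmod_fst (Csqrt (h z)))).
  assert (SM := Cmod_sq (Csqrt (h z))).
  set (s := Csqrt (h z)) in *. assert (W := Cmod_ge_0 s).
  assert (Hs : fst s < sg) by (assert (0 < sg) by (unfold sg; lra); nra).
  assert (Hsg5 : sg * sg <= 5) by (unfold sg; nra).
  apply in_cardioid_disk_near_1; [|rewrite Cmod_sq]; clearbody s; destruct s as [a b]; simpl in *.
  + unfold sg in Hs. nra.
  + assert (A1 : 0 <= 1 - 2 * a + (a ^ 2 + b ^ 2) <= 6).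
    { assert (P1 := pow2_ge_0 (1 - a)). assert (P2 := pow2_ge_0 b). split; lra. }
    assert (A2 : 0 <= (T - 1) ^ 2 <= 0.18) by nra.
    assert (A3 : (T - 1) ^ 2 * (1 - 2 * a + (a ^ 2 + b ^ 2)) <= 0.18 * 6) by (apply Rmult_le_compat; lra). lra.
Qed.

(** * The sine family *)

Lemma C11_Csin (r : R) : C11_on (closed_disk r) Csin
  (fun z => (Cexp (Ci * z) * (0 * z + Ci * 1) + - (Cexp (- (Ci * z)) * - (0 * z + Ci * 1))) * / (RtoC 2 * Ci)
    + (Cexp (Ci * z) - Cexp (- (Ci * z))) * 0)%C.
Proof.
assert (L : C11_on (closed_disk r) (fun z => Ci * z)%C (fun z => 0 * z + Ci * 1)%C).
{ apply (C11_mult _ (fun _ => Ci) (fun z => z) (fun _ => 0%C) (fun _ => 1%C)); [apply C11_const|apply C11_id_disk]. }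
assert (M : forall z, closed_disk r z -> Cmod (Ci * z) <= r) by (intros z Hz; rewrite Cmod_mult, Cmod_Ci, Rmult_1_l; exact Hz).
apply (C11_mult _ (fun z => Cexp (Ci * z) - Cexp (- (Ci * z)))%C (fun _ => / (RtoC 2 * Ci))%C
  (fun z => Cexp (Ci * z) * (0 * z + Ci * 1) + - (Cexp (- (Ci * z)) * - (0 * z + Ci * 1)))%C (fun _ => 0%C));
  [|apply C11_const].
apply (C11_plus _ (fun z => Cexp (Ci * z)) (fun z => - Cexp (- (Ci * z)))%C (fun z => Cexp (Ci * z) * (0 * z + Ci * 1))%C).
- apply (C11_comp _ (fun z => Cmod z <= r) (fun z => Ci * z)%C Cexp (fun z => 0 * z + Ci * 1)%C Cexp); [exact M|apply C11_Cexp|exact L].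
- apply (C11_opp _ (fun z => Cexp (- (Ci * z)))).
  apply (C11_comp _ (fun z => Cmod z <= r) (fun z => - (Ci * z))%C Cexp (fun z => - (0 * z + Ci * 1))%C Cexp).
  + intros z Hz; rewrite Cmod_opp; apply M, Hz.
  + apply C11_Cexp.
  + apply C11_opp, L.
Qed.

Lemma Csin_coords (x y : R) :
  Csin (x, y) = (sin x * ((exp y + exp (- y)) / 2), cos x * ((exp y - exp (- y)) / 2)).
Proof.
unfold Csin, Cexp, Cdiv, Cinv, Cmult, Cminus, Cplus, Copp, Ci, RtoC; simpl.
replace (0 * x - 1 * y) with (- y) by ring. replace (0 * y + 1 * x) with x by ring.
rewrite cos_neg, sin_neg, Ropp_involutive.
apply injective_projections; simpl; field.
Qed.

Lemma Rabs_le_of_sq (x k : R) : 0 <= k -> x ^ 2 <= k ^ 2 -> Rabs x <= k.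
Proof. intros Hk H. rewrite <- pow2_abs in H. assert (U := Rabs_pos x). nra. Qed.

Lemma sin_cubic_le (t : R) : 0 <= t -> t - t ^ 3 / 6 <= sin t.
Proof.
intros Ht. destruct (MVT_gen (fun u => sin u - u + u ^ 3 / 6) 0 t (fun u => cos u - 1 + u ^ 2 / 2)) as [c [Hc E]].
- intros u _; auto_derive; [trivial|field].
- intros u _. apply derivable_continuous_pt. exists (cos u - 1 + u ^ 2 / 2). apply is_derive_Reals.
  auto_derive; [trivial|field].
- rewrite sin_0 in E. assert (Q := cos_quadratic c). nra.
Qed.

(** The bound exp t <= 1 + t + 3/2 t^2 holds for |t| <= 1/3. It is applied at y/2 and - y/2, and the
    sum is squared, which doubles the admissible range. *)
Lemma cosh_quadratic (y : R) : Rabs y <= 2 / 3 -> (exp y + exp (- y)) / 2 <= 1 + 3 / 2 * y ^ 2 + 9 / 32 * y ^ 4.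
Proof.
intros H; apply Rabs_le_between in H. set (h := y / 2).
assert (E1 : exp h * exp (- h) = 1) by (rewrite <- exp_plus, Rplus_opp_r; apply exp_0).
assert (B : forall t, -1 / 3 <= t <= 1 / 3 -> exp t <= 1 + t + 3 / 2 * t ^ 2).
{ intros t Ht. assert (L := exp_ineq1_le (- t)). assert (P := exp_pos t).
  assert (Et : exp t * exp (- t) = 1) by (rewrite <- exp_plus, Rplus_opp_r; apply exp_0).
  assert (exp t * (1 - t) <= 1) by nra.
  assert (1 <= (1 + t + 3 / 2 * t ^ 2) * (1 - t)) by nra. nra. }
assert (B1 := B h ltac:(unfold h; lra)). assert (B2 := B (- h) ltac:(unfold h; lra)).
assert (P1 := exp_pos h); assert (P2 := exp_pos (- h)).
replace y with (h + h) at 1 by (unfold h; field). replace (- y) with (- h + - h) by (unfold h; field).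
rewrite !exp_plus.
assert (S : exp h + exp (- h) <= 2 + 3 * h ^ 2) by lra.
assert (S2 : (exp h + exp (- h)) ^ 2 <= (2 + 3 * h ^ 2) ^ 2) by (apply pow_incr; lra).
unfold h in *. nra.
Qed.

(** The loss of sin x against sin r must outweigh the growth of cosh y. The mean value theorem gives
    sin x <= 1/2 - 0.859 (r - x), and y^2 < (r - x)(r + x) <= 1.06 (r - x) turns this into a loss of
    0.81 y^2. Since cosh y <= 1 + 1.58 y^2 and 1.58 / 2 = 0.79 < 0.81, the product stays below
    1/2. *)
Lemma sinh_disk_bound (r x y : R) : 0 < r <= 0.53 -> sin r = 1 / 2 -> x ^ 2 + y ^ 2 < r ^ 2 -> 0 <= x ->
  sin x * ((exp y + exp (- y)) / 2) < 1 / 2.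
Proof.
intros Hr Hs Hxy Hx.
assert (Hxr : x < r) by nra.
destruct (MVT_gen sin x r cos) as [c [Hc Ec]].
- intros t _; apply is_derive_Reals, derivable_pt_lim_sin.
- intros t _; apply continuity_sin.
- rewrite Rmin_left, Rmax_right in Hc by lra. rewrite Hs in Ec.
  assert (Q := cos_quadratic c). assert (c ^ 2 <= 0.53 ^ 2) by nra.
  assert (Hr2 : r ^ 2 <= 0.53 ^ 2) by (apply pow_incr; lra).
  assert (x2 := pow2_ge_0 x).
  assert (Hy : Rabs y <= 2 / 3) by (apply Rabs_le_of_sq; lra).
  assert (K := cosh_quadratic y Hy).
  assert (Hy2 : y ^ 2 <= 0.53 ^ 2) by nra.
  assert (K1 : (exp y + exp (- y)) / 2 <= 1 + 1.58 * y ^ 2) by nra.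
  assert (Hd : y ^ 2 < 1.06 * (r - x)) by nra.
  assert (S1 : sin x <= 1 / 2 - 0.859 * (r - x)) by nra.
  assert (S2 : sin x < 1 / 2 - 0.81 * y ^ 2) by nra.
  assert (P : 0 < (exp y + exp (- y)) / 2) by (assert (P1 := exp_pos y); assert (P2 := exp_pos (- y)); lra).
  assert (Pos : 0 < 1 / 2 - 0.81 * y ^ 2) by nra.
  apply Rlt_le_trans with ((1 / 2 - 0.81 * y ^ 2) * ((exp y + exp (- y)) / 2)).
  + apply Rmult_lt_compat_r; assumption.
  + apply Rle_trans with ((1 / 2 - 0.81 * y ^ 2) * (1 + 1.58 * y ^ 2)); [apply Rmult_le_compat_l; lra|].
    assert (0 <= y ^ 2) by apply pow2_ge_0. nra.
Qed.

Lemma radius_sin : is_radius (Sstar phi_sin) phi_car (asin (1 / 2)).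
Proof.
set (r := asin (1 / 2)).
assert (Hs : sin r = 1 / 2) by (apply sin_asin; lra).
assert (Hb := asin_bound (1 / 2)). fold r in Hb. assert (P1 := PI2_1). assert (P4 := PI_4).
assert (Hr0 : 0 < r).
{ destruct (Rlt_or_le 0 r) as [L|L]; [exact L|exfalso].
  assert (V := sin_incr_1 r 0 ltac:(lra) ltac:(lra) ltac:(lra) ltac:(lra) L). rewrite sin_0 in V. lra. }
(* 0.53 is slightly above PI/6; the cubic lower bound for the sine already exceeds 1/2 there. *)
assert (Hr1 : r <= 0.53).
{ destruct (Rle_or_lt r 0.53) as [L|L]; [exact L|exfalso].
  assert (V := sin_incr_1 0.53 r ltac:(lra) ltac:(lra) ltac:(lra) ltac:(lra) ltac:(lra)).
  assert (W := sin_cubic_le 0.53 ltac:(lra)). lra. }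
eapply (cardioid_radius phi_sin _ r); [lra| | | |].
- unfold phi_sin. change (RtoC 0) with ((0, 0) : C). rewrite Csin_coords, sin_0, Ropp_0, exp_0.
  apply injective_projections; simpl; field.
- intros s _. apply (C11_plus _ (fun _ => 1%C) Csin (fun _ => 0%C)); [apply C11_const|apply C11_Csin].
- unfold phi_sin. change (RtoC (- r)) with ((- r, 0) : C). rewrite Csin_coords, sin_neg, Hs, Ropp_0, exp_0.
  apply injective_projections; simpl; field.
- intros z Hz. assert (Z := Cmod_lt_coords z _ Hz). destruct z as [x y].
  assert (Ephi : phi_sin (x, y) = (1 + sin x * ((exp y + exp (- y)) / 2), cos x * ((exp y - exp (- y)) / 2))).
  { unfold phi_sin; rewrite Csin_coords. apply injective_projections; simpl; ring. }
  rewrite Ephi; clear Ephi. simpl fst in Z; simpl snd in Z.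
  set (ch := (exp y + exp (- y)) / 2) in *. set (sh := (exp y - exp (- y)) / 2).
  assert (E1 : exp y * exp (- y) = 1) by (rewrite <- exp_plus, Rplus_opp_r; apply exp_0).
  assert (P : 0 < ch) by (assert (Q1 := exp_pos y); assert (Q2 := exp_pos (- y)); unfold ch; lra).
  assert (Hcs : sh ^ 2 = ch ^ 2 - 1) by (unfold sh, ch; nra).
  assert (Hr2 : r ^ 2 <= 0.53 ^ 2) by (apply pow_incr; lra).
  assert (x2 := pow2_ge_0 x). assert (y2 := pow2_ge_0 y).
  assert (Hx : Rabs x <= 0.53) by (apply Rabs_le_of_sq; lra).
  assert (Hch : ch <= 1 + 1.58 * y ^ 2).
  { assert (K := cosh_quadratic y ltac:(apply Rabs_le_of_sq; lra)). fold ch in K.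
    assert (y ^ 2 <= 0.53 ^ 2) by lra. nra. }
  apply in_cardioid_disk_near_1; [|rewrite Cmod_sq]; simpl fst; simpl snd.
  + destruct (Rle_or_lt 0 x) as [L|L].
    * assert (0 <= sin x) by (apply sin_ge_0; apply Rabs_le_between in Hx; lra). nra.
    * assert (K := sinh_disk_bound r (- x) y ltac:(lra) Hs ltac:(nra) ltac:(lra)).
      rewrite sin_neg in K. fold ch in K. lra.
  + assert (S := sin2_cos2 x). unfold Rsqr in S.
    assert (Sx : sin x ^ 2 <= x ^ 2).
    { rewrite <- (pow2_abs (sin x)), <- (pow2_abs x). apply pow_incr. split; [apply Rabs_pos|apply sin_abs_le]. }
    assert (Cx : cos x ^ 2 = 1 - sin x ^ 2) by lra.
    assert (Hc2 : ch ^ 2 <= (1 + 1.58 * y ^ 2) ^ 2) by (apply pow_incr; lra).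
    (* The identity |sin z|^2 = sin^2 x + cosh^2 y - 1 reduces the modulus bound to separate
       estimates in x and y. *)
    assert (Eq : (1 + sin x * ch - 1) ^ 2 + (cos x * sh - 0) ^ 2 = sin x ^ 2 + ch ^ 2 - 1).
    { transitivity (sin x ^ 2 * ch ^ 2 + cos x ^ 2 * sh ^ 2); [ring|]. rewrite Hcs, Cx; ring. }
    unfold Rminus in Eq. rewrite Eq. nra.
Qed.

(** * The exponential family *)

Lemma exp_ge_quadratic (s : R) : 0 <= s -> 1 + s + s ^ 2 / 2 <= exp s.
Proof.
intros Hs. destruct (MVT_gen (fun t => exp t - t - t ^ 2 / 2) 0 s (fun t => exp t - 1 - t)) as [c [Hc E]].
- intros t _; auto_derive; [trivial|field].
- intros t _. apply derivable_continuous_pt. exists (exp t - 1 - t). apply is_derive_Reals.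
  auto_derive; [trivial|field].
- rewrite exp_0 in E. assert (Q := exp_ineq1_le c). nra.
Qed.

Lemma exp_1_lower : 8 / 3 <= exp 1.
Proof.
assert (A := exp_ge_quadratic (1 / 4) ltac:(lra)).
assert (E : exp 1 = exp (1 / 4) ^ 4).
{ simpl. rewrite Rmult_1_r, <- !exp_plus. f_equal; field. }
rewrite E. apply Rle_trans with ((1 + 1 / 4 + (1 / 4) ^ 2 / 2) ^ 4); [lra|]. apply pow_incr; lra.
Qed.

(** exp t - 4/3 t^2 is nondecreasing for t >= 0, since exp c >= e c >= 8/3 c by the tangent at 1.
    The constant 4/3 is the value of (D + 2) / 2 at D = 2/3, the bound on [D] in the proof of
    [radius_e]. *)
Lemma exp_diff_ge (x r : R) : 0 <= x <= r -> exp x + 4 / 3 * (r ^ 2 - x ^ 2) <= exp r.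
Proof.
intros H. destruct (MVT_gen (fun t => exp t - 4 / 3 * t ^ 2) x r (fun t => exp t - 8 / 3 * t)) as [c [Hc E]].
- intros t _; auto_derive; [trivial|field].
- intros t _. apply derivable_continuous_pt. exists (exp t - 8 / 3 * t). apply is_derive_Reals.
  auto_derive; [trivial|field].
- rewrite Rmin_left, Rmax_right in Hc by lra.
  assert (Q : 8 / 3 * c <= exp c).
  { replace c with (1 + (c - 1)) at 2 by ring. rewrite exp_plus.
    assert (A := exp_ineq1_le (c - 1)). assert (B := exp_1_lower). assert (P := exp_pos (c - 1)). nra. }
  nra.
Qed.

Lemma radius_e (a : R) : 0 <= a < (exp 1 - 2) / (2 * (exp 1 - 1)) ->
  is_radius (Sstar (phi_e a)) phi_car (ln (2 * (1 - a) / (1 - 2 * a))).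
Proof.
intros Ha. assert (He := exp_1_lower).
assert (Ha1 : 2 * a * (exp 1 - 1) < exp 1 - 2).
{ destruct Ha as [_ Ha]. apply (Rmult_lt_compat_r (2 * (exp 1 - 1))) in Ha; [|lra].
  unfold Rdiv in Ha; rewrite Rmult_assoc, Rinv_l in Ha; lra. }
assert (Ha2 : a < 1 / 2) by nra.
set (A := 2 * (1 - a) / (1 - 2 * a)). set (r := ln A).
assert (HA : A * (1 - 2 * a) = 2 * (1 - a)) by (unfold A; field; lra).
assert (HA1 : 1 < A) by nra. assert (HAe : A < exp 1) by nra.
assert (Er : exp r = A) by (apply exp_ln; lra).
assert (Hr : 0 < r < 1).
{ split; [rewrite <- ln_1; apply ln_increasing; lra|]. apply exp_lt_inv. rewrite Er; exact HAe. }
(* In terms of D, exp (- r) = 1 - D and phi = (2 D - 1 + exp z) / (2 D). Re phi > 1/2 becomes X > 1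
   - D, and membership in the disk becomes the inequality [X2] below. *)
set (D := 1 / (2 * (1 - a))). assert (ED : D * (2 * (1 - a)) = 1) by (unfold D; field; lra).
assert (Hq : exp (- r) = 1 - D).
{ rewrite exp_Ropp, Er. unfold A, D. field. lra. }
assert (E3 := exp_le_3).
(* A < e <= 3 and A = 1 / (1 - D) give D < 2/3. At D = 2/3 the value of phi at r would be 5/2, where
   the disk touches the cardioid. *)
assert (HD : 1 / 2 <= D < 2 / 3).
{ split; [nra|]. assert (P : exp r * exp (- r) = 1) by (rewrite <- exp_plus, Rplus_opp_r; apply exp_0).
  rewrite Hq, Er in P. nra. }
assert (Ea : a = (2 * D - 1) / (2 * D)) by (unfold D; field; lra).
eapply (cardioid_radius (phi_e a) _ r Hr).
- unfold phi_e. rewrite Cexp_0, RtoC_minus. ring.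
- intros s _. apply (C11_plus _ (fun _ => RtoC a) (fun z => RtoC (1 - a) * Cexp z)%C (fun _ => 0%C)); [apply C11_const|].
  apply (C11_mult _ (fun _ => RtoC (1 - a)) Cexp (fun _ => 0%C)); [apply C11_const|apply C11_Cexp].
- unfold phi_e, Cexp; simpl. rewrite cos_0, sin_0, Hq. replace (1 - a) with (1 / (2 * D)) by (rewrite Ea; field; lra). rewrite Ea.
  apply injective_projections; simpl; field; lra.
- intros z Hz. assert (Z := Cmod_lt_coords z _ Hz). destruct z as [x y]; simpl fst in Z; simpl snd in Z.
  set (E := exp x). assert (PE : 0 < E) by apply exp_pos.
  set (X := E * cos y). set (Y := E * sin y).
  assert (S := sin2_cos2 y). unfold Rsqr in S.
  assert (XY : X ^ 2 + Y ^ 2 = E ^ 2) by (unfold X, Y; nra).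
  assert (C := cos_quadratic y). assert (y2 := pow2_ge_0 y).
  set (d := r ^ 2 - x ^ 2). assert (Hd : 0 < d) by (unfold d; nra).
  assert (Hd1 : d < 1) by (unfold d; assert (x2 := pow2_ge_0 x); nra).
  assert (HX : E * (1 - d / 2) < X) by (unfold X; apply Rmult_lt_compat_l; [exact PE|unfold d; lra]).
  assert (Hxr : - r < x < r) by (split; nra).
  assert (X1 : 1 - D < X).
  { apply Rle_lt_trans with (2 := HX).
    (* Measured from the extreme point - r, E is exp s (1 - D). As r < 1, 1 - d/2 >= 1 - s + s^2/2,
       and (1 + s + s^2/2)(1 - s + s^2/2) = 1 + s^4/4 >= 1. *)
    set (s := x + r). assert (G := exp_ge_quadratic s ltac:(unfold s; lra)).
    assert (Es : E = exp s * (1 - D)) by (unfold E, s; rewrite <- Hq, <- exp_plus; f_equal; ring).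
    assert (G2 : 1 - s + s ^ 2 / 2 <= 1 - d / 2).
    { unfold d. replace x with (s - r) by (unfold s; ring). assert (0 < s) by (unfold s; lra). nra. }
    assert (G3 : 0 < 1 - s + s ^ 2 / 2) by nra.
    assert (G4 : 1 <= (1 + s + s ^ 2 / 2) * (1 - s + s ^ 2 / 2)).
    { assert (0 <= s ^ 2 * s ^ 2) by nra. nra. }
    assert (G5 : (1 + s + s ^ 2 / 2) * (1 - s + s ^ 2 / 2) <= exp s * (1 - d / 2)).
    { apply Rmult_le_compat; try lra. unfold s; nra. }
    rewrite Es. nra. }
  assert (X2 : E ^ 2 < (2 * D - 1) * (3 * D + 1) + (D + 2) * X).
  { assert (HX2 : E * ((D + 2) * (1 - d / 2)) < (D + 2) * X) by nra.
    assert (Hk : 0 <= (2 * D - 1) * (3 * D + 1)) by nra.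
    destruct (Rle_or_lt x 0) as [L|L].
    - assert (E1 : E <= 1).
      { unfold E. rewrite <- exp_0. destruct L as [L|L]; [apply Rlt_le, exp_increasing, L|rewrite L; lra]. }
      assert (P1 : 1 <= (D + 2) * (1 - d / 2)) by nra.
      assert (E * E <= E * 1) by (apply Rmult_le_compat_l; lra).
      assert (E * 1 <= E * ((D + 2) * (1 - d / 2))) by (apply Rmult_le_compat_l; lra). lra.
    - assert (G := exp_diff_ge x r ltac:(lra)). fold E d in G. rewrite Er in G.
      assert (AD : A * (1 - D) = 1).
      { rewrite <- Er, <- Hq, <- exp_plus, Rplus_opp_r; apply exp_0. }
      assert (EA : E < A) by (unfold E; rewrite <- Er; apply exp_increasing; lra).
      (* D < 2/3 gives (D + 2) d / 2 <= 4/3 d <= A - E, which eliminates d. *)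
      assert (B1 : (D + 2) - A <= (D + 2) * (1 - d / 2) - E) by nra.
      (* the extreme case [x = r], where multiplication by [(1 - D)^2] yields a factorization *)
      assert (B2 : 0 <= (2 * D - 1) * (3 * D + 1) + A * ((D + 2) - A)).
      { assert (F : ((2 * D - 1) * (3 * D + 1) + A * ((D + 2) - A)) * (1 - D) ^ 2
          = D ^ 2 * ((2 - 3 * D) * (3 - 2 * D))).
        { transitivity ((2 * D - 1) * (3 * D + 1) * (1 - D) ^ 2 + (A * (1 - D)) * ((D + 2) * (1 - D) - A * (1 - D))); [ring|].
          rewrite AD; ring. }
        assert (0 <= D ^ 2 * ((2 - 3 * D) * (3 - 2 * D))) by (apply Rmult_le_pos; [apply pow2_ge_0|apply Rmult_le_pos; lra]).
        assert (0 < (1 - D) ^ 2) by (apply pow_lt; lra).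
        apply Rmult_le_reg_r with ((1 - D) ^ 2); [assumption|]. rewrite F; lra. }
      (* The expression is affine in E and nonnegative at both ends of [0, A], at E = A by [B2]. *)
      assert (B3 : 0 <= (2 * D - 1) * (3 * D + 1) + E * ((D + 2) - A)).
      { destruct (Rle_or_lt 0 ((D + 2) - A)) as [M|M].
        - assert (0 <= E * ((D + 2) - A)) by (apply Rmult_le_pos; lra). lra.
        - assert (0 <= (A - E) * (A - (D + 2))) by (apply Rmult_le_pos; lra). lra. }
      assert (B4 : E * ((D + 2) - A) <= E * ((D + 2) * (1 - d / 2) - E)) by (apply Rmult_le_compat_l; lra).
      lra. }
  assert (Ef : phi_e a (x, y) = ((2 * D - 1 + X) / (2 * D), Y / (2 * D))).
  { unfold phi_e, Cexp; simpl. fold E X Y. replace (1 - a) with (1 / (2 * D)) by (rewrite Ea; field; lra).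
    rewrite Ea. apply injective_projections; simpl; field; lra. }
  rewrite Ef. split; simpl fst; simpl snd.
  + apply Rmult_lt_reg_r with (2 * D); [lra|]. unfold Rdiv at 2. rewrite Rmult_assoc, Rinv_l by lra. lra.
  + apply Rmult_lt_reg_r with (2 * D ^ 2); [nra|].
    replace (2 * (((2 * D - 1 + X) / (2 * D)) ^ 2 + (Y / (2 * D)) ^ 2) * (2 * D ^ 2))
      with ((2 * D - 1 + X) ^ 2 + Y ^ 2) by (field; lra).
    replace (5 * ((2 * D - 1 + X) / (2 * D)) * (2 * D ^ 2)) with (5 * D * (2 * D - 1 + X)) by (field; lra).
    nra.
Qed.

Theorem theorem4p3 :
  (* (a) *)
  (forall c : R, 3/4 < c <= 1 ->
     is_radius (Sstar (phi_sqrt c)) phi_car (3 / (4 * c))) /\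
  (* (b) *)
  (forall a : R, 0 <= a < 1/2 ->
     is_radius (Sstar (phi_L a)) phi_car ((3 - 4 * a) / (4 * (1 - a) ^ 2))) /\
  (* (c) *)
  (forall a : R, 0 <= a < (exp 1 - 2) / (2 * (exp 1 - 1)) ->
     is_radius (Sstar (phi_e a)) phi_car (ln (2 * (1 - a) / (1 - 2 * a)))) /\
  (* (d) *)
  is_radius (Sstar phi_RL) phi_car ((39 + 17 * sqrt 2) / 82) /\
  (* (e) *)
  is_radius (Sstar phi_C) phi_car (1/2) /\
  (* (f) *)
  is_radius (Sstar phi_lim) phi_car (sqrt 2 - 1) /\
  (* (g) *)
  is_radius (Sstar phi_crescent) phi_car (3/4) /\
  (* (h) *)
  is_radius (Sstar phi_sin) phi_car (asin (1/2)) /\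
  (* (i) *)
  (forall r9 : R,
     0 < r9 < 1 -> 2 * r9 ^ 3 - 6 * r9 + 3 = 0 ->
     (forall r, 0 < r < r9 -> 2 * r ^ 3 - 6 * r + 3 <> 0) ->
     is_radius (Sstar phi_ne) phi_car r9).
Proof.
split; [exact radius_sqrt|]. split; [exact radius_L|]. split; [exact radius_e|].
split; [exact radius_RL|]. split; [exact radius_C|]. split; [exact radius_lim|].
split; [exact radius_crescent|]. split; [exact radius_sin|].
intros r9 Hr E _; exact (radius_ne r9 Hr E).
Qed.
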